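(* Let $\Omega\subseteq\mathbb R^2$ be an open set, let $v\in BV(\Omega;\mathbb R^2)\cap L^\infty(\Omega;\mathbb R^2)$ with $\mathrm{div}\,v\in L^\infty(\Omega)$, and let $\lambda:\Omega\to\mathbb R$ be a measurable function such that $0<c_1\le\lambda\le c_2$ $\mathcal L^2$-a.e. in $\Omega$ for some constants $c_1,c_2$. Let $K\subseteq\Omega$ be a compact subset, let $w\in W^{1,1}(\Omega;\mathbb R^2)$, and let $\varrho>0$ be sufficiently small. Let $\Phi:K\times[-\varrho,\varrho]\to\Omega$ be the regular Lagrangian flow starting from $K$ relative to $v$. For $\mathcal L^2$-a.e. $q\in K$ let $$\sigma_q(s)=\int_0^s\lambda(\Phi(q,\xi))\,d\xi,\qquad s\in[-\varrho,\varrho],$$ let $\tau_q:[\sigma_q(-\varrho),\sigma_q(\varrho)]\to[-\varrho,\varrho]$ be the (bi-Lipschitz, strictly increasing) inverse of $\sigma_q$, and let $\gamma_q(s)=\Phi(q,\tau_q(s))$. Then, for $\mathcal L^2$-a.e. $q\in K$, the curve $w\circ\gamma_q$ belongs to $W^{1,1}((\sigma_q(-\varrho),\sigma_q(\varrho));\mathbb R^2)$, and its weak derivative is $(\nabla w\circ\gamma_q)\,\dot\gamma_q$.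
   Context: The functions $v$, $\lambda$, $w$, $\nabla w$ are defined pointwise by choosing representatives; the result holds for any choice (the exceptional null set of $q$ may depend on it). A regular Lagrangian flow starting from $K$ relative to $v$ is an $\mathcal L^2$-measurable map $\Phi:K\to C([-\varrho,\varrho];\mathbb R^2)$ (sup norm), written $\Phi(q,s)=\Phi(q)(s)$, such that for $\mathcal L^2$-a.e. $q\in K$ one has $\Phi(q,s)=q+\int_0^sv(\Phi(q,\sigma))\,d\sigma$ for all $s\in[-\varrho,\varrho]$, and such that for some constant $m\ge1$, $\frac1m\mathcal L^2(A)\le\mathcal L^2(\Phi(A,s))\le m\,\mathcal L^2(A)$ for all measurable $A\subseteq K$ and all $s\in[-\varrho,\varrho]$. By a theorem of Ambrosio (applied to a bounded $BV$ extension to $\mathbb R^2$, with bounded divergence, of $v$ restricted to a neighbourhood of $K$), for $\varrho$ small such a flow with values in $\Omega$ exists, is unique up to $\mathcal L^2$-null sets of initial points, and $(q,s)\mapsto\Phi(q,s)$ is $\mathcal L^2\times\mathcal L^1$-measurable. *)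

(* Defs.v *)
From HB Require Import structures.
From mathcomp Require Import all_boot all_order all_algebra.
From mathcomp Require Import all_classical all_reals all_analysis.

Set Implicit Arguments.
Unset Strict Implicit.
Unset Printing Implicit Defensive.
Import Order.TTheory GRing.Theory Num.Theory.
Import numFieldNormedType.Exports.
Local Open Scope classical_set_scope.
Local Open Scope ring_scope.

(** [leb1] and [leb2] are the Lebesgue measures on the line and on the plane
    [R * R], on the sigma-algebras of all Lebesgue measurable (not just Borel)
    sets; these are the Caratheodory measurable sets, carried by the aliases
    [line R] of [R] and [plane R] of [R * R]. On a set that is not known to be
    measurable, both return the Lebesgue outer measure. *)
Notation line R := (caratheodory_type (mu_ext (@wlength R idfun))).

Definition leb1 (R : realType) : {measure set (line R) -> \bar R} :=
  @completed_lebesgue_measure R.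

Notation borel_leb2 R := ((@lebesgue_measure R \x @lebesgue_measure R)%E).

Notation plane R := (caratheodory_type (mu_ext (borel_leb2 R))).

Definition leb2 (R : realType) : {measure set (plane R) -> \bar R} :=
  @completed_measure_extension _ _ _ (borel_leb2 R).

Section test_functions.
Context {R : realType} {V : normedModType R}.

(** [V] is finite-dimensional in every use, where this is the usual [C^n]. *)
Fixpoint Cn (n : nat) (f : V -> R^o) : Prop :=
  continuous f /\
  if n is n'.+1 then
    forall e : V, (forall x, derivable f x e) /\ Cn n' (fun x => 'D_e f x)
  else True.

Definition supp (f : V -> R^o) : set V := closure [set x | f x != 0].

Definition test_function (U : set V) (phi : V -> R^o) : Prop :=
  [/\ forall n, Cn n phi, compact (supp phi) & supp phi `<=` U].

End test_functions.

Section plane_spaces.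
Context {R : realType}.
Implicit Types (Omega : set (R * R)) (f g : R * R -> R) (v : R * R -> R * R).

Definition e1 : R * R := (1, 0).
Definition e2 : R * R := (0, 1).

Definition L1 Omega f : Prop :=
  (leb2 R).-integrable Omega (fun x : plane R => (f x)%:E).

Definition Linfty Omega f : Prop :=
  measurable_fun (Omega : set (plane R)) (f : plane R -> R) /\
  exists M : R, {ae leb2 R, forall x, Omega x -> `|f x| <= M}.

(** The distributional derivative of [f] in the direction [e] is a finite
    signed Borel measure, written as a difference of two finite measures. *)
Definition measure_derivative Omega (e : R * R) f : Prop :=
  exists mu nu : {finite_measure set (measurableTypeR R * measurableTypeR R)%type
                                 -> \bar R},
    forall phi : R * R -> R^o, test_function Omega phi ->
      \int[leb2 R]_(x in Omega) (f x * 'D_e phi x) =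
      - (\int[mu]_(x in Omega) phi x - \int[nu]_(x in Omega) phi x).

Definition BV Omega f : Prop :=
  [/\ L1 Omega f, measure_derivative Omega e1 f & measure_derivative Omega e2 f].

Definition BV_vec Omega v : Prop :=
  BV Omega (fun x => (v x).1) /\ BV Omega (fun x => (v x).2).

Definition Linfty_vec Omega v : Prop :=
  Linfty Omega (fun x => (v x).1) /\ Linfty Omega (fun x => (v x).2).

Definition bounded_divergence Omega v : Prop :=
  exists2 d : R * R -> R, Linfty Omega d &
    forall phi : R * R -> R^o, test_function Omega phi ->
      \int[leb2 R]_(x in Omega)
        ((v x).1 * 'D_e1 phi x + (v x).2 * 'D_e2 phi x) =
      - \int[leb2 R]_(x in Omega) (d x * phi x).

Definition weak_partial Omega (e : R * R) f g : Prop :=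
  forall phi : R * R -> R^o, test_function Omega phi ->
    \int[leb2 R]_(x in Omega) (f x * 'D_e phi x) =
    - \int[leb2 R]_(x in Omega) (g x * phi x).

Definition W11_with_gradient Omega f (g1 g2 : R * R -> R) : Prop :=
  [/\ L1 Omega f, L1 Omega g1, L1 Omega g2,
      weak_partial Omega e1 f g1 & weak_partial Omega e2 f g2].

(** [Dw x] is the pair of the columns [(d_1 w (x), d_2 w (x))] of the Jacobian
    matrix of [w] at [x]. *)
Definition W11_vec_with_gradient Omega (w : R * R -> R * R)
    (Dw : R * R -> (R * R) * (R * R)) : Prop :=
  W11_with_gradient Omega (fun x => (w x).1)
    (fun x => (Dw x).1.1) (fun x => (Dw x).2.1) /\
  W11_with_gradient Omega (fun x => (w x).2)
    (fun x => (Dw x).1.2) (fun x => (Dw x).2.2).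

Definition apply_jacobian (J : (R * R) * (R * R)) (h : R * R) : R * R :=
  (h.1 * J.1.1 + h.2 * J.2.1, h.1 * J.1.2 + h.2 * J.2.2).

End plane_spaces.

Section curves.
Context {R : realType}.

Definition L1_itv (I : set R) (f : R -> R) : Prop :=
  (leb1 R).-integrable I (fun t : line R => (f t)%:E).

Definition W11_with_derivative (I : set R) (f g : R -> R) : Prop :=
  [/\ L1_itv I f, L1_itv I g &
      forall phi : R -> R^o, test_function (V := R^o) I phi ->
        \int[leb1 R]_(t in I) (f t * phi^`()%classic t) =
        - \int[leb1 R]_(t in I) (g t * phi t)].

Definition W11_curve_with_derivative (I : set R) (f g : R -> R * R) : Prop :=
  W11_with_derivative I (fun t => (f t).1) (fun t => (g t).1) /\
  W11_with_derivative I (fun t => (f t).2) (fun t => (g t).2).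

(** The oriented integral from 0 to [s]. *)
Definition int0 (f : R -> R) (s : R) : R :=
  if 0 <= s then \int[leb1 R]_(t in `[0, s]) f t
  else - \int[leb1 R]_(t in `[s, 0]) f t.

Definition strictly_increasing_on (A : set R) (f : R -> R) : Prop :=
  forall s t, A s -> A t -> s < t -> f s < f t.

Definition bilipschitz_on (A : set R) (f : R -> R) : Prop :=
  exists k : R, 0 < k /\ forall s t, A s -> A t ->
    k^-1 * `|s - t| <= `|f s - f t| <= k * `|s - t|.

End curves.

Section flow.
Context {R : realType}.
Variables (K : set (R * R)) (rho : R).

(** The second clause is the measurability of [q |-> Phi q] from [K] to
    C([-rho, rho]; R^2): the open sets of the latter are the traces of the open
    sets of [{uniform` `[- rho, rho] -> R * R}]. In the last clause the image of
    [A] need not be assumed measurable, see [leb2]. *)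
Definition regular_lagrangian_flow (v : R * R -> R * R)
    (Phi : R * R -> R -> R * R) : Prop :=
  [/\ forall q, K q -> {within `[- rho, rho], continuous (Phi q)},
      forall O : set {uniform` `[- rho, rho] -> R * R}, open O ->
        measurable ([set q | K q /\ O (Phi q)] : set (plane R)),
      {ae leb2 R, forall q, K q ->
        [/\ L1_itv `[- rho, rho] (fun t => (v (Phi q t)).1),
            L1_itv `[- rho, rho] (fun t => (v (Phi q t)).2) &
            forall s, s \in `[- rho, rho] ->
              Phi q s = q + (int0 (fun t => (v (Phi q t)).1) s,
                             int0 (fun t => (v (Phi q t)).2) s)]} &
      exists2 m : R, 1 <= m &
        forall (A : set (plane R)) (s : R),
          measurable A -> A `<=` K -> s \in `[- rho, rho] ->
          ((m^-1)%:E * leb2 R A <= leb2 R ((Phi ^~ s) @` A))%E /\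
          (leb2 R ((Phi ^~ s) @` A) <= m%:E * leb2 R A)%E].

Variables (Phi : R * R -> R -> R * R) (lambda : R * R -> R) (q : R * R).

Definition sigma (s : R) : R := int0 (fun t => lambda (Phi q t)) s.

(** Inverse of the restriction of [sigma] to [-rho, rho]; its values outside the
    image of that interval are irrelevant. *)
Definition tau : R -> R := 'pinv_(fun=> 0) `[- rho, rho] sigma.

Definition gamma (t : R) : R * R := Phi q (tau t).

End flow.

(* Main.v *)
(** A Sobolev function can be restricted to almost every trajectory because the flow
    pushes the measure [L^2 x L^1] on [K x [-rho, rho]] to a measure bounded by a
    multiple of [L^2]. Hence almost every trajectory meets a given null set of the
    plane only at a null set of times, and [w], [lambda], [v], [Dw] may be replaced by
    Borel representatives along it.

    Fix such a trajectory, with its Lipschitz reparametrization [gamma]. For every [y]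
    the Lipschitz function [t |-> eta_n (gamma t - y) phi t], with [eta_n] a smooth
    kernel and [phi] a test function, has a derivative of integral zero. Integrating
    this against [w y] over the plane, and using [y |-> eta_n (x - y)] as a test
    function for the weak gradient of [w], gives the claim with the mollified [w] and
    [Dw] in place of [w] and [Dw]. The error is at most a constant times the integral
    along [gamma] of [D_n x], the integral over [y] of
    [(|w y - w x| + |Dw y - Dw x|) eta_n (x - y)]. The integral of [D_n] over the plane
    tends to [0], so by the bound on the flow and Fatou's lemma its integrals along
    almost every trajectory tend to [0] on a subsequence. *)
Require Import Defs.
From HB Require Import structures.
From mathcomp Require Import all_boot all_order all_algebra.
From mathcomp Require Import all_classical all_reals all_analysis.
From mathcomp Require Import measurable_realfun ring lra.
Set Implicit Arguments.
Unset Strict Implicit.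
Unset Printing Implicit Defensive.
Import Order.TTheory GRing.Theory Num.Theory.
Import numFieldNormedType.Exports.
Local Open Scope classical_set_scope.
Local Open Scope ring_scope.

(** * Mollifiers that are test functions *)

(** The exceptional set of initial points must not depend on the test function, and test functions
    form an uncountable family. Hence the shape of the error bound: a constant depending on [phi]
    times an integral of [D_n] along the trajectory in which [phi] does not occur. The null set is
    fixed first, and every [phi] is treated on the trajectories that remain. A vanishing liminf
    provides arbitrarily late [n] with small error, and the mollified identity holds for all late
    [n], so a common [n] exists. Lipschitz functions occur as primitives of bounded measurable
    densities, and their calculus is one of densities; differentiability of a trajectory at almost
    every time serves to recognize its density as its velocity. The kernel is a product of kernels
    on the line, so that the convergence of [D_n] reduces to Lebesgue points on the line. Two
    sigma-algebras coexist on the plane. Initial points carry the completed one, for which the flow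
    is measurable; the values of the flow carry the Borel one, since only Borel functions compose
    with it. *)

Section flat_exponential.
Context {R : realType}.
Implicit Types (p : {poly R}) (x : R).

(** Polynomials in [1/x] are allowed in front of [exp (- 1/x)] so that the family is
    closed under derivation. *)
Definition flat_exp p x : R :=
  if 0 < x then p.[x^-1] * expR (- x^-1) else 0.

(** The bound [u ^ (i+1) / (i+1)! <= expR u] is applied to each monomial of degree [i]; the spare
    factor [u] becomes the decay [1 / u]. *)
Lemma poly_expRN_bound p :
  exists2 C : R, 0 <= C & forall u, 0 < u -> `|p.[u] * expR (- u)| <= C / u.
Proof.
exists (\sum_(i < size p) `|p`_i| * (i.+1)`!%:R).
  by apply: sumr_ge0 => i _; rewrite mulr_ge0.
move=> u u0; rewrite normrM [X in _ * X]gtr0_norm ?expR_gt0// expRN.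
rewrite ler_pdivrMr ?expR_gt0// mulrAC ler_pdivlMr//.
apply: (@le_trans _ _ ((\sum_(i < size p) `|p`_i * u ^+ i|) * u)).
  by rewrite horner_coef ler_wpM2r ?(ltW u0)// ler_norm_sum.
rewrite !mulr_suml; apply: ler_sum => i _.
rewrite normrM -!mulrA ler_wpM2l// ger0_norm ?exprn_ge0 ?(ltW u0)// -exprSr.
have := expR_ge1Dxn i (ltW u0).
rewrite -ler_pdivrMl ?ltr0n ?fact_gt0// => H;
apply: le_trans H.
by rewrite mulrC lerDr.
Qed.

(** In the variable [u = 1/x], with [du/dx = - u^2], the derivative of [p(u) exp (- u)] is
    [u^2 (p - p')(u) exp (- u)]. *)
Definition flat_exp_deriv p : {poly R} := (p - p^`()) * 'X^2.

Lemma is_derive_flat_exp p x :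
  is_derive x 1 (flat_exp p) (flat_exp (flat_exp_deriv p) x).
Proof.
have [x0|x0|->] := ltgtP x 0.
- rewrite /flat_exp ltNge (ltW x0)/=.
  apply: (@near_eq_is_derive _ _ _ (cst 0)) => //.
    near=> y; rewrite /= /flat_exp ltNge (ltW _)//.
    by near: y; exact: lt_nbhsl.
- rewrite {2}/flat_exp x0.
  apply: (@near_eq_is_derive _ _ _ (fun x => p.[x^-1] * expR (- x^-1))) => //.
    near=> y; rewrite /flat_exp ifT//.
    by near: y; exact: lt_nbhsr.
  have dV : is_derive x 1 (fun x : R => x^-1) (- x ^- 2 : R).
    have := @is_deriveV R id x 1 1.
    by rewrite scaler1; apply => //; rewrite gt_eqF.
  have dp : is_derive x 1 (fun x => p.[x^-1]) (- x ^- 2 * p^`().[x^-1]).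
    have := @is_derive1_comp R (horner p) (fun x => x^-1) x (p^`().[x^-1]) (- x ^- 2).
    by rewrite mulrC; exact.
  have de : is_derive x 1 (fun x : R => expR (- x^-1)) (x ^- 2 * expR (- x^-1)).
    have := @is_derive1_comp R expR (fun x => - x^-1) x (expR (- x^-1)) (x ^- 2).
    rewrite mulrC; apply => //.
    by apply: is_derive_eq; rewrite opprK.
  apply: is_derive_eq.
  rewrite /flat_exp_deriv hornerM hornerXn hornerD hornerN exprVn /GRing.scale/=.
  by field; rewrite gt_eqF.
(* At [0] the difference quotient is [p(1/h) (1/h) exp (- 1/h)] for [h > 0] and [0] otherwise; the
   bound for [p * 'X] makes it at most [C h]. *)
- have [C C0 Cp] := poly_expRN_bound (p * 'X).
  have flat0 q : flat_exp q 0 = 0 by rewrite /flat_exp ltxx.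
  rewrite flat0.
  have cvg0 : h^-1 *: (flat_exp p (h *: 1 + 0) - flat_exp p 0) @[h --> (0:R)^'] --> 0.
    apply/cvgr0Pnorm_le => e e0; near=> h.
    rewrite flat0 subr0 addr0 [h *: 1]mulr1 /flat_exp; case: ifPn => h0; last first.
      by rewrite scaler0 normr0 ltW.
    have := Cp h^-1; rewrite invr_gt0 => /(_ h0); rewrite hornerMX invrK.
    rewrite -mulrAC mulrC; move=> /le_trans; apply.
    apply: (@le_trans _ _ ((C + 1) * `|h|)).
      by rewrite gtr0_norm// ler_wpM2r ?ltW// ltrDl.
    rewrite -ler_pdivlMl ?ltr_wpDl//; near: h.
    by apply: dnbhs0_le; rewrite mulr_gt0// invr_gt0 ltr_wpDl.
  by apply: DeriveDef; [apply/cvg_ex; exists 0|exact/cvg_lim].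
Unshelve. all: by end_near.
Qed.

End flat_exponential.

Lemma is_derive_line {R : realType} {V W : normedModType R} (f : V -> W) (x e : V)
    (d : W) :
  is_derive (0 : R^o) 1 (fun t : R^o => f (t *: e + x)) d -> is_derive x e f d.
Proof.
move=> [/(derivable1P f x e).2 df <-]; apply: DeriveDef => //.
rewrite /derive; set F := (X in lim (fmap X _)); set G := (X in _ = lim (fmap X _)).
suff -> : F = G by [].
apply/funext => h; rewrite /F /G/=.
by rewrite addr0 scale0r add0r [h *: 1]mulr1.
Qed.

Section smooth_functions.
Context {R : realType}.

(** A class closed under directional derivatives, on which [Cn n] is proved by
    induction on [n] alone. *)
Inductive smooth_gen : (R * R -> R^o) -> Prop :=
| smooth_flat p a b c : smooth_gen (fun y => flat_exp p (a * y.1 + b * y.2 + c))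
| smoothD f g : smooth_gen f -> smooth_gen g -> smooth_gen (f \+ g)
| smoothM f g : smooth_gen f -> smooth_gen g -> smooth_gen (f \* g)
| smoothZ k f : smooth_gen f -> smooth_gen (fun y => k * f y).

Lemma smooth_gen_continuous f : smooth_gen f -> continuous f.
Proof.
elim=> [p a b c|g h _ gc _ hc|g h _ gc _ hc|k g _ gc] x.
- apply: (@continuous_comp _ _ _ (fun y : R * R => a * y.1 + b * y.2 + c) (flat_exp p)).
    apply: cvgD; last exact: cvg_cst.
    by apply: cvgD; apply: cvgM; [exact: cvg_cst|exact: cvg_fst|exact: cvg_cst|exact: cvg_snd].
  apply: differentiable_continuous; apply/derivable1_diffP.
  by case: (is_derive_flat_exp p (a * x.1 + b * x.2 + c)).
- by apply: cvgD; [exact: gc|exact: hc].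
- by apply: cvgM; [exact: gc|exact: hc].
- by apply: cvgM; [exact: cvg_cst|exact: gc].
Qed.

Lemma smooth_gen_derive f e : smooth_gen f ->
  exists2 g, smooth_gen g & forall x, is_derive x e f (g x).
Proof.
elim=> [p a b c|g h _ [g' sg gg'] _ [h' sh hh']|g h sg [g' sg' gg'] sh [h' sh' hh']
  |k g _ [g' sg gg']].
- exists (fun y => (a * e.1 + b * e.2) * flat_exp (flat_exp_deriv p) (a * y.1 + b * y.2 + c)).
    exact/smoothZ/smooth_flat.
  move=> x; apply: is_derive_line => /=.
  have := @is_derive1_comp R (flat_exp p)
    (fun t => t * (a * e.1 + b * e.2) + (a * x.1 + b * x.2 + c)) 0
    (flat_exp (flat_exp_deriv p) (a * x.1 + b * x.2 + c)) (a * e.1 + b * e.2).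
  rewrite mul0r add0r [X in is_derive _ _ (_ \o _) X]mulrC => H.
  have {}H := H (is_derive_flat_exp _ _).
  rewrite (_ : (fun t => _) = flat_exp p \o
       (fun t => t * (a * e.1 + b * e.2) + (a * x.1 + b * x.2 + c))); last first.
    apply/funext => t /=; congr flat_exp; rewrite /GRing.scale/=; ring.
  apply: H.
  apply: is_derive_eq.
  rewrite scaler0 add0r addr0 /GRing.scale/= mulr1//.
- exists (g' \+ h'); first exact: smoothD.
  by move=> x; apply: is_deriveD.
- exists ((g \* h') \+ (h \* g')); first by apply: smoothD; exact: smoothM.
  by move=> x; apply: is_deriveM.
- exists (fun y => k * g' y); first exact: smoothZ.
  by move=> x; apply: is_deriveZ.
Qed.

Lemma smooth_gen_Cn f n : smooth_gen f -> Cn n f.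
Proof.
elim: n f => [|n ih] f sf; split; try exact: smooth_gen_continuous.
- by [].
- move=> e; have [g sg fg] := smooth_gen_derive e sf.
  split=> [x|]; first by case: (fg x).
  rewrite (_ : (fun x => _) = g); first exact: ih.
  by apply/funext => x; case: (fg x).
Qed.

End smooth_functions.

Section mollifier_kernel.
Context {R : realType}.
Local Notation mu := (@lebesgue_measure R).
Implicit Types (n : nat) (u x y : R).

Lemma flat_exp_continuous (p : {poly R}) : continuous (flat_exp p).
Proof.
move=> x; apply: differentiable_continuous; apply/derivable1_diffP.
by case: (is_derive_flat_exp p x).
Qed.

(** On []-1, 1[] this is [exp (- 2 / (1 - u^2))], because [1/(1+u) + 1/(1-u) = 2/(1-u^2)]. Only flat
    exponentials of affine functions occur, so the kernels built from it in two variables belong to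
    [smooth_gen]. *)
Definition bump u : R := flat_exp 1 (1 + u) * flat_exp 1 (1 - u).

Lemma bump_ge0 u : 0 <= bump u.
Proof.
rewrite /bump /flat_exp; apply: mulr_ge0; case: ifPn => // _;
by rewrite hornerC mul1r expR_ge0.
Qed.

Lemma bump_le1 u : bump u <= 1.
Proof.
have flat_le1 (x : R) : 0 <= flat_exp 1 x <= 1.
  rewrite /flat_exp; case: ifPn => [x0|]; last by rewrite lexx ler01.
  by rewrite hornerC mul1r expR_ge0 expR_le1 oppr_le0 invr_ge0 ltW.
rewrite /bump mulr_ile1//;
  first [by case/andP: (flat_le1 (1 + u)) | by case/andP: (flat_le1 (1 - u))].
Qed.

Lemma bump_eq0 u : 1 <= `|u| -> bump u = 0.
Proof.
move=> u1; rewrite /bump /flat_exp; case: ifPn => [|_]; last by rewrite mul0r.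
case: ifPn => [|_]; last by rewrite mulr0.
move=> a b; move: u1; rewrite real_ler_normr ?num_real// => /orP[]; lra.
Qed.

Lemma bumpN u : bump (- u) = bump u.
Proof. by rewrite /bump opprK mulrC. Qed.

Lemma bump_continuous : continuous bump.
Proof.
move=> x; apply: cvgM.
  apply: (continuous_comp (f := fun u => 1 + u) (g := flat_exp 1)).
    by apply: cvgD; [exact: cvg_cst|exact: cvg_id].
  exact: flat_exp_continuous.
apply: (continuous_comp (f := fun u => 1 - u) (g := flat_exp 1)).
  by apply: cvgB; [exact: cvg_cst|exact: cvg_id].
exact: flat_exp_continuous.
Qed.

(** Both [1 + u] and [1 - u] are at least [1/2], so each factor is at least [exp (- 2)]. This makes
    the mass of [bump] positive. *)
Lemma bump_lb u : `|u| <= 2^-1 -> expR (- 4) <= bump u.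
Proof.
move=> u1.
have u2 : - 2^-1 <= u <= 2^-1 by rewrite -ler_norml.
have h x : 2^-1 <= x -> expR (- 2) <= flat_exp 1 x.
  move=> x2; rewrite /flat_exp ifT; last lra.
  rewrite hornerC mul1r ler_expR lerN2 invf_ple ?posrE//; lra.
rewrite /bump (_ : - 4 = (-2) + (-2)); last by ring.
rewrite expRD; apply: ler_pM; rewrite ?expR_ge0//; apply: h; lra.
Qed.

Lemma measurable_bump : measurable_fun setT bump.
Proof. apply: continuous_measurable_fun; exact: bump_continuous. Qed.

Definition bump_mass : R := fine (\int[mu]_u (bump u)%:E)%E.

Lemma integral_bump : (\int[mu]_u (bump u)%:E)%E = bump_mass%:E.
Proof.
rewrite fineK// ge0_fin_numE; last by apply: integral_ge0 => u _; rewrite lee_fin bump_ge0.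
apply: (@le_lt_trans _ _ (\int[mu]_u (\1_(`[-1, 1]) u)%:E)%E).
  apply: ge0_le_integral => //.
  - by move=> u _; rewrite lee_fin bump_ge0.
  - by apply/measurable_EFinP; exact: measurable_bump.
  - by apply/measurable_EFinP; exact: measurable_indic.
  - move=> u _; rewrite lee_fin indicE; case: (boolP (_ \in _)); rewrite ?bump_le1//=.
    rewrite notin_setE/= in_itv/= => /negP; rewrite -ler_norml -ltNge => /ltW.
    by move/bump_eq0 ->.
rewrite integral_indic// setIT. rewrite [X in (X < _)%E]lebesgue_measure_itv/=; case: ifPn => // _.
by rewrite ltry.
Qed.

Lemma bump_mass_gt0 : 0 < bump_mass.
Proof.
rewrite -lte_fin -integral_bump; apply: (@lt_le_trans _ _
  (\int[mu]_u (expR (- 4) * \1_(`[- 2^-1, 2^-1]) u)%:E)%E).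
  under eq_integral do rewrite EFinM.
  rewrite ge0_integralZl//; last by apply/measurable_EFinP; exact: measurable_indic.
  rewrite integral_indic// setIT [X in (_ < _ * X)%E]lebesgue_measure_itv/= lte_fin ifT; last lra.
  by rewrite -EFinB -EFinM lte_fin mulr_gt0 ?expR_gt0//; lra.
apply: ge0_le_integral => //.
- by apply/measurable_EFinP; apply: measurable_funM => //; exact: measurable_indic.
- by apply/measurable_EFinP; exact: measurable_bump.
- move=> u _; rewrite lee_fin indicE; case: (boolP (_ \in _)) => [|_]; last first.
    by rewrite mulr0 bump_ge0.
  by rewrite inE/= in_itv/= -ler_norml mulr1 => /bump_lb.
Qed.

Definition mol n u : R := n.+1%:R / bump_mass * bump (n.+1%:R * u).

Lemma mol_ge0 n u : 0 <= mol n u.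
Proof. by rewrite mulr_ge0 ?bump_ge0// divr_ge0// (ltW bump_mass_gt0). Qed.

Lemma mol_le n u : mol n u <= n.+1%:R / bump_mass.
Proof.
by rewrite ler_piMr ?bump_le1// divr_ge0// (ltW bump_mass_gt0).
Qed.

Lemma mol_eq0 n u : n.+1%:R^-1 <= `|u| -> mol n u = 0.
Proof.
move=> nu; rewrite /mol bump_eq0 ?mulr0// normrM ger0_norm//.
by rewrite -ler_pdivrMl// mulr1.
Qed.

Lemma molN n u : mol n (- u) = mol n u.
Proof. by rewrite /mol mulrN bumpN. Qed.

Lemma mol_continuous n : continuous (mol n).
Proof.
move=> x; apply: cvgM; first exact: cvg_cst.
apply: (continuous_comp (f := fun u => n.+1%:R * u) (g := bump)).
  by apply: cvgM; [exact: cvg_cst|exact: cvg_id].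
exact: bump_continuous.
Qed.

Lemma measurable_mol n : measurable_fun setT (mol n).
Proof. apply: continuous_measurable_fun; exact: mol_continuous. Qed.

Lemma integral_mol n x : (\int[mu]_y (mol n (x - y))%:E)%E = 1%E.
Proof.
have n0 : n.+1%:R != 0 :> R by rewrite pnatr_eq0.
have dF y : is_derive y 1 (fun y => n.+1%:R * (y - x)) (n.+1%:R : R).
  by apply: is_derive_eq; rewrite /GRing.scale/= subr0 mulr1 ?mulr0 ?addr0.
have F' : (fun y => n.+1%:R * (y - x))^`()%classic = cst (n.+1%:R : R).
  by apply/funext => y; rewrite derive1E; case: (dF y).
(* The substitution is [u = (n+1) (y - x)]; evenness of [bump] accounts for the order [x - y] in the
   statement. *)
have := @increasing_ge0_integration_by_substitutionT R (fun y => n.+1%:R * (y - x))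
  (fun u => bump u / bump_mass).
rewrite F' => /(_ _ _ _ _ _ _ _ _ _) E.
transitivity (\int[mu]_u (bump u / bump_mass)%:E)%E.
  rewrite E.
  - apply: eq_integral => y _; congr EFin; rewrite /mol /= -[x - y]opprB mulrN bumpN.
    by rewrite fctE /= [LHS]mulrC mulrA [RHS]mulrAC.
  - by move=> a b ab; rewrite ltr_pM2l// ltrD2r.
  - by move=> y; apply: cvg_cst.
  - exact: is_cvg_cst.
  - exact: is_cvg_cst.
  - by move=> y; case: (dF y).
  - apply/cvgrNyPle => A; near=> y.
    by rewrite -ler_pdivlMl// lerBlDr; near: y; apply: nbhs_ninfty_le; exact: num_real.
  - apply/cvgryPge => A; near=> y.
    by rewrite -ler_pdivrMl// lerBrDr; near: y; apply: nbhs_pinfty_ge; exact: num_real.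
  - by move=> y; apply: cvgM; [exact: bump_continuous|exact: cvg_cst].
  - by move=> y; rewrite divr_ge0 ?bump_ge0// (ltW bump_mass_gt0).
under eq_integral do rewrite EFinM muleC.
rewrite ge0_integralZl//; last 3 first.
- by apply/measurable_EFinP; exact: measurable_bump.
- by move=> u _; rewrite lee_fin bump_ge0.
- by rewrite lee_fin invr_ge0 (ltW bump_mass_gt0).
by rewrite integral_bump -EFinM mulVf ?gt_eqF// bump_mass_gt0.
Unshelve. all: by end_near.
Qed.
End mollifier_kernel.

Section mollifier_test_functions.
Context {R : realType}.
Implicit Types (n : nat) (u : R) (x y : R * R).

Definition dmol n u : R := n.+1%:R / bump_mass *
  (n.+1%:R * (flat_exp (flat_exp_deriv 1) (1 + n.+1%:R * u) * flat_exp 1 (1 - n.+1%:R * u)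
   - flat_exp 1 (1 + n.+1%:R * u) * flat_exp (flat_exp_deriv 1) (1 - n.+1%:R * u))).

Lemma is_derive_mol n u : is_derive u 1 (mol n) (dmol n u).
Proof.
have d1 : is_derive u 1 (fun u => flat_exp 1 (1 + n.+1%:R * u))
    (flat_exp (flat_exp_deriv 1) (1 + n.+1%:R * u) * n.+1%:R).
  apply: (@is_derive1_comp R (flat_exp 1) (fun u => 1 + n.+1%:R * u)).
    exact: is_derive_flat_exp.
  by apply: is_derive_eq; rewrite /GRing.scale/=; ring.
have d2 : is_derive u 1 (fun u => flat_exp 1 (1 - n.+1%:R * u))
    (flat_exp (flat_exp_deriv 1) (1 - n.+1%:R * u) * - n.+1%:R).
  apply: (@is_derive1_comp R (flat_exp 1) (fun u => 1 - n.+1%:R * u)).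
    exact: is_derive_flat_exp.
  by apply: is_derive_eq; rewrite /GRing.scale/=; ring.
rewrite /mol /bump; apply: is_derive_eq; rewrite /GRing.scale/= /dmol; ring.
Qed.

Lemma dmol_continuous n : continuous (dmol n).
Proof.
have c (p : {poly R}) (a : R) : continuous (fun u => flat_exp p (1 + a * u)).
  move=> u; apply: (continuous_comp (f := fun u => 1 + a * u) (g := flat_exp p)).
    by apply: cvgD; [exact: cvg_cst|apply: cvgM; [exact: cvg_cst|exact: cvg_id]].
  exact: flat_exp_continuous.
move=> u; apply: cvgM; first exact: cvg_cst.
apply: cvgM; first exact: cvg_cst.
have cN (p : {poly R}) : continuous (fun u => flat_exp p (1 - n.+1%:R * u)).
  by under eq_fun do rewrite -mulNr; exact: c.
by apply: cvgB; apply: cvgM; [exact: c|exact: cN|exact: c|exact: cN].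
Qed.

Lemma dmol_eq0 n u : n.+1%:R^-1 <= `|u| -> dmol n u = 0.
Proof.
move=> nu; have {nu} : 1 <= `|n.+1%:R * u|.
  by rewrite normrM ger0_norm// -ler_pdivrMl// mulr1.
rewrite /dmol; move: (_ * u) => {u} u u1.
rewrite /flat_exp; case: (ltP 0 (1 + u)) => h1; rewrite ?mul0r ?subrr ?mulr0//.
case: (ltP 0 (1 - u)) => h2; rewrite ?mul0r ?subrr ?mulr0 ?subrr ?mulr0//.
move: u1; rewrite real_ler_normr ?num_real// => /orP[]; lra.
Qed.

Lemma dmol_bounded n : exists D, forall u, `|dmol n u| <= D.
Proof.
have : compact ([set dmol n u | u in `[-1, 1]] : set R^o).
  apply: continuous_compact; last exact: segment_compact.
  by apply: continuous_subspaceT; exact: dmol_continuous.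
move=> /compact_bounded[M [_ /(_ (`|M| + 1))]].
move=> /(_ (ltr_pwDr ltr01 (ler_norm M))) H.
exists (`|M| + 1) => u; have [u1|u1] := leP `|u| 1.
  by apply: H; exists u => //=; rewrite in_itv/= -ler_norml.
rewrite dmol_eq0 ?normr0 ?addr_ge0//.
by apply: le_trans (ltW u1); rewrite invf_le1// ler1n.
Qed.

(** A product rather than a radial kernel: iterated integrals split into integrals on the line, and
    the support is a ball of the sup norm of [R * R]. *)
Definition mol2 n x y : R := mol n (x.1 - y.1) * mol n (x.2 - y.2).

Lemma smooth_mol2 n x : smooth_gen (mol2 n x : R * R -> R^o).
Proof.
have fe (p : {poly R}) a b c d : smooth_gen (fun y : R * R => flat_exp p (a + b * (c * (d - y.1)))).
  rewrite (_ : (fun _ => _) = fun y => flat_exp p (- (b * c) * y.1 + 0 * y.2 + (a + b * c * d))).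
    exact: smooth_flat.
  by apply/funext => y; congr flat_exp; ring.
have fe2 (p : {poly R}) a b c d :
    smooth_gen (fun y : R * R => flat_exp p (a + b * (c * (d - y.2)))).
  rewrite (_ : (fun _ => _) = fun y => flat_exp p (0 * y.1 + - (b * c) * y.2 + (a + b * c * d))).
    exact: smooth_flat.
  by apply/funext => y; congr flat_exp; ring.
rewrite (_ : mol2 n x =
  (fun y => n.+1%:R / bump_mass * (flat_exp 1 (1 + 1 * (n.+1%:R * (x.1 - y.1))) *
    flat_exp 1 (1 + (-1) * (n.+1%:R * (x.1 - y.1))))) \*
  (fun y => n.+1%:R / bump_mass * (flat_exp 1 (1 + 1 * (n.+1%:R * (x.2 - y.2))) *
    flat_exp 1 (1 + (-1) * (n.+1%:R * (x.2 - y.2))))))//; last first.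
  by apply/funext => y /=; rewrite /mol2 /mol /bump !mul1r !mulN1r.
by apply: smoothM; apply: smoothZ; apply: smoothM.
Qed.

Lemma mol2_eq0 n x y : n.+1%:R^-1 <= `|x - y| -> mol2 n x y = 0.
Proof.
rewrite /mol2 prod_normE/= le_max => /orP[] /mol_eq0 ->; by rewrite ?mulr0 ?mul0r.
Qed.

Lemma mol2_test_function (Omega : set (R * R)) n x :
  (forall y, `|x - y| <= n.+1%:R^-1 -> Omega y) ->
  test_function Omega (mol2 n x : R * R -> R^o).
Proof.
move=> xO.
have sB : supp (mol2 n x : R * R -> R^o) `<=` closed_ball x n.+1%:R^-1.
  rewrite /supp [X in _ `<=` X](closure_id _).1; last exact: closed_ball_closed.
  apply: closureS => y /= my; rewrite closed_ballE//= /closed_ball_/=.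
  by rewrite leNgt; apply: contra my => /ltW /mol2_eq0 ->.
split.
- by move=> k; exact/smooth_gen_Cn/smooth_mol2.
- apply: (@subclosed_compact _ _ (closed_ball x n.+1%:R^-1)) => //.
    exact: closed_closure.
  (* A closed ball of the sup norm is a product of two segments, hence compact. *)
  rewrite (_ : closed_ball _ _ =
      `[x.1 - n.+1%:R^-1, x.1 + n.+1%:R^-1]%classic `*`
      `[x.2 - n.+1%:R^-1, x.2 + n.+1%:R^-1]%classic).
    by apply: compact_setX; exact: segment_compact.
  rewrite closed_ballE//; apply/seteqP; split => y;
    rewrite /closed_ball_/= prod_normE/= ge_max !ler_distlC !in_itv/=.
    by move/andP.
  by move=> [-> ->].
- apply: (subset_trans sB) => y; rewrite closed_ballE//=; exact: xO.
Qed.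

Lemma derive_mol2_e1 n x y :
  'D_e1 (mol2 n x : R * R -> R^o) y = - (dmol n (x.1 - y.1) * mol n (x.2 - y.2)).
Proof.
suff [] : is_derive y e1 (mol2 n x : R * R -> R^o)
  (- (dmol n (x.1 - y.1) * mol n (x.2 - y.2))) by [].
apply: is_derive_line.
have d1 : is_derive (0 : R) 1 (fun t => mol n (x.1 - (t + y.1)))
    (dmol n (x.1 - y.1) * - 1).
  apply: (@is_derive1_comp R (mol n) (fun t => x.1 - (t + y.1)) 0
    (dmol n (x.1 - y.1)) (- 1)).
    by rewrite add0r; exact: is_derive_mol.
  by apply: is_derive_eq; ring.
rewrite (_ : (fun t => _) =
    fun t : R => mol n (x.1 - (t + y.1)) * mol n (x.2 - y.2)); last first.
  by apply/funext => t; rewrite /mol2/= [t *: 1]mulr1 [t *: 0]mulr0 add0r.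
by apply: is_derive_eq; rewrite /GRing.scale/=; ring.
Qed.

Lemma derive_mol2_e2 n x y :
  'D_e2 (mol2 n x : R * R -> R^o) y = - (mol n (x.1 - y.1) * dmol n (x.2 - y.2)).
Proof.
suff [] : is_derive y e2 (mol2 n x : R * R -> R^o)
  (- (mol n (x.1 - y.1) * dmol n (x.2 - y.2))) by [].
apply: is_derive_line.
have d1 : is_derive (0 : R) 1 (fun t => mol n (x.2 - (t + y.2)))
    (dmol n (x.2 - y.2) * - 1).
  apply: (@is_derive1_comp R (mol n) (fun t => x.2 - (t + y.2)) 0
    (dmol n (x.2 - y.2)) (- 1)).
    by rewrite add0r; exact: is_derive_mol.
  by apply: is_derive_eq; ring.
rewrite (_ : (fun t => _) =
    fun t : R => mol n (x.1 - y.1) * mol n (x.2 - (t + y.2))); last first.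
  by apply/funext => t; rewrite /mol2/= [t *: 1]mulr1 [t *: 0]mulr0 add0r.
by apply: is_derive_eq; rewrite /GRing.scale/=; ring.
Qed.

End mollifier_test_functions.

(** * Mollification in the mean *)

Section mollifier_error_line.
Context {R : realType}.
Local Notation mu := (@lebesgue_measure R).
Local Notation B := (measurableTypeR R).
Implicit Types (h : R -> R) (n : nat).

(** The mean oscillation is preferred to the difference with the mollified function: being
    nonnegative, it needs no integrability for Tonelli's theorem, and the triangle inequality
    applies under the integral. *)
Definition mol_err1 n h (x : R) : \bar R :=
  (\int[mu]_y (`|h y - h x| * mol n (x - y))%:E)%E.

Lemma measurable_mol_sub n : measurable_fun setT (fun z : B * B => mol n (z.1 - z.2)).
Proof.
apply: measurableT_comp; first exact: measurable_mol.
by apply: measurable_funB; [exact: measurable_fst|exact: measurable_snd].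
Qed.

Lemma measurable_mol_err1_integrand n h : measurable_fun setT (h : B -> R) ->
  measurable_fun setT (fun z : B * B => (`|h z.2 - h z.1| * mol n (z.1 - z.2))%:E).
Proof.
move=> mh; apply/measurable_EFinP; apply: measurable_funM; last exact: measurable_mol_sub.
apply: measurableT_comp => //; apply: measurable_funB.
  by apply: measurableT_comp => //; exact: measurable_snd.
by apply: measurableT_comp => //; exact: measurable_fst.
Qed.

Lemma mol_err1_ge0 n h x : (0 <= mol_err1 n h x)%E.
Proof. by apply: integral_ge0 => y _; rewrite lee_fin mulr_ge0// mol_ge0. Qed.

Lemma measurable_mol_err1 n h : measurable_fun setT (h : B -> R) ->
  measurable_fun setT (mol_err1 n h : B -> \bar R).
Proof.
move=> mh; have := measurable_fun_fubini_tonelli_F (m2 := mu) _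
  (measurable_mol_err1_integrand n mh); apply.
by move=> z; rewrite lee_fin mulr_ge0// mol_ge0.
Qed.

(** The kernel is at most [(n+1) / bump_mass] and lives on a ball of length [2 / (n+1)], so the
    error is at most [2 / bump_mass] times the mean deviation over this ball, which tends to [0] at
    a Lebesgue point. *)
Lemma mol_err1_lebesgue_pt h x : measurable_fun setT (h : B -> R) ->
  lebesgue_pt h x -> mol_err1 n h x @[n --> \oo] --> 0%E.
Proof.
move=> mh hx.
have cvg_davg : davg h x n.+1%:R^-1 @[n --> \oo] --> 0%E.
  apply: (cvg_comp _ _ _ hx).
  move=> A [e /= e0 eA]; near=> n; apply: eA => //=.
  rewrite distrC subr0 ger0_norm//; near: n.
  exact: (near_infty_natSinv_lt (PosNum e0)).
have m0 := @bump_mass_gt0 R.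
have le_davg n : (mol_err1 n h x <= (2 / bump_mass)%:E * davg h x n.+1%:R^-1)%E.
  have mc : measurable_fun setT (fun y : B => `|h y - h x|).
    by apply: measurableT_comp => //; apply: measurable_funB.
  have mB : measurable (ball x n.+1%:R^-1 : set B) by exact: measurable_ball.
  rewrite /davg /iavg lebesgue_measure_ball// inver.
  rewrite mulrn_eq0/= invr_eq0 pnatr_eq0/= muleA -EFinM.
  rewrite (_ : 2 / bump_mass * _ = n.+1%:R / bump_mass); last first.
    by rewrite -mulr_natl; field; rewrite (gt_eqF m0) ?andbT//= addrC natr1 pnatr_eq0.
  rewrite -ge0_integralZl//; last 2 first.
  - by apply/measurable_EFinP; apply: measurable_funTS; exact: mc.
  - by rewrite lee_fin divr_ge0// ltW.
  rewrite [leRHS]integral_mkcond; apply: ge0_le_integral => //.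
  - by move=> y _; rewrite lee_fin mulr_ge0// mol_ge0.
  - by apply: (measurable_fun_pair2 x (measurable_mol_err1_integrand n mh)).
  - apply: (iffLR (measurable_restrictT _ mB)); apply: measurable_funeM; apply/measurable_EFinP.
    by apply: measurable_funTS; exact: mc.
  - move=> y _; rewrite patchE; case: ifPn => [_|].
      by rewrite /= -EFinM lee_fin [leRHS]mulrC ler_wpM2l// mol_le.
    rewrite notin_setE /ball/= => /negP; rewrite -leNgt => /mol_eq0 ->.
    by rewrite mulr0.
apply: (@squeeze_cvge _ _ _ _ (cst 0%E) _ (fun n => (2 / bump_mass)%:E * davg h x n.+1%:R^-1)%E).
- by near=> n; rewrite /= mol_err1_ge0 le_davg.
- exact: cvg_cst.
- rewrite -[X in _ --> X](mule0 (2 / bump_mass)%:E).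
  by apply: cvgeZl.
Unshelve. all: by end_near.
Qed.

Lemma locally_integrable_bounded h (M : R) : measurable_fun setT (h : B -> R) ->
  (forall x, `|h x| <= M) -> locally_integrable setT h.
Proof.
move=> mh hM; split => //; first exact: openT.
move=> K _ cK; have mK : measurable (K : set B) by exact: compact_measurable.
apply: (@le_lt_trans _ _ (\int[mu]_(x in K) (cst M%:E) x)%E).
  apply: ge0_le_integral => //.
  - by apply/measurable_EFinP; apply: measurableT_comp => //; exact: measurable_funTS.
  - by move=> x _; rewrite lee_fin.
rewrite integral_cst// ltey_eq fin_numM//.
by rewrite ge0_fin_numE// compact_finite_measure.
Qed.

(** Almost every point is a Lebesgue point, and the convergence is dominated: the kernel has radius
    at most [1], so the error vanishes beyond [N + 1], and it is at most [2 M] elsewhere. *)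
Lemma mol_err1_cvg_bounded h (M N : R) : measurable_fun setT (h : B -> R) ->
  (forall x, `|h x| <= M) -> (forall x, N < `|x| -> h x = 0) ->
  (\int[mu]_x mol_err1 n h x)%E @[n --> \oo] --> 0%E.
Proof.
move=> mh hM hN.
have M0 : 0 <= M by exact: le_trans (hM 0).
set g : B -> \bar R := fun x => (2 * M * \1_(`[- (N + 1), N + 1]) x)%:E.
have ig : mu.-integrable setT g.
  rewrite (_ : g = fun x => ((2 * M)%:E * (EFin \o \1_(`[(- (N + 1))%R, (N + 1)%R])) x)%E).
    exact/integrableZl/integrable_indic_itv.
  by apply/funext => x; rewrite /g EFinM.
have le_g n x : (`|mol_err1 n h x| <= g x)%E.
  rewrite gee0_abs ?mol_err1_ge0// /g indicE.
  case: (boolP (_ \in _)) => [_|]; last first.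
    rewrite notin_setE/= in_itv/= => /negP; rewrite -ler_norml -ltNge => xN.
    rewrite mulr0 /mol_err1 integral0_eq// => y _.
    have [yN|yN] := ltP N `|y|.
      rewrite (hN _ yN) (hN x) ?subrr ?normr0 ?mul0r//; lra.
    rewrite mol_eq0 ?mulr0//.
    have : n.+1%:R^-1 <= 1 :> R by rewrite invf_le1// ler1n.
    have xy : `|x| <= `|x - y| + `|y| by rewrite -{1}(subrK y x) ler_normD.
    move=> n1; apply: (le_trans n1); lra.
  rewrite mulr1; apply: (@le_trans _ _ (\int[mu]_y ((2 * M)%:E * (mol n (x - y))%:E))%E).
    apply: ge0_le_integral => //.
    - by move=> y _; rewrite lee_fin mulr_ge0// mol_ge0.
    - by apply: (measurable_fun_pair2 x (measurable_mol_err1_integrand n mh)).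
    - apply: measurable_funeM; apply/measurable_EFinP.
      by apply: (measurable_fun_pair2 x (measurable_mol_sub n)).
    - move=> y _; rewrite -EFinM lee_fin ler_wpM2r ?mol_ge0//.
      by rewrite mulr_natl mulr2n (le_trans (ler_normB _ _))// lerD.
  rewrite ge0_integralZl//; last 3 first.
  - apply/measurable_EFinP.
    by apply: (measurable_fun_pair2 x (measurable_mol_sub n)).
  - by move=> y _; rewrite lee_fin mol_ge0.
  - by rewrite lee_fin mulr_ge0.
  by rewrite integral_mol mule1.
have h0 : {ae mu, forall x, setT x -> mol_err1 n h x @[n --> \oo] --> cst 0%E x}.
  have := lebesgue_differentiation (locally_integrable_bounded mh hM).
  apply: filterS; first exact: (ae_filter_ringOfSetsType mu).
  by move=> x hx _; exact: mol_err1_lebesgue_pt.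
have hg : {ae mu, forall x, forall n, setT x -> (`|mol_err1 n h x| <= g x)%E}.
  by apply: aeW => x /= n _; exact: le_g.
have [_ _] := dominated_convergence measurableT
  (fun n => measurable_mol_err1 n mh) (measurable_cst _) h0 ig hg.
by rewrite integral0.
Qed.

Lemma integral_molr n y : (\int[mu]_x (mol n (x - y))%:E)%E = 1%E.
Proof.
rewrite -[RHS](integral_mol n y); apply: eq_integral => x _.
by rewrite -molN opprB.
Qed.

(** With [r = |h - k|] one has [|h y - h x| <= |k y - k x| + r y + r x]. The kernel has mass [1] in
    either variable, so each of the last two terms contributes the integral of [r], whence the
    factor [2]. A truncation as [k] gives an approximation argument; [k = 0] gives a dominating
    function. *)
Lemma integral_mol_err1_le n h (k : R -> R) : measurable_fun setT (h : B -> R) ->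
  measurable_fun setT (k : B -> R) ->
  (\int[mu]_x mol_err1 n h x <= \int[mu]_x mol_err1 n k x +
     2%:E * \int[mu]_x `|h x - k x|%:E)%E.
Proof.
move=> mh mk; pose r (x : R) : R := `|h x - k x|.
have r0 x : 0 <= r x by exact: normr_ge0.
have mr : measurable_fun setT (r : B -> R).
  by apply: measurableT_comp => //; exact: measurable_funB.
have mrm : measurable_fun setT (fun z : B * B => (r z.2 * mol n (z.1 - z.2))%:E).
  apply/measurable_EFinP; apply: measurable_funM; last exact: measurable_mol_sub.
  by apply: measurableT_comp => //; exact: measurable_snd.
have rm0 z : (0 <= (r z.2 * mol n (z.1 - z.2))%:E)%E.
  by rewrite lee_fin mulr_ge0// mol_ge0.
have mm x : measurable_fun setT (fun y : B => (mol n (x - y))%:E).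
  by apply/measurable_EFinP; apply: (measurable_fun_pair2 x (measurable_mol_sub n)).
have m0 x y : (0 <= (mol n (x - y))%:E)%E by rewrite lee_fin mol_ge0.
have mrm2 x : measurable_fun setT (fun y : B => (r y * mol n (x - y))%:E).
  by apply: (measurable_fun_pair2 x mrm).
have mkm x : measurable_fun setT (fun y : B => (`|k y - k x| * mol n (x - y))%:E).
  by apply: (measurable_fun_pair2 x (measurable_mol_err1_integrand n mk)).
have le_x x : (mol_err1 n h x <= mol_err1 n k x +
    (\int[mu]_y (r y * mol n (x - y))%:E + (r x)%:E))%E.
  rewrite (_ : (r x)%:E = \int[mu]_y ((r x)%:E * (mol n (x - y))%:E))%E; last first.
    rewrite ge0_integralZl//; first by rewrite integral_mol mule1.
    by rewrite lee_fin.
  have mrx : measurable_fun setT (fun y : B => ((r x)%:E * (mol n (x - y))%:E)%E).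
    exact: measurable_funeM.
  have rx0 y : (0 <= (r x)%:E * (mol n (x - y))%:E)%E.
    by rewrite mule_ge0// lee_fin.
  rewrite -ge0_integralD//; last by move=> y _; exact: (rm0 (x, y)).
  rewrite -ge0_integralD//; first last.
  - exact: emeasurable_funD.
  - by move=> y _; rewrite adde_ge0//; exact: (rm0 (x, y)).
  - by move=> y _; rewrite lee_fin mulr_ge0// mol_ge0.
  apply: ge0_le_integral => //.
  - by move=> y _; rewrite lee_fin mulr_ge0// mol_ge0.
  - by apply: (measurable_fun_pair2 x (measurable_mol_err1_integrand n mh)).
  - by apply: emeasurable_funD => //; exact: emeasurable_funD.
  move=> y _; rewrite -EFinM -!EFinD lee_fin -!mulrDl ler_wpM2r ?mol_ge0//.
  rewrite (_ : h y - h x = (k y - k x) + ((h y - k y) - (h x - k x))); last by ring.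
  by rewrite (le_trans (ler_normD _ _))// lerD2l (le_trans (ler_normB _ _)).
have mF := measurable_fun_fubini_tonelli_F (m2 := mu) _ mrm rm0.
have F0 x : (0 <= \int[mu]_y (r y * mol n (x - y))%:E)%E.
  by apply: integral_ge0 => y _; exact: (rm0 (x, y)).
have mre : measurable_fun setT (fun x : B => (r x)%:E) by exact/measurable_EFinP.
apply: (@le_trans _ _ (\int[mu]_x (mol_err1 n k x +
    (\int[mu]_y (r y * mol n (x - y))%:E + (r x)%:E)))%E).
  apply: ge0_le_integral => //.
  - by move=> x _; exact: mol_err1_ge0.
  - exact: measurable_mol_err1.
  - by apply: emeasurable_funD; [exact: measurable_mol_err1|exact: emeasurable_funD].
rewrite ge0_integralD//; first last.
- exact: emeasurable_funD.
- by move=> x _; rewrite adde_ge0// lee_fin.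
- exact: measurable_mol_err1.
- by move=> x _; exact: mol_err1_ge0.
rewrite leeD2l// ge0_integralD//; last by move=> x _; rewrite lee_fin.
rewrite (fubini_tonelli (m1 := mu) (m2 := mu) _ mrm rm0)/=.
rewrite [X in (X + _)%E](_ : _ = \int[mu]_x (r x)%:E)%E; last first.
  apply: eq_integral => y _; under eq_integral do rewrite EFinM.
  rewrite ge0_integralZl//; first by rewrite integral_molr mule1.
  - apply/measurable_EFinP.
    by apply: (measurable_fun_pair1 y (measurable_mol_sub n)).
  - by rewrite lee_fin.
by rewrite -mule2n -mule_natl.
Qed.
Lemma ge0_cvge0P (u : nat -> \bar R) : (forall n, 0 <= u n)%E ->
  (u @ \oo --> 0%E) <-> (forall e : R, 0 < e -> \forall n \near \oo, (u n <= e%:E)%E).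
Proof.
move=> u0; split=> [/fine_cvgP[uf /cvgr0Pnorm_le u0' e e0]|ue].
  near=> n; have un : u n \is a fin_num by near: n.
  rewrite -(fineK un) lee_fin; apply: le_trans (ler_norm _) _.
  by near: n; exact: u0'.
apply/fine_cvgP.
have uf : \forall n \near \oo, u n \is a fin_num.
  near=> n; rewrite ge0_fin_numE//; apply: (@le_lt_trans _ _ 1%:E); last exact: ltry.
  by near: n; exact: ue.
split => //; apply/cvgr0Pnorm_le => e e0; near=> n.
have un : u n \is a fin_num by near: n.
rewrite /= ger0_norm ?fine_ge0// -lee_fin fineK//; near: n; exact: ue.
Unshelve. all: by end_near.
Qed.

Lemma integral_mol_err1_cvg h : measurable_fun setT (h : B -> R) ->
  (\int[mu]_x `|h x|%:E < +oo)%E ->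
  (\int[mu]_x mol_err1 n h x)%E @[n --> \oo] --> 0%E.
Proof.
move=> mh ih.
(* Truncating both in space and in value reduces to the bounded case; [k j x = h x] as soon as [j]
   exceeds [|x|] and [|h x|]. *)
pose k (j : nat) (x : R) : R := if (`|x| <= j%:R) && (`|h x| <= j%:R) then h x else 0.
have mk j : measurable_fun setT (k j : B -> R).
  apply: measurable_fun_if => //.
  - apply: measurable_and; apply: measurable_fun_ler => //.
    by apply: measurableT_comp.
  - exact: measurable_funTS.
have ek j : (\int[mu]_x mol_err1 n (k j) x)%E @[n --> \oo] --> 0%E.
  apply: (@mol_err1_cvg_bounded _ j%:R j%:R) => // x; rewrite /k.
    by case: ifPn => [/andP[]//|_]; rewrite normr0.
  by rewrite ltNge => /negbTE ->.
have ihE : mu.-integrable setT (fun x => `|h x|%:E).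
  apply/integrableP; split; first by apply/measurable_EFinP; exact: measurableT_comp.
  by under eq_integral do rewrite gee0_abs// ?lee_fin//.
have kh : (\int[mu]_x `|h x - k j x|%:E)%E @[j --> \oo] --> 0%E.
  have mkh j : measurable_fun setT (fun x : B => `|h x - k j x|%:E).
    by apply/measurable_EFinP; apply: measurableT_comp => //; exact: measurable_funB.
  have c0 : {ae mu, forall x, setT x -> `|h x - k j x|%:E @[j --> \oo] --> cst 0%E x}.
    apply: aeW => x _; apply: cvg_near_cst; near=> j.
    rewrite /k ifT ?subrr ?normr0//; apply/andP; split; near: j;
    exact: nbhs_infty_ger.
  have cg : {ae mu, forall x, forall j, setT x -> (`| `|h x - k j x|%:E | <= `|h x|%:E)%E}.
    apply: aeW => x j _ /=; rewrite lee_fin normr_id /k; case: ifPn => _.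
      by rewrite subrr normr0.
    by rewrite subr0.
  have [_ _] := dominated_convergence measurableT mkh (measurable_cst _) c0 ihE cg.
  by rewrite integral0.
apply/ge0_cvge0P => [n|e e0]; first by apply: integral_ge0 => x _; exact: mol_err1_ge0.
(* The approximation error counts twice, hence a quarter of [e] for it and a half for the error of
   [k j]. *)
have e4 : 0 < e / 4 by rewrite divr_gt0.
have e2 : 0 < e / 2 by rewrite divr_gt0.
have /ge0_cvge0P/(_ _ e4)[|j _ /(_ j (leqnn _)) kj] := kh.
  by move=> j; apply: integral_ge0.
have ekj : \forall n \near \oo, (\int[mu]_x mol_err1 n (k j) x <= (e / 2)%:E)%E.
  have /ge0_cvge0P/(_ _ e2) := ek j; apply => n.
  by apply: integral_ge0 => x _; exact: mol_err1_ge0.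
near=> n; apply: (le_trans (integral_mol_err1_le n mh (mk j))).
have -> : e%:E = ((e / 2)%:E + (e / 2)%:E)%E by rewrite -EFinD -splitr.
apply: leeD; first by near: n; exact: ekj.
rewrite (_ : e / 2 = 2 * (e / 4)); last by field.
by rewrite EFinM lee_pmul2l.
Unshelve. all: by end_near.
Qed.
End mollifier_error_line.

Section plane_measure.
Context {R : realType}.
Local Notation B := (measurableTypeR R).
Local Notation mu := (@lebesgue_measure R).

(** [mu \x mu] under a name of its own: canonical structure inference does not
    find a sigma-finite structure on a product of two sigma-finite measures. *)
Definition lebesgue2 : set (B * B) -> \bar R := (mu \x mu)%E.

HB.instance Definition _ := Measure.on lebesgue2.

Lemma sigma_finite_lebesgue2 : sigma_finite setT lebesgue2.
Proof.
have /sigma_finiteP[F [TF ndF Foo]] := sigma_finiteT mu.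
exists (fun n => F n `*` F n).
  rewrite -setXTT TF predeqE => -[x y]; split.
    move=> [/= [n _ Fnx] [k _ Fky]]; exists (maxn n k) => //; split.
      by move: x Fnx; exact/subsetPset/ndF/leq_maxl.
    by move: y Fky; exact/subsetPset/ndF/leq_maxr.
  by move=> [n _ []/= ? ?]; split; exists n.
move=> k; have [mF Fk] := Foo k; split; first exact: measurableX.
by rewrite /lebesgue2 product_measure1E// lte_mul_pinfty// ge0_fin_numE.
Qed.

HB.instance Definition _ := Measure_isSigmaFinite.Build _ _ _ lebesgue2
  sigma_finite_lebesgue2.

End plane_measure.

(** * Mean oscillation in the plane *)

Section mollifier_error_plane.
Context {R : realType}.
Local Notation mu := (@lebesgue_measure R).
Local Notation B := (measurableTypeR R).
Local Notation mu2 := (@lebesgue2 R).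
Implicit Types (f g : R * R -> R) (n : nat).

(** Joint measurability does not follow from that of the sections: the error is written as an
    integral over a third variable, to which Tonelli's theorem applies. *)
Lemma measurable_mol_err1_section n g : measurable_fun setT (g : B * B -> R) ->
  measurable_fun setT (fun z : B * B => mol_err1 n (fun b => g (z.1, b)) z.2).
Proof.
move=> mg.
have := measurable_fun_fubini_tonelli_F (m2 := mu)
  (fun z : (B * B) * B => (`|g (z.1.1, z.2) - g z.1| * mol n (z.1.2 - z.2))%:E).
have mp : measurable_fun setT (fun z : (B * B) * B => (z.1.1, z.2) : B * B).
  apply: measurable_fun_pair; last exact: measurable_snd.
  by apply: measurableT_comp; [exact: measurable_fst|exact: measurable_fst].
rewrite /fubini_F => H.
rewrite (_ : (fun z => _) = fun x : B * B => (\int[mu]_y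
     (`|g ((x, y).1.1, (x, y).2) - g (x, y).1| *
           mol n ((x, y).1.2 - (x, y).2))%:E)%E); last first.
  by apply/funext => -[a b].
apply: H; last by move=> z; rewrite lee_fin mulr_ge0// mol_ge0.
apply/measurable_EFinP; apply: measurable_funM.
  apply: measurableT_comp => //; apply: measurable_funB.
    exact: (measurableT_comp mg mp).
  exact: (measurableT_comp mg measurable_fst).
apply: measurableT_comp; first exact: measurable_mol.
apply: measurable_funB; last exact: measurable_snd.
exact: (measurableT_comp measurable_snd measurable_fst).
Qed.

(** For almost every [a] the section is integrable and its error tends to [0]. Comparison with the
    zero function bounds this error by twice the norm of the section, which is integrable in [a]. *)
Lemma integral_mol_err1_section_cvg g : measurable_fun setT (g : B * B -> R) ->
  (\int[mu]_a \int[mu]_b `|g (a, b)|%:E < +oo)%E ->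
  (\int[mu]_a \int[mu]_x mol_err1 n (fun b => g (a, b)) x)%E @[n --> \oo] --> 0%E.
Proof.
move=> mg ig.
have mga a : measurable_fun setT (fun b : B => g (a, b)).
  by apply: (measurable_fun_pair2 a mg).
pose G (a : B) : \bar R := (2%:E * \int[mu]_b `|g (a, b)|%:E)%E.
have mg1 : measurable_fun setT (fun a : B => (\int[mu]_b `|g (a, b)|%:E)%E).
  apply: (measurable_fun_fubini_tonelli_F (m2 := mu) (fun z : B * B => `|g z|%:E)) => //.
  by apply/measurable_EFinP; exact: measurableT_comp.
have intg0 a : (0 <= \int[mu]_b `|g (a, b)|%:E)%E by exact: integral_ge0.
have iG1 : mu.-integrable setT (fun a : B => (\int[mu]_b `|g (a, b)|%:E)%E).
  by apply/integrableP; split => //; under eq_integral do rewrite gee0_abs//.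
have iG : mu.-integrable setT G by exact: integrableZl.
have err0 n a : (0 <= \int[mu]_x mol_err1 n (fun b => g (a, b)) x)%E.
  by apply: integral_ge0 => x _; exact: mol_err1_ge0.
have mF n : measurable_fun setT
    (fun a : B => (\int[mu]_x mol_err1 n (fun b => g (a, b)) x)%E).
  apply: (measurable_fun_fubini_tonelli_F (m2 := mu)
    (fun z : B * B => mol_err1 n (fun b => g (z.1, b)) z.2)).
    exact: measurable_mol_err1_section.
  by move=> z; exact: mol_err1_ge0.
have c0 : {ae mu, forall a, setT a ->
    (\int[mu]_x mol_err1 n (fun b => g (a, b)) x)%E @[n --> \oo] --> cst 0%E a}.
  have := integrable_ae measurableT iG1.
  apply: filterS => a /(_ I) fa _; apply: integral_mol_err1_cvg => //.
  by rewrite -ge0_fin_numE.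
have cG : {ae mu, forall a, forall n, setT a ->
    (`|\int[mu]_x mol_err1 n (fun b => g (a, b)) x| <= G a)%E}.
  apply: aeW => a n _ /=; rewrite gee0_abs//.
  have := integral_mol_err1_le n (mga a) (measurable_cst (0 : R)).
  rewrite [X in (_ <= X + _)%E](_ : _ = 0%E); last first.
    apply: integral0_eq => x _; apply: integral0_eq => y _.
    by rewrite subrr normr0 mul0r.
  by rewrite add0e; under [X in (_ <= _ * X)%E]eq_integral do rewrite subr0.
have [_ _] := dominated_convergence measurableT mF (measurable_cst _) c0 iG cG.
by rewrite integral0.
Qed.
Definition mol_err n f (x : R * R) : \bar R :=
  (\int[mu2]_y (`|f y - f x| * mol2 n x y)%:E)%E.

Lemma mol2_ge0 n (x y : R * R) : 0 <= mol2 n x y.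
Proof. by rewrite mulr_ge0// mol_ge0. Qed.

Lemma measurable_mol2 n :
  measurable_fun setT (fun z : (B * B) * (B * B) => mol2 n z.1 z.2).
Proof.
have m (i j : B * B -> B) : measurable_fun setT i -> measurable_fun setT j ->
    measurable_fun setT (fun z : (B * B) * (B * B) => mol n (i z.1 - j z.2)).
  move=> mi mj; apply: measurableT_comp; first exact: measurable_mol.
  apply: measurable_funB.
    exact: (measurableT_comp mi measurable_fst).
  exact: (measurableT_comp mj measurable_snd).
apply: measurable_funM; first by apply: m; exact: measurable_fst.
by apply: m; exact: measurable_snd.
Qed.

Lemma measurable_mol_err_integrand n f : measurable_fun setT (f : B * B -> R) ->
  measurable_fun setT (fun z : (B * B) * (B * B) =>
    (`|f z.2 - f z.1| * mol2 n z.1 z.2)%:E).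
Proof.
move=> mf; apply/measurable_EFinP; apply: measurable_funM; last exact: measurable_mol2.
apply: measurableT_comp => //; apply: measurable_funB.
  exact: (measurableT_comp mf measurable_snd).
exact: (measurableT_comp mf measurable_fst).
Qed.

Lemma mol_err_ge0 n f x : (0 <= mol_err n f x)%E.
Proof. by apply: integral_ge0 => y _; rewrite lee_fin mulr_ge0// mol2_ge0. Qed.

Lemma measurable_mol_err n f : measurable_fun setT (f : B * B -> R) ->
  measurable_fun setT (mol_err n f : B * B -> \bar R).
Proof.
move=> mf; have := measurable_fun_fubini_tonelli_F (m2 := mu2) _
  (measurable_mol_err_integrand n mf); apply.
by move=> z; rewrite lee_fin mulr_ge0// mol2_ge0.
Qed.

Lemma integral_mol_err_le n f : measurable_fun setT (f : B * B -> R) ->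
  (\int[mu2]_x mol_err n f x <=
   \int[mu]_b \int[mu]_x mol_err1 n (fun a => f (a, b)) x +
   \int[mu]_a \int[mu]_x mol_err1 n (fun b => f (a, b)) x)%E.
Proof.
move=> mf.
(* The path from [x] to [y] through [(x.1, y.2)] moves one coordinate at a time. *)
pose p (z : (B * B) * (B * B)) : R := `|f z.2 - f (z.1.1, z.2.2)| * mol2 n z.1 z.2.
pose q (z : (B * B) * (B * B)) : R := `|f (z.1.1, z.2.2) - f z.1| * mol2 n z.1 z.2.
have mid : measurable_fun setT (fun z : (B * B) * (B * B) => (z.1.1, z.2.2) : B * B).
  apply: measurable_fun_pair.
    exact: (measurableT_comp measurable_fst measurable_fst).
  exact: (measurableT_comp measurable_snd measurable_snd).
have mp : measurable_fun setT (fun z => (p z)%:E).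
  apply/measurable_EFinP; apply: measurable_funM; last exact: measurable_mol2.
  apply: measurableT_comp => //; apply: measurable_funB.
    exact: (measurableT_comp mf measurable_snd).
  exact: (measurableT_comp mf mid).
have mq : measurable_fun setT (fun z => (q z)%:E).
  apply/measurable_EFinP; apply: measurable_funM; last exact: measurable_mol2.
  apply: measurableT_comp => //; apply: measurable_funB.
    exact: (measurableT_comp mf mid).
  exact: (measurableT_comp mf measurable_fst).
have p0 z : (0 <= (p z)%:E)%E by rewrite lee_fin mulr_ge0// mol2_ge0.
have q0 z : (0 <= (q z)%:E)%E by rewrite lee_fin mulr_ge0// mol2_ge0.
have mP := measurable_fun_fubini_tonelli_F (m2 := mu2) _ mp p0.
have mQ := measurable_fun_fubini_tonelli_F (m2 := mu2) _ mq q0.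
have P0 x : (0 <= \int[mu2]_y (p (x, y))%:E)%E by exact: integral_ge0.
have Q0 x : (0 <= \int[mu2]_y (q (x, y))%:E)%E by exact: integral_ge0.
have mpx x : measurable_fun setT (fun y : B * B => (p (x, y))%:E).
  by apply: (measurable_fun_pair2 x mp).
have mqx x : measurable_fun setT (fun y : B * B => (q (x, y))%:E).
  by apply: (measurable_fun_pair2 x mq).
have le_x x : (mol_err n f x <= \int[mu2]_y (p (x, y))%:E + \int[mu2]_y (q (x, y))%:E)%E.
  rewrite -ge0_integralD//; apply: ge0_le_integral => //.
  - by move=> y _; rewrite lee_fin mulr_ge0// mol2_ge0.
  - by apply: (measurable_fun_pair2 x (measurable_mol_err_integrand n mf)).
  - exact: emeasurable_funD.
  move=> y _; rewrite -EFinD lee_fin -mulrDl ler_wpM2r ?mol2_ge0//=.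
  by rewrite (le_trans _ (ler_normD _ _))// addrA subrK.
have m0 (x y : R) : (0 <= (mol n (x - y))%:E)%E by rewrite lee_fin mol_ge0.
have m1 x : measurable_fun setT (fun y : B => (mol n (x - y))%:E).
  by apply/measurable_EFinP; apply: (measurable_fun_pair2 x (measurable_mol_sub n)).
have m1r y : measurable_fun setT (fun x : B => (mol n (x - y))%:E).
  by apply/measurable_EFinP; apply: (measurable_fun_pair1 y (measurable_mol_sub n)).
apply: (@le_trans _ _ (\int[mu2]_x (\int[mu2]_y (p (x, y))%:E + \int[mu2]_y (q (x, y))%:E))%E).
  apply: ge0_le_integral => //.
  - by move=> x _; exact: mol_err_ge0.
  - exact: measurable_mol_err.
  - exact: emeasurable_funD.
(* On the second leg [y.1] occurs in the kernel alone and integrates to [1]. *)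
have QE a x : (\int[mu2]_y (q ((a, x), y))%:E = mol_err1 n (fun b => f (a, b)) x)%E.
  rewrite (fubini_tonelli2 (m1 := mu) (m2 := mu) _ (mqx (a, x)) (fun y => q0 (a, x, y)))/=.
  apply: eq_integral => b _; rewrite /fubini_G /q/= /mol2/=.
  under eq_integral do rewrite mulrCA mulrC EFinM.
  rewrite ge0_integralZl//; first by rewrite integral_mol mule1.
  by rewrite lee_fin mulr_ge0// mol_ge0.
have PE a x : (\int[mu2]_y (p ((a, x), y))%:E =
    \int[mu2]_y ((`|f y - f (a, y.2)| * mol n (a - y.1)) * mol n (x - y.2))%:E)%E.
  by apply: eq_integral => y _; rewrite /p/= /mol2/= mulrA.
rewrite ge0_integralD//; apply: leeD.
- rewrite (fubini_tonelli1 (m1 := mu) (m2 := mu) _ mP P0)/= /fubini_F/=.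
  under eq_integral => a _ do under eq_integral => x _ do rewrite PE.
  have mA a : measurable_fun setT (fun y : B * B => `|f y - f (a, y.2)| * mol n (a - y.1)).
    apply: measurable_funM.
      apply: measurableT_comp => //; apply: measurable_funB => //.
      by apply: (measurableT_comp mf); exact: measurable_fun_pair.
    apply: measurableT_comp; first exact: measurable_mol.
    by apply: measurable_funB.
  (* On the first leg it is [x.2] that occurs in the kernel alone; integrating over it first leaves
     [y.2] as a parameter of an error in the first coordinate. *)
  have E a : (\int[mu]_x \int[mu2]_y
       ((`|f y - f (a, y.2)| * mol n (a - y.1)) * mol n (x - y.2))%:E =
      \int[mu]_b mol_err1 n (fun a => f (a, b)) a)%E.
    rewrite (fubini_tonelli (m1 := mu) (m2 := mu2)
      (fun z => ((`|f z.2 - f (a, z.2.2)| * mol n (a - z.2.1)) *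
        mol n (z.1 - z.2.2))%:E))//=; first last.
    + move=> z; rewrite lee_fin; apply: mulr_ge0; last exact: mol_ge0.
      by apply: mulr_ge0; [exact: normr_ge0|exact: mol_ge0].
    + apply/measurable_EFinP; apply: measurable_funM.
        exact: (measurableT_comp (mA a) measurable_snd).
      apply: measurableT_comp; first exact: measurable_mol.
      apply: measurable_funB => //.
      exact: (measurableT_comp measurable_snd measurable_snd).
    rewrite (eq_integral (fun y : B * B => (`|f y - f (a, y.2)| * mol n (a - y.1))%:E)); last first.
      move=> y _; under eq_integral do rewrite EFinM.
      rewrite ge0_integralZl//; first by rewrite integral_molr mule1.
      by rewrite lee_fin mulr_ge0// mol_ge0.
    rewrite (fubini_tonelli2 (m1 := mu) (m2 := mu))//=.
    + exact/measurable_EFinP.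
    + by move=> y; rewrite lee_fin mulr_ge0// mol_ge0.
  under eq_integral do rewrite E.
  have mg : measurable_fun setT (fun z : B * B => f (z.2, z.1)).
    by apply: (measurableT_comp mf); exact: measurable_fun_pair.
  have mg1 : measurable_fun setT
      (fun z : B * B => mol_err1 n (fun a => f (a, z.2)) z.1).
    exact: (measurableT_comp (measurable_mol_err1_section n mg)
      (measurable_fun_pair measurable_snd measurable_fst)).
  have g0 (z : B * B) : (0 <= mol_err1 n (fun a => f (a, z.2)) z.1)%E.
    exact: mol_err1_ge0.
  have E2 := fubini_tonelli (m1 := mu) (m2 := mu) _ mg1 g0.
  exact: (eq_ind _ (fun t => (_ <= t)%E) (lexx _) _ E2).
- rewrite (fubini_tonelli1 (m1 := mu) (m2 := mu) _ mQ Q0)/= /fubini_F/=.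
  by under eq_integral => a _ do under eq_integral => x _ do rewrite QE.
Qed.
Lemma integral_mol_err_cvg f : measurable_fun setT (f : B * B -> R) ->
  (\int[mu2]_x `|f x|%:E < +oo)%E ->
  (\int[mu2]_x mol_err n f x)%E @[n --> \oo] --> 0%E.
Proof.
move=> mf iff.
have mff : measurable_fun setT (fun z : B * B => `|f z|%:E).
  by apply/measurable_EFinP; exact: measurableT_comp.
have mg : measurable_fun setT (fun z : B * B => f (z.2, z.1)).
  by apply: (measurableT_comp mf); exact: measurable_fun_pair.
have f0 (z : B * B) : (0 <= `|f z|%:E)%E by rewrite lee_fin.
have E1 := fubini_tonelli1 (m1 := mu) (m2 := mu) _ mff f0.
have E2 := fubini_tonelli2 (m1 := mu) (m2 := mu) _ mff f0.
have c1 := integral_mol_err1_section_cvg mf (eq_ind _ (fun t => (t < +oo)%E) iff _ E1).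
have c2 := integral_mol_err1_section_cvg mg (eq_ind _ (fun t => (t < +oo)%E) iff _ E2).
have c12 := cvgeD (isT : (0 +? 0)%E) c2 c1; rewrite adde0 in c12.
apply: (@squeeze_cvge _ _ _ _ (cst 0%E) _ (fun n =>
  \int[mu]_b \int[mu]_x mol_err1 n (fun a => f (a, b)) x +
  \int[mu]_a \int[mu]_x mol_err1 n (fun b => f (a, b)) x)%E).
- apply: nearW => n; apply/andP; split; last exact: integral_mol_err_le.
  by apply: integral_ge0 => x _; exact: mol_err_ge0.
- exact: cvg_cst.
- exact: c12.
Qed.

End mollifier_error_plane.

(** * Borel sets and the completed Lebesgue measures *)

Section completion.
Local Open Scope ereal_scope.
Context d (T : measurableType d) (R : realType) (mu : {measure set T -> \bar R}).
Local Notation C := (caratheodory_type (mu_ext mu)).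
Local Notation cmu := (@completed_measure_extension _ _ _ mu).

Lemma measurable_caratheodory (A : set T) : measurable A -> measurable (A : set C).
Proof. exact: caratheodory_measurable_mu_ext. Qed.

(** [A] is arbitrary, measurable or not; [F] is the intersection of countable covers whose measures
    exceed [mu_ext mu A] by at most [1 / (n+1)]. *)
Lemma mu_ext_hull (A : set T) : mu_ext mu A < +oo ->
  exists F : set T, [/\ measurable F, mu F = mu_ext mu A & A `<=` F].
Proof.
move=> Aoo.
have coverA (n : nat) : exists F : set T, [/\ measurable F, A `<=` F &
    mu F <= mu_ext mu A + (n.+1%:R^-1)%:E].
  have : mu_ext mu A \is a fin_num by rewrite ge0_fin_numE// mu_ext_ge0.
  have n0 : (0 < n.+1%:R^-1 :> R)%R by rewrite invr_gt0.
  move=> /lb_ereal_inf_adherent => /(_ _ n0)[_/= [G [mG AG] <-]] AGlt.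
  exists (\bigcup_k G k); split => //; first exact: bigcupT_measurable.
  apply: le_trans (ltW AGlt).
  by apply: measure_sigma_subadditive => //; exact: bigcupT_measurable.
have [F mF] := choice coverA.
exists (\bigcap_n F n); split.
- by apply: bigcapT_measurable => n; have [] := mF n.
- have mFF : measurable (\bigcap_n F n).
    by apply: bigcapT_measurable => n; have [] := mF n.
  apply/eqP; rewrite eq_le; apply/andP; split; last first.
    rewrite -measurable_mu_extE//; apply: le_mu_ext.
    by apply: sub_bigcap => n _; have [] := mF n.
  apply/lee_addgt0Pr => /= _/posnumP[e]; near \oo => n.
  apply: (@le_trans _ _ (mu (F n))).
    by apply: le_measure; rewrite ?inE//; [have [] := mF n|exact: bigcap_inf].
  have [_ _ /le_trans] := mF n; apply.
  rewrite leeD// lee_fin ltW//.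
  by near: n; apply: near_infty_natSinv_lt.
- by apply: sub_bigcap => n _; have [] := mF n.
Unshelve. all: by end_near.
Qed.

Lemma mu_ext_null_sub (A : set T) : mu_ext mu A = 0 ->
  exists N : set T, [/\ measurable N, mu N = 0 & A `<=` N].
Proof.
move=> A0; have [|N [mN muN AN]] := @mu_ext_hull A; first by rewrite A0 ltry.
by exists N; split => //; rewrite muN.
Qed.

Lemma completed_negligible_sub (A : set T) : cmu.-negligible (A : set C) ->
  exists N : set T, [/\ measurable N, mu N = 0 & A `<=` N].
Proof.
move=> [M [_ M0 AM]]; have [N [mN N0 MN]] := mu_ext_null_sub M0.
by exists N; split => //; exact: subset_trans MN.
Qed.

Hypothesis sfmu : sigma_finite setT mu.

(** When [E] has finite measure, its hull [F] exceeds it by a null set, and this null set lies in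
    one that is measurable in [T]. The general case is a union over a sigma-finite exhaustion. *)
Lemma caratheodory_measurable_hull (E : set T) : measurable (E : set C) ->
  exists F N : set T, [/\ measurable F, measurable N, mu N = 0 & E `\` N = F `\` N].
Proof.
have finite_case (A : set T) : measurable (A : set C) -> mu_ext mu A < +oo ->
    exists F N : set T, [/\ measurable F, measurable N, mu N = 0 & A `\` N = F `\` N].
  move=> mA Aoo; have [F [mF muF AF]] := mu_ext_hull Aoo.
  have FA0 : mu_ext mu (F `\` A) = 0.
    have -> : mu_ext mu (F `\` A) = cmu (F `\` A) by [].
    rewrite measureD//=.
    + rewrite setIidr// /completed_measure_extension measurable_mu_extE// muF subee//.
      by rewrite ge0_fin_numE// mu_ext_ge0.
    + exact: measurable_caratheodory.
    + by rewrite /completed_measure_extension measurable_mu_extE// muF.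
  have [N [mN N0 FAN]] := mu_ext_null_sub FA0.
  exists F, N; split => //; apply/seteqP; split => x [Ax Nx]; split => //.
    exact: AF.
  by apply: contrapT => nAx; apply: Nx; exact: FAN.
move=> mE; have [S ST Soo] := sfmu.
have /choice[F FP] : forall n, exists FN : set T * set T,
    [/\ measurable FN.1, measurable FN.2, mu FN.2 = 0 & (E `&` S n) `\` FN.2 = FN.1 `\` FN.2].
  move=> n; have [mS Sn] := Soo n.
  have [||F [N [mF mN N0 EN]]] := finite_case (E `&` S n).
  - by apply: measurableI => //; exact: measurable_caratheodory.
  - apply: le_lt_trans Sn; rewrite -[leRHS]measurable_mu_extE//.
    exact: le_mu_ext.
  by exists (F, N).
exists (\bigcup_n (F n).1), (\bigcup_n (F n).2); split.
- by apply: bigcupT_measurable => n; have [] := FP n.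
- by apply: bigcupT_measurable => n; have [] := FP n.
- apply: measure_negligible; first by apply: bigcupT_measurable => n; have [] := FP n.
  apply: negligible_bigcup => n; have [_ mN N0 _] := FP n.
  by exists (F n).2; split.
- apply/seteqP; split => x.
    move=> [Ex Nx]; split => //; have : setT x by []; rewrite ST => -[n _ Snx].
    have [_ _ _ En] := FP n; exists n => //.
    have : ((E `&` S n) `\` (F n).2) x by split => // Fx; apply: Nx; exists n.
    by rewrite En => -[].
  move=> [[n _ Fx] Nx]; split => //; have [_ _ _ En] := FP n.
  have : ((F n).1 `\` (F n).2) x by split => // F2x; apply: Nx; exists n.
  by rewrite -En => -[[]].
Qed.

(** Rays with rational end points suffice to test measurability; discarding the null sets attached
    to these countably many rays makes all preimages measurable in [T] at once. *)
Lemma caratheodory_measurable_fun_ae (D : set T) (f : T -> R) : measurable D ->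
  measurable_fun (D : set C) (f : C -> R) ->
  exists N : set T, [/\ measurable N, mu N = 0 & measurable_fun (D `\` N) f].
Proof.
move=> mD mf.
have /choice[F FP] : forall q : rat, exists FN : set T * set T,
    [/\ measurable FN.1, measurable FN.2, mu FN.2 = 0 &
      (D `&` f @^-1` `]ratr q, +oo[) `\` FN.2 = FN.1 `\` FN.2].
  move=> q; have [|F [N [mF mN N0 EN]]] :=
    @caratheodory_measurable_hull (D `&` f @^-1` `]ratr q, +oo[).
    by apply: mf; [exact: measurable_caratheodory|exact: measurable_itv].
  by exists (F, N).
have mN : measurable (\bigcup_q (F q).2).
  by apply: bigcupT_measurable_rat => q; have [] := FP q.
exists (\bigcup_q (F q).2); split => //.
  apply: measure_negligible => //.
  apply: (@negligibleS _ _ _ _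
    (\bigcup_n oapp (fun q : rat => (F q).2) set0 (unpickle n))).
    by move=> x [q _ Fx]; exists (pickle q); [exact: I|rewrite pickleK].
  apply: negligible_bigcup => n; case: unpickle => [q|] /=.
    by have [_ mFq F0 _] := FP q; exists (F q).2; split.
  exact: negligible_set0.
move=> mDN; apply: (measurability _ (RGenOInfty.measurableE R)) => //.
move=> _ [_ [r ->] <-].
(* A ray []r, +oo[] is the union of the rational rays that it contains. *)
rewrite (_ : _ `&` _ = \bigcup_q (if (r < ratr q)%R then (F q).1 `\` \bigcup_q (F q).2 else set0)).
  apply: bigcupT_measurable_rat => q; case: ifPn => // _.
  by apply: measurableD => //; have [] := FP q.
apply/seteqP; split => x.
  move=> [[Dx Nx]] /=; rewrite in_itv/= andbT => /rat_in_itvoo[q].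
  rewrite in_itv/= => /andP[rq qf]; exists q => //; rewrite rq; split => //.
  have [_ _ _ Eq] := FP q.
  have : ((D `&` f @^-1` `]ratr q, +oo[) `\` (F q).2) x.
    split; first by split => //=; rewrite in_itv/= qf.
    by move=> Fx; apply: Nx; exists q.
  by rewrite Eq => -[].
move=> [q _]; case: ifPn => // rq [Fx Nx].
have [_ _ _ Eq] := FP q.
have : ((F q).1 `\` (F q).2) x by split => // F2x; apply: Nx; exists q.
rewrite -Eq => -[[Dx]] /=; rewrite !in_itv/= !andbT => qf _.
by split => //; exact: lt_trans qf.
Qed.

End completion.

Section refinement.
Local Open Scope ereal_scope.
Context d1 d2 (S : measurableType d1) (T : measurableType d2) (R : realType).
Variables (nu : {measure set S -> \bar R}) (mu : {measure set T -> \bar R}) (h : S -> T).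
Hypothesis mh : measurable_fun setT h.
Hypothesis nuh : forall A, measurable A -> nu (h @^-1` A) = mu A.

(** The map [h] is used in two ways: as the identity from a completed sigma-algebra to the Borel
    one, and as the arclength function from a measure with density to the Lebesgue measure. *)
Lemma ge0_integral_refine (D : set T) (f : T -> \bar R) : measurable D ->
  measurable_fun D f -> {in D, forall x, 0 <= f x} ->
  \int[nu]_(x in h @^-1` D) f (h x) = \int[mu]_(x in D) f x.
Proof.
move=> mD mf f0.
rewrite -(ge0_integral_pushforward mh)//.
by apply: eq_measure_integral => A mA _ /=; rewrite /pushforward nuh.
Qed.

Lemma integral_refine (D : set T) (f : T -> \bar R) : measurable D ->
  measurable_fun D f ->
  \int[nu]_(x in h @^-1` D) f (h x) = \int[mu]_(x in D) f x.
Proof.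
move=> mD mf; rewrite [LHS]integralE [RHS]integralE; congr (_ - _).
  rewrite (funepos_comp f h); apply: ge0_integral_refine => //.
  exact: measurable_funepos.
rewrite (funeneg_comp f h); apply: ge0_integral_refine => //.
exact: measurable_funeneg.
Qed.
End refinement.

Section lebesgue_completion.
Context {R : realType}.
Local Notation B := (measurableTypeR R).
Local Notation mu := (@lebesgue_measure R).
Local Notation mu2 := (@lebesgue2 R).

Lemma measurable_line (A : set R) : measurable (A : set B) -> measurable (A : set (line R)).
Proof. by move=> mA; apply: sub_caratheodory. Qed.

Lemma measurable_plane (A : set (R * R)) : measurable (A : set (B * B)) ->
  measurable (A : set (plane R)).
Proof. exact: measurable_caratheodory. Qed.

Lemma leb2_borel (A : set (R * R)) : measurable (A : set (B * B)) ->
  leb2 R A = mu2 A.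
Proof. by move=> mA; rewrite [LHS]measurable_mu_extE. Qed.

Lemma measurable_fun_line (D : set R) d (T : measurableType d) (f : R -> T) :
  measurable_fun (D : set B) (f : B -> T) ->
  measurable (D : set B) ->
  measurable_fun (D : set (line R)) (f : line R -> T).
Proof. by move=> mf mD _ A mA; apply: measurable_line; exact: mf. Qed.

Lemma measurable_fun_plane (D : set (R * R)) d (T : measurableType d) (f : R * R -> T) :
  measurable_fun (D : set (B * B)) (f : B * B -> T) ->
  measurable (D : set (B * B)) ->
  measurable_fun (D : set (plane R)) (f : plane R -> T).
Proof. by move=> mf mD _ A mA; apply: measurable_plane; exact: mf. Qed.

Lemma integral_leb1 (D : set R) (f : R -> \bar R) : measurable (D : set B) ->
  measurable_fun (D : set B) (f : B -> \bar R) ->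
  (\int[leb1 R]_(x in D) f x = \int[mu]_(x in D) f x)%E.
Proof.
move=> mD mf.
have mid : measurable_fun setT (id : line R -> B).
  by move=> _ A mA; rewrite setTI; exact: measurable_line.
by rewrite -(integral_refine (nu := leb1 R) (mu := mu) mid).
Qed.

Lemma integral_leb2 (D : set (R * R)) (f : R * R -> \bar R) :
  measurable (D : set (B * B)) ->
  measurable_fun (D : set (B * B)) (f : B * B -> \bar R) ->
  (\int[leb2 R]_(x in D) f x = \int[mu2]_(x in D) f x)%E.
Proof.
move=> mD mf.
have mid : measurable_fun setT (id : plane R -> B * B).
  by move=> _ A mA; rewrite setTI; exact: measurable_plane.
rewrite -(integral_refine (nu := leb2 R) (mu := mu2) mid)// => A mA.
exact: leb2_borel.
Qed.

Lemma leb1_complete : measure_is_complete (leb1 R).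
Proof. exact: measure_is_complete_caratheodory. Qed.

End lebesgue_completion.

(** * Lipschitz primitives and changes of variables on the line *)

Section primitives.
Context {R : realType}.
Local Notation mu := (@lebesgue_measure R).
Local Notation B := (measurableTypeR R).
Implicit Types (P Q p q : R -> R) (a b s t : R).

(** Extending the density [p] by [0] outside [[a, b]] makes [P] Lipschitz on the
    whole line, which keeps the end points out of the calculus below. *)
Definition prim a b P p : Prop :=
  [/\ measurable_fun setT (p : B -> R),
      exists M, forall s, `|p s| <= M,
      forall s, s \notin `[a, b] -> p s = 0 &
      forall s t, s <= t -> P t - P s = \int[mu]_(x in `[s, t]) p x].

Lemma lebesgue_measure_cc s t : s <= t ->
  (mu : {measure set B -> \bar R}) `[s, t]%classic = (t - s)%:E.
Proof.
move=> st; have := lebesgue_measure_itv `[s, t]; rewrite /= lte_fin => ->.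
by move: st; rewrite le_eqVlt => /predU1P[->|->]; rewrite ?ltxx ?subrr.
Qed.

Lemma lebesgue_measure_cc_lty s t :
  ((mu : {measure set B -> \bar R}) `[s, t]%classic < +oo)%E.
Proof.
have := lebesgue_measure_itv `[s, t]; rewrite /= lte_fin => ->.
by case: ifPn => // _; rewrite -EFinB ltry.
Qed.

Lemma bounded_itv_integrable (p : R -> R) (M s t : R) : measurable_fun setT (p : B -> R) ->
  (forall x, `|p x| <= M) -> mu.-integrable `[s, t] (EFin \o p).
Proof.
move=> mp pM; apply: measurable_bounded_integrable => //.
- exact: lebesgue_measure_cc_lty.
- exact: measurable_funTS.
- by exists M; split; [exact: num_real|move=> x /ltW Mx y _; exact: le_trans (pM y) _].
Qed.

Lemma Rintegral_itv_le (p : R -> R) (M s t : R) : measurable_fun setT (p : B -> R) ->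
  s <= t -> (forall x, s <= x <= t -> `|p x| <= M) ->
  (exists N, forall x, `|p x| <= N) ->
  `|\int[mu]_(x in `[s, t]) p x| <= M * (t - s).
Proof.
move=> mp st pM [N pN].
have ip := bounded_itv_integrable s t mp pN.
apply: (le_trans (le_normr_Rintegral _ ip)) => //.
have -> : M * (t - s) = \int[mu]_(x in `[s, t]) (cst M x).
  by rewrite Rintegral_cst// lebesgue_measure_cc.
apply: le_Rintegral => //.
- apply: (bounded_itv_integrable (M := N)); first exact: measurableT_comp.
  by move=> x; rewrite normr_id.
- by apply: (bounded_itv_integrable (M := `|M|)) => //; exact: measurable_cst.
Qed.

Lemma prim_lipschitz a b P p : prim a b P p ->
  exists2 M, 0 <= M & forall s t, `|P t - P s| <= M * `|t - s|.
Proof.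
move=> [mp [M pM] _ Pp]; exists M; first by exact: le_trans (pM 0).
have le_st s t : s <= t -> `|P t - P s| <= M * (t - s).
  move=> st; rewrite Pp//; apply: Rintegral_itv_le => //; by exists M.
move=> s t; have [st|/ltW ts] := leP s t; first by rewrite [X in _ * X]ger0_norm ?subr_ge0// le_st.
by rewrite distrC (distrC t) [X in _ * X]ger0_norm ?subr_ge0// le_st.
Qed.

Lemma prim_continuous a b P p : prim a b P p -> continuous P.
Proof.
move=> /prim_lipschitz[M M0 PM] s; apply/cvgrPdist_le => e e0; near=> t.
rewrite (le_trans (PM _ _))//.
apply: (@le_trans _ _ ((M + 1) * `|s - t|)); first by rewrite ler_wpM2r// lerDl.
rewrite -ler_pdivlMl ?ltr_wpDl//; near: t.
apply: cvgr_dist_le; first exact: cvg_id.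
by rewrite mulr_gt0// invr_gt0 ltr_wpDl.
Unshelve. all: by end_near.
Qed.

Lemma prim_eq a b P p q : prim a b P p -> p =1 q -> prim a b P q.
Proof. by move=> Pp pq; rewrite (_ : q = p)//; apply/funext => s. Qed.

Lemma primD a b P p Q q : prim a b P p -> prim a b Q q ->
  prim a b (fun s => P s + Q s) (fun s => p s + q s).
Proof.
move=> [mp [M pM] p0 Pp] [mq [N qN] q0 Qq]; split.
- exact: measurable_funD.
- by exists (M + N) => s; rewrite (le_trans (ler_normD _ _))// lerD.
- by move=> s sab; rewrite p0// q0// addr0.
- move=> s t st; rewrite RintegralD//; last 2 first.
  + exact: (bounded_itv_integrable _ _ mp pM).
  + exact: (bounded_itv_integrable _ _ mq qN).
  by rewrite -Pp// -Qq//; ring.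
Qed.

Lemma primZ a b k P p : prim a b P p ->
  prim a b (fun s => k * P s) (fun s => k * p s).
Proof.
move=> [mp [M pM] p0 Pp]; split.
- exact: measurable_funM.
- by exists (`|k| * M) => s; rewrite normrM ler_wpM2l.
- by move=> s sab; rewrite p0// mulr0.
- move=> s t st; rewrite RintegralZl//; last first.
    exact: (bounded_itv_integrable _ _ mp pM).
  by rewrite -Pp//; ring.
Qed.

Lemma bounded_supp_integrable a b p M : measurable_fun setT (p : B -> R) ->
  (forall s, `|p s| <= M) -> (forall s, s \notin `[a, b] -> p s = 0) ->
  mu.-integrable setT (EFin \o p).
Proof.
move=> mp pM p0; rewrite (_ : EFin \o p = (EFin \o p) \_ `[a, b]).
  by apply/(integrable_mkcond _ _).1 => //; exact: (bounded_itv_integrable _ _ mp pM).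
apply/funext => s; rewrite patchE; case: ifPn => //.
by rewrite notin_setE/= => /negP/p0; rewrite /= => ->.
Qed.

Lemma prim_integrable a b P p : prim a b P p -> mu.-integrable setT (EFin \o p).
Proof. by move=> [mp [M pM] p0 _]; exact: bounded_supp_integrable pM p0. Qed.

Lemma prim_integral a b p M : measurable_fun setT (p : B -> R) ->
  (forall s, `|p s| <= M) -> (forall s, s \notin `[a, b] -> p s = 0) ->
  prim a b (fun t => \int[mu]_(x in `]-oo, t]) p x) p.
Proof.
move=> mp pM p0; split => //; first by exists M.
have ip := bounded_supp_integrable mp pM p0.
move=> s t st.
rewrite Rintegral_itvB//; last exact: integrableS ip.
rewrite Rintegral_itv_obnd_cbnd//; exact: integrableS ip.
Qed.

Lemma prim_unique a b P Q p : prim a b P p -> prim a b Q p ->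
  exists c, forall t, P t = c + Q t.
Proof.
move=> [_ _ _ Pp] [_ _ _ Qp]; exists (P 0 - Q 0) => t.
have [t0|/ltW t0] := leP 0 t.
  by have := Pp _ _ t0; rewrite -(Qp _ _ t0) => /eqP; rewrite subr_eq => /eqP ->; ring.
have := Pp _ _ t0; rewrite -(Qp _ _ t0) => E; have -> : P 0 = Q 0 - Q t + P t by rewrite -E; ring.
ring.
Qed.

(** As [p] is merely bounded and measurable, [P] may fail to be differentiable at some points, which
    rules out the pointwise chain rule. Subtracting from [f \o P] the primitive [Q] of the expected
    density leaves a function that is differentiable everywhere. *)
Lemma prim_chain a b P p (f f' : R -> R) : prim a b P p ->
  (forall x : R, is_derive x 1 f (f' x)) -> continuous f' ->
  prim a b (f \o P) (fun s => f' (P s) * p s).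
Proof.
move=> Pp df cf'; have cP := prim_continuous Pp.
have [K K0 PK] := prim_lipschitz Pp.
have [mp [M pM] p0 pP] := Pp.
have M0 : 0 <= M by exact: le_trans (pM 0).
have mq : measurable_fun setT ((fun s => f' (P s) * p s) : B -> R).
  apply: measurable_funM => //; apply: continuous_measurable_fun.
  by move=> s; apply: continuous_comp; [exact: cP|exact: cf'].
have [N qN] : exists N, forall s, `|f' (P s) * p s| <= N.
  have : compact ([set f' (P s) | s in `[a, b]] : set R^o).
    apply: continuous_compact; last exact: segment_compact.
    apply: continuous_subspaceT => s.
    by apply: continuous_comp; [exact: cP|exact: cf'].
  move=> /compact_bounded[N [_ /(_ (`|N| + 1))]].
  move=> /(_ (ltr_pwDr ltr01 (ler_norm N))) HN.
  exists ((`|N| + 1) * M) => s; have [sab|sab] := boolP (s \in `[a, b]).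
    rewrite normrM ler_pM//; apply: HN; by exists s.
  by rewrite p0// mulr0 normr0 mulr_ge0// addr_ge0.
have q0 s : s \notin `[a, b] -> f' (P s) * p s = 0.
  by move=> sab; rewrite p0// mulr0.
pose q s := f' (P s) * p s.
have iq s t := bounded_itv_integrable s t mq qN.
have Qq := prim_integral mq qN q0; have [_ _ _ QE] := Qq.
set Q := (fun t => Rintegral _ _ _) in Qq QE.
pose D t := f (P t) - Q t.
(* [D] has derivative zero everywhere, since [f' (P x)] is close to [f' (P t0)]
   for [x] close to [t0]. *)
have D_le t0 e : 0 < e -> \forall d \near 0^'+, forall s t, s <= t ->
    `|s - t0| <= d -> `|t - t0| <= d -> `|D t - D s| <= e * (t - s).
  (* Both [f' xi] and [f' (P r)] will lie within [e1] of [f' (P t0)], so their difference times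
     [p r] is at most [2 e1 M <= e]. *)
  move=> e0; pose e1 := e / (2 * M + 1).
  have e10 : 0 < e1 by rewrite divr_gt0// ltr_wpDl// mulr_ge0.
  have /cvgrPdist_le/(_ _ e10)[eta /= eta0 Heta] := cf' (P t0).
  near=> d => s t st sd td.
  have d0 : 0 < d by [].
  have near_P r : `|r - t0| <= d -> `|P t0 - P r| < eta.
    move=> rd; rewrite distrC (le_lt_trans (PK _ _))//.
    apply: (@le_lt_trans _ _ ((K + 1) * d)); first by rewrite ler_pM// lerDl.
    rewrite -ltr_pdivlMl ?ltr_wpDl//; near: d; apply: nbhs_right_lt.
    by rewrite mulr_gt0// invr_gt0 ltr_wpDl.
  have Pnear x : `|P t0 - x| < eta -> `|f' (P t0) - f' x| <= e1.
    by move=> ?; exact: Heta.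
  have cf : continuous f.
    move=> x; apply: differentiable_continuous; apply/derivable1_diffP.
    by case: (df x).
  (* The mean value theorem writes the increment of [f \o P] as [f' xi] times that of [P], with [xi]
     between the two values of [P]. The increment of [P] is the integral of [p], so the increment of
     [D] becomes a single integral. *)
  have [xi xiE xin] : exists2 xi, f (P t) - f (P s) = f' xi * (P t - P s) & `|P t0 - xi| < eta.
    have := near_P _ sd; have := near_P _ td; rewrite !ltr_norml => Pt Ps.
    have [Pst|/ltW Pts] := leP (P s) (P t).
      have [|c cin cE] := MVT_segment Pst (fun x _ => df x).
        exact: continuous_subspaceT.
      exists c => //; rewrite ltr_norml; move: cin; rewrite in_itv/=; lra.
    have [|c cin cE] := MVT_segment Pts (fun x _ => df x).
      exact: continuous_subspaceT.
    exists c; first by rewrite -[LHS]opprB cE -mulrN opprB.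
    rewrite ltr_norml; move: cin; rewrite in_itv/=; lra.
  have ixp : mu.-integrable `[s, t] (EFin \o (fun r => f' xi * p r)).
    apply: (bounded_itv_integrable (M := `|f' xi| * M)).
      exact: measurable_funM.
    by move=> x; rewrite normrM ler_wpM2l.
  have -> : D t - D s = \int[mu]_(r in `[s, t]) ((f' xi - f' (P r)) * p r).
    have -> : D t - D s = (f (P t) - f (P s)) - (Q t - Q s) by rewrite /D; ring.
    rewrite xiE QE// pP//.
    rewrite -RintegralZl//; last exact: (bounded_itv_integrable _ _ mp pM).
    rewrite -RintegralB//.
    by apply: eq_Rintegral => r _; rewrite mulrBl.
  apply: (@le_trans _ _ ((2 * e1 * M) * (t - s))).
    apply: Rintegral_itv_le => //.
    - apply: (eq_measurable_fun (fun r => f' xi * p r - f' (P r) * p r)).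
        by move=> r _; rewrite mulrBl.
      by apply: measurable_funB => //; exact: measurable_funM.
    - move=> r /andP[sr rt]; rewrite normrM ler_pM//.
      have rd : `|r - t0| <= d by move: sd td; rewrite !ler_norml; lra.
      have := Pnear _ xin; have := Pnear _ (near_P _ rd).
      rewrite !ler_norml; lra.
    - exists (`|f' xi| * M + N) => r; rewrite mulrBl (le_trans (ler_normB _ _))// lerD//.
      by rewrite normrM ler_wpM2l.
  rewrite ler_wpM2r ?subr_ge0// /e1 mulrAC mulrA ler_pdivrMr ?ltr_wpDl// ?mulr_ge0//.
  by rewrite [leRHS]mulrC ler_wpM2r ?(ltW e0)// lerDl.
have D0 (t0 : R) : is_derive t0 1 D 0.
  have cvg0 : h^-1 *: (D (h *: 1 + t0) - D t0) @[h --> (0:R)^'] --> 0.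
    apply/cvgr0Pnorm_le => e e0.
    have /= [d0 d00 Hd0] := D_le t0 e e0.
    near=> h; rewrite [h *: 1]mulr1.
    have h0 : h != 0 by near: h; exact: nbhs_dnbhs_neq.
    have hd0 : `|h| < d0 by near: h; exact: dnbhs0_lt.
    have h0' : 0 < `|h| by rewrite normr_gt0.
    have Hh : forall s t, s <= t -> `|s - t0| <= `|h| -> `|t - t0| <= `|h| ->
      `|D t - D s| <= e * (t - s).
      by apply: Hd0 => //=; rewrite sub0r normrN normr_id.
    rewrite normrM normfV ler_pdivrMl//.
    have [hp|hn] := leP 0 h.
      have := Hh t0 (h + t0); rewrite lerDr addrK subrr normr0 => /(_ hp (normr_ge0 _) (lexx _)).
      by rewrite (ger0_norm hp) [leRHS]mulrC.
    have := Hh (h + t0) t0; rewrite gerDr addrK subrr normr0.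
    move=> /(_ (ltW hn) (lexx _) (normr_ge0 _)).
    by rewrite distrC (ltr0_norm hn) [leRHS]mulrC (_ : t0 - (h + t0) = - h)//; ring.
  by apply: DeriveDef; [apply/cvg_ex; exists 0|exact/cvg_lim].
have Dcst s t : D s = D t by apply: is_derive_0_is_cst.
split => //; first by exists N.
move=> s t st; rewrite -QE// -/(Q s) -/(Q t).
by have := Dcst s t; rewrite /D/= => E; lra.
Unshelve. all: by end_near.
Qed.
Lemma primM a b P p Q q : prim a b P p -> prim a b Q q ->
  prim a b (fun s => P s * Q s) (fun s => p s * Q s + P s * q s).
Proof.
move=> Pp Qq.
have dsq (x : R) : is_derive x 1 (fun y => y * y) (2 * x).
  by apply: is_derive_eq; rewrite /GRing.scale/=; ring.
have csq : continuous (fun x : R => 2 * x).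
  by move=> x; apply: cvgM; [exact: cvg_cst|exact: cvg_id].
have sqr P' p' : prim a b P' p' -> prim a b (fun s => P' s * P' s) (fun s => 2 * P' s * p' s).
  by move=> P'p'; exact: (prim_chain P'p' dsq csq).
(* Polarization: squares are covered by the chain rule. *)
have H := primZ 2^-1 (primD (sqr _ _ (primD Pp Qq))
  (primD (primZ (-1) (sqr _ _ Pp)) (primZ (-1) (sqr _ _ Qq)))).
rewrite (_ : (fun s => P s * Q s) = (fun s : R =>
      2^-1 * ((P s + Q s) * (P s + Q s) + (-1 * (P s * P s) + -1 * (Q s * Q s))))).
  by apply: (prim_eq H) => s /=; field.
by apply/funext => s; field.
Qed.

Lemma prim_Rintegral_eq0 a b P p : a <= b -> prim a b P p -> P a = P b ->
  \int[mu]_(x in `[a, b]) p x = 0.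
Proof. by move=> ab [_ _ _ Pp] Pab; rewrite -Pp// Pab subrr. Qed.

Lemma prim_C1 a b (f f' : R -> R) : (forall x : R, is_derive x 1 f (f' x)) ->
  continuous f' -> (forall s, s \notin `[a, b] -> f' s = 0) -> prim a b f f'.
Proof.
move=> df cf' f'0.
have cf : continuous f.
  move=> x; apply: differentiable_continuous; apply/derivable1_diffP.
  by case: (df x).
split => //; first by apply: continuous_measurable_fun; exact: cf'.
- have : compact ([set f' s | s in `[a, b]] : set R^o).
    apply: continuous_compact; last exact: segment_compact.
    by apply: continuous_subspaceT; exact: cf'.
  move=> /compact_bounded[N [_ /(_ (`|N| + 1))]].
  move=> /(_ (ltr_pwDr ltr01 (ler_norm N))) HN.
  exists (`|N| + 1) => s; have [sab|sab] := boolP (s \in `[a, b]).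
    by apply: HN; exists s.
  by rewrite f'0// normr0 addr_ge0.
move=> s t; rewrite le_eqVlt => /predU1P[->|st].
  by rewrite subrr set_itv1 Rintegral_set1.
rewrite /Rintegral (continuous_FTC2 (F := f) st)//=.
- exact: continuous_subspaceT.
- split.
  + by move=> x _; case: (df x).
  + by apply: cvg_at_right_filter; exact: cf.
  + by apply: cvg_at_left_filter; exact: cf.
- by move=> x _; rewrite derive1E; case: (df x).
Qed.

(** Up to a constant [P] is the integral of [p] from [-oo], to which Lebesgue differentiation
    applies. This identifies the density of a trajectory with its velocity. *)
Lemma prim_ae_derive a b P p : prim a b P p ->
  {ae mu, forall t, is_derive (t : R) 1 P (p t)}.
Proof.
move=> Pp; have [mp [M pM] p0 _] := Pp.
have Qp := prim_integral mp pM p0; have [c PQ] := prim_unique Pp Qp.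
have ipy y : mu.-integrable `]-oo, y] (EFin \o p).
  exact: integrableS (prim_integrable Pp).
have := FTC1Ny ipy (locally_integrable_bounded mp pM).
apply: filterS; first exact: (ae_filter_ringOfSetsType mu).
move=> t [dQ Q't].
rewrite (_ : P = cst c \+ (fun t => \int[mu]_(x in `]-oo, t]) p x)); last first.
  by apply/funext => s; rewrite PQ.
rewrite -[p t]add0r; apply: is_deriveD.
by apply: DeriveDef; [exact: dQ|rewrite -Q't derive1E].
Qed.
End primitives.

Section density_measure.
Import HBNNSimple.
Local Open Scope ereal_scope.
Context d (T : measurableType d) (R : realType) (mu : {measure set T -> \bar R}).
Variable g : T -> R.
Hypotheses (mg : measurable_fun setT g) (g0 : forall x, (0 <= g x)%R).

Let mge : measurable_fun setT (EFin \o g). Proof. exact/measurable_EFinP. Qed.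
Let ge0 x : 0 <= (EFin \o g) x. Proof. by rewrite lee_fin. Qed.

(** The two proofs are arguments although the body does not mention them: they let the measure
    structure be found from the term alone. *)
Definition density_measure of measurable_fun setT g & (forall x, (0 <= g x)%R) :=
  fun A : set T => \int[mu]_(x in A) (g x)%:E.

Local Notation nu := (density_measure mg g0).

Let nu0 : nu set0 = 0. Proof. exact: integral_set0. Qed.
Let nu_ge0 A : 0 <= nu A. Proof. by apply: integral_ge0 => x _; exact: ge0. Qed.
Let nu_sigma_additive : semi_sigma_additive nu.
Proof. exact: semi_sigma_additive_nng_induced. Qed.

HB.instance Definition _ := isMeasure.Build _ _ _ nu nu0 nu_ge0 nu_sigma_additive.

(** Both sides are limits along the same increasing simple functions; on the indicator of a level
    set the identity is the definition of [density_measure]. *)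
Lemma ge0_integral_density (f : T -> \bar R) : measurable_fun setT f ->
  (forall x, 0 <= f x) -> \int[nu]_x f x = \int[mu]_x (f x * (g x)%:E).
Proof.
move=> mf f0; pose h := nnsfun_approx measurableT mf.
have -> : \int[nu]_x f x = lim (\int[nu]_x (EFin \o h n) x @[n --> \oo]).
  have fE x : f x = lim ((EFin \o h n) x @[n --> \oo]).
    by apply/esym/cvg_lim => //; exact: cvg_nnsfun_approx.
  under eq_integral => x _ do rewrite fE.
  apply: monotone_convergence => //.
  - by move=> n; apply/measurable_EFinP.
  - by move=> n x _ //=; rewrite lee_fin.
  - by move=> x _ a b ab; rewrite lee_fin; exact/lefP/nd_nnsfun_approx.
have -> : \int[mu]_x (f x * (g x)%:E) =
    lim (\int[mu]_x ((EFin \o h n) x * (g x)%:E) @[n --> \oo]).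
  have fg x : f x * (g x)%:E = lim (((EFin \o h n) x * (g x)%:E) @[n --> \oo]).
    apply/esym/cvg_lim => //; apply: cvgeZr => //.
    exact: cvg_nnsfun_approx.
  under eq_integral => x _ do rewrite fg.
  apply: monotone_convergence => //.
  - by move=> n; apply: emeasurable_funM => //; exact/measurable_EFinP.
  - by move=> n x _ /=; rewrite mule_ge0 ?lee_fin.
  - by move=> x _ a b ab/=; rewrite lee_wpmul2r ?lee_fin//; exact/lefP/nd_nnsfun_approx.
suff suf n : \int[nu]_x (EFin \o h n) x = \int[mu]_x ((EFin \o h n) x * (g x)%:E).
  by under eq_fun do rewrite suf.
transitivity (\int[nu]_x (\sum_(y \in range (h n)) (y * \1_(h n @^-1` [set y]) x)%:E)).
  by apply: eq_integral => t tE; rewrite /= fimfunE -fsumEFin.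
rewrite ge0_integral_fsum//; last 2 first.
- by move=> r; apply/measurable_EFinP; exact: measurable_funM.
- by move=> m y Ey; exact: nnfun_muleindic_ge0.
transitivity (\int[mu]_x (\sum_(y \in range (h n))
    (y * \1_(h n @^-1` [set y]) x)%:E * (g x)%:E)); last first.
  under [RHS]eq_integral => x xE.
    rewrite /= fimfunE -fsumEFin// ge0_mule_fsuml => [|y]; last exact: nnfun_muleindic_ge0.
    over.
  by [].
rewrite ge0_integral_fsum//; last 2 first.
- move=> y; apply: emeasurable_funM => //.
  by apply/measurable_EFinP; exact: measurable_funM.
- by move=> m y Ey; rewrite mule_ge0 ?nnfun_muleindic_ge0// lee_fin.
apply: eq_fsbigr => r /[!inE] -[x _ rx].
have r0 : (0 <= r)%R by rewrite -rx.
have mr : measurable (h n @^-1` [set r]) by exact: measurable_sfunP.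
under eq_integral do rewrite EFinM.
rewrite ge0_integralZl//; last exact/measurable_EFinP.
rewrite integral_indic// setIT.
under [RHS]eq_integral do rewrite EFinM -muleA.
rewrite ge0_integralZl//; last 2 first.
- by apply: emeasurable_funM => //; exact/measurable_EFinP.
- by move=> y _; rewrite mule_ge0// lee_fin.
congr (_ * _); rewrite /= /density_measure [LHS]integral_mkcond.
apply: eq_integral => y _; rewrite patchE indicE; case: ifPn => _.
  by rewrite mul1e.
by rewrite mul0e.
Qed.

End density_measure.

Section change_of_variables.
Context {R : realType}.
Local Notation mu := (@lebesgue_measure R).
Local Notation B := (measurableTypeR R).
Variables (L S : R -> R) (c1 c2 : R).
Hypotheses (mL : measurable_fun setT (L : B -> R)) (c10 : 0 < c1)
  (Lc : forall s, c1 <= L s <= c2)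
  (SL : forall s t, s <= t -> S t - S s = \int[mu]_(x in `[s, t]) L x).

Let L0 s : 0 <= L s.
Proof. by have /andP[/(le_trans (ltW c10))] := Lc s. Qed.

Let Lb s : `|L s| <= c2.
Proof. by rewrite ger0_norm//; case/andP: (Lc s). Qed.

Lemma speed_bounds s t : s <= t -> c1 * (t - s) <= S t - S s <= c2 * (t - s).
Proof.
move=> st; apply/andP; split.
  have -> : c1 * (t - s) = \int[mu]_(x in `[s, t]) (cst c1 x).
    by rewrite Rintegral_cst// lebesgue_measure_cc.
  rewrite SL//; apply: le_Rintegral => //.
  - apply: (bounded_itv_integrable (M := `|c1|)) => //; exact: measurable_cst.
  - exact: (bounded_itv_integrable _ _ mL Lb).
  - by move=> x _; case/andP: (Lc x).
rewrite (le_trans (ler_norm _))// SL//.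
by apply: Rintegral_itv_le => //; exists c2.
Qed.

Lemma arclength_homo : {homo S : s t / s < t}.
Proof.
move=> s t st; have /andP[+ _] := speed_bounds (ltW st); rewrite -subr_gt0.
by apply: lt_le_trans; rewrite mulr_gt0// subr_gt0.
Qed.

Lemma arclength_mono : {mono S : s t / s <= t}.
Proof. exact/le_mono/arclength_homo. Qed.

Lemma arclength_continuous : continuous S.
Proof.
have c20 : 0 <= c2 by exact: le_trans (Lb 0).
have SK s t : `|S t - S s| <= c2 * `|t - s|.
  have [st|/ltW ts] := leP s t.
    by rewrite SL// [X in _ * X]ger0_norm ?subr_ge0//; apply: Rintegral_itv_le => //; exists c2.
  rewrite distrC (distrC t) SL// [X in _ * X]ger0_norm ?subr_ge0//.
  by apply: Rintegral_itv_le => //; exists c2.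
move=> s; apply/cvgrPdist_le => e e0; near=> t.
rewrite (le_trans (SK _ _))//.
apply: (@le_trans _ _ ((c2 + 1) * `|s - t|)); first by rewrite ler_wpM2r// lerDl.
rewrite -ler_pdivlMl ?ltr_wpDl//; near: t.
apply: cvgr_dist_le; first exact: cvg_id.
by rewrite mulr_gt0// invr_gt0 ltr_wpDl.
Unshelve. all: by end_near.
Qed.

Lemma arclength_inverse : exists T : R -> R,
  [/\ cancel S T, cancel T S & {mono T : s t / s <= t}].
Proof.
have Ssurj t : exists s, S s = t.
  (* [S] grows at rate at least [c1], so it covers the distance [|t - S 0|] within time
     [|t - S 0| / c1] on either side of [0]. *)
  pose s0 := - (`|t - S 0| / c1); pose s1 := `|t - S 0| / c1.
  have s10 : 0 <= s1 by rewrite divr_ge0// ltW.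
  have s00 : s0 <= 0 by rewrite oppr_le0.
  have S0t : S s0 <= t.
    have /andP[+ _] := speed_bounds s00.
    rewrite /s0 sub0r opprK mulrCA mulfV ?gt_eqF// mulr1 => h.
    have := ler_norm (- (t - S 0)); rewrite normrN; lra.
  have St1 : t <= S s1.
    have /andP[+ _] := speed_bounds s10.
    rewrite /s1 subr0 mulrCA mulfV ?gt_eqF// mulr1 => h.
    have := ler_norm (t - S 0); lra.
  have [||s _ <-] := @IVT R S s0 s1 t (le_trans s00 s10).
  - exact: continuous_subspaceT arclength_continuous.
  - by rewrite ge_min le_max S0t St1/= orbT.
  - by exists s.
have [T TS] := choice Ssurj.
have ST : cancel S T by move=> s; apply: (inc_inj arclength_mono); rewrite TS.
exists T; split => // s t; by rewrite -{2}(TS s) -{2}(TS t) arclength_mono.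
Qed.

(** The image under [S] of the measure with density [L] gives []u, v]] the mass
    [S (T v) - S (T u) = v - u], and half-open intervals determine the Lebesgue measure. *)
Lemma ge0_integral_arclength (f : R -> \bar R) :
  measurable_fun setT (f : B -> \bar R) -> (forall t, 0 <= f t)%E ->
  (\int[mu]_t f t = \int[mu]_s (f (S s) * (L s)%:E))%E.
Proof.
move=> mf f0; have [T [ST TS Tmono]] := arclength_inverse.
have mS : measurable_fun setT (S : B -> B).
  by apply: continuous_measurable_fun; exact: arclength_continuous.
pose nu := density_measure mu mL L0.
have nuS (A : set B) : measurable A -> pushforward nu (S : B -> B) A = mu A.
  move=> mA; apply/esym.
  apply: (lebesgue_measure_unique
    (mu := (pushforward nu (S : B -> B) : {measure set B -> \bar R}))) => //.
  move=> _ [[u v] _ <-] /=.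
  have -> : pushforward nu (S : B -> B) `]u, v] = (\int[mu]_(s in `]T u, T v]) (L s)%:E)%E.
    rewrite /pushforward /= /nu/= /density_measure; congr (integral _ _ _).
    have E s : (T u < s <= T v) = (u < S s <= v).
      by rewrite -(leW_mono arclength_mono (T u)) -(arclength_mono s) !TS.
    by apply/seteqP; split => s /=; rewrite !in_itv/= E.
  have [uv|vu] := ltP u v; last first.
    rewrite !set_itv_ge ?bnd_simp -?leNgt ?Tmono// integral_set0.
    exact: measure0.
  have Tuv : T u <= T v by rewrite Tmono ltW.
  have iL := bounded_itv_integrable (T u) (T v) mL Lb.
  have -> : (\int[mu]_(s in `]T u, T v]) (L s)%:E)%E = (S (T v) - S (T u))%:E.
    have iL' : mu.-integrable `]T u, T v] (EFin \o L).
      by apply: integrableS iL => //; exact: subset_itv_oc_cc.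
    rewrite SL// -Rintegral_itv_obnd_cbnd// /Rintegral fineK//.
    exact: integrable_fin_num.
  rewrite !TS; have := lebesgue_measure_itv `]u, v]; rewrite /= lte_fin uv => ->.
  by rewrite EFinB.
rewrite -(ge0_integral_refine (nu := nu) (mu := mu) mS)//.
rewrite preimage_setT ge0_integral_density//.
exact: measurableT_comp.
Qed.

Lemma integral_arclength (D : set R) (f : R -> \bar R) : measurable (D : set B) ->
  measurable_fun (D : set B) (f : B -> \bar R) ->
  (\int[mu]_(t in D) f t = \int[mu]_(s in S @^-1` D) (f (S s) * (L s)%:E))%E.
Proof.
move=> mD mf; rewrite [LHS]integral_mkcond [RHS]integral_mkcond.
have mfD : measurable_fun setT ((f \_ D) : B -> \bar R).
  exact: (iffLR (measurable_restrictT _ mD)).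
have -> : (fun s => f (S s) * (L s)%:E)%E \_ (S @^-1` D) =
    (fun s => (f \_ D) (S s) * (L s)%:E)%E.
  apply/funext => s; rewrite !patchE.
  rewrite (_ : (s \in S @^-1` D) = (S s \in D)); last by apply/idP/idP; rewrite !inE.
  by case: ifPn => //; rewrite mul0e.
move: (f \_ D) mfD => {mD mf D}f mf.
rewrite [LHS]integralE [RHS]integralE; congr (_ - _)%E.
  rewrite ge0_integral_arclength//; last exact: measurable_funepos.
  apply: eq_integral => s _; rewrite !funeposE maxe_pMl ?lee_fin//.
  congr maxe; exact: mul0e.
rewrite ge0_integral_arclength//; last exact: measurable_funeneg.
apply: eq_integral => s _; rewrite !funenegE.
rewrite maxe_pMl ?lee_fin//; congr maxe; last exact: mul0e.
by rewrite mulNe.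
Qed.

Lemma arclength_preimage_itv T u v : cancel S T -> cancel T S ->
  S @^-1` `[u, v] = `[T u, T v]%classic.
Proof.
move=> ST TS; apply/seteqP; split => s /=; rewrite !in_itv/=;
by rewrite -{1}(arclength_mono (T u)) -(arclength_mono s) !TS.
Qed.

Lemma arclength_inverse_continuous T : cancel T S -> continuous T.
Proof.
move=> TS t; apply/cvgrPdist_le => e e0; near=> u.
have le_T x y : x <= y -> `|T x - T y| <= c1^-1 * `|x - y|.
  move=> xy; have Txy : T x <= T y by rewrite -arclength_mono !TS.
  have /andP[+ _] := speed_bounds Txy; rewrite !TS -ler_pdivlMl// => h.
  by rewrite distrC (distrC x) !ger0_norm ?subr_ge0.
have {}le_T : `|T t - T u| <= c1^-1 * `|t - u|.
  by have [/le_T//|/ltW/le_T] := leP t u; rewrite distrC (distrC u).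
rewrite (le_trans le_T)// ler_pdivrMl//; near: u.
by apply: cvgr_dist_le; [exact: cvg_id|exact: mulr_gt0].
Unshelve. all: by end_near.
Qed.

(** In the integral of the new density, the substitution [t = S s] brings a factor [L s] that
    cancels the denominator. *)
Lemma prim_arclength a b T P p : cancel S T -> cancel T S -> prim a b P p ->
  prim (S a) (S b) (P \o T) (fun t => p (T t) / L (T t)).
Proof.
move=> ST TS [mp [M pM] p0 Pp].
have mq : measurable_fun setT ((fun t => p (T t) / L (T t)) : B -> R).
  have mT : measurable_fun setT (T : B -> B).
    by apply: continuous_measurable_fun; exact: arclength_inverse_continuous.
  apply: measurable_funM; first exact: (measurableT_comp mp mT).
  have mV : measurable_fun (`]0, +oo[%classic : set B) (fun x : B => x^-1 : B).
    apply: open_continuous_measurable_fun; first exact: interval_open.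
    by move=> x; rewrite inE/= in_itv/= andbT => x0; apply: cvgV; rewrite ?gt_eqF.
  have mLT : measurable_fun setT ((L \o T) : B -> B) by exact: (measurableT_comp mL mT).
  apply: (measurable_comp (measurable_itv `]0, +oo[) _ mV mLT).
  move=> _ /= [t _ <-]; rewrite in_itv/= andbT.
  by apply: lt_le_trans c10 _; case/andP: (Lc (T t)).
split => //.
- exists (M / c1) => t; rewrite normrM normfV ler_pM ?invr_ge0//.
  rewrite ger0_norm// lef_pV2 ?posrE//; first by case/andP: (Lc (T t)).
  by apply: lt_le_trans c10 _; case/andP: (Lc (T t)).
- move=> t tab; rewrite p0 ?mul0r//; apply: contra tab.
  by rewrite !in_itv/= -(arclength_mono a) -(arclength_mono _ b) TS.
move=> u v uv; rewrite /= Pp//; last by rewrite -arclength_mono !TS.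
rewrite /Rintegral [X in _ = fine X]integral_arclength//.
  rewrite (arclength_preimage_itv _ _ ST TS); congr fine.
  apply: eq_integral => s _; rewrite ST -EFinM divfK// gt_eqF//.
  by apply: lt_le_trans c10 _; case/andP: (Lc s).
by apply/measurable_EFinP; exact: measurable_funTS.
Qed.

(** The preimage of [N] under [T] has as its measure the integral of [L] over [N]. *)
Lemma arclength_null_preimage T (N : set R) : cancel S T -> cancel T S ->
  measurable (N : set B) -> mu N = 0%E -> mu (T @^-1` N) = 0%E.
Proof.
move=> ST TS mN N0.
have mT : measurable_fun setT (T : B -> B).
  by apply: continuous_measurable_fun; exact: arclength_inverse_continuous.
have mTN : measurable (T @^-1` N : set B) by rewrite -[_ @^-1` _]setTI; exact: mT.
have := integral_arclength mTN (measurable_cst (1%E : \bar R)).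
rewrite integral_cst// mul1e => E; apply: etrans E _.
under eq_integral do rewrite mul1e.
rewrite (_ : S @^-1` (T @^-1` N) = N); last first.
  by apply/seteqP; split => s /=; rewrite ST.
apply: null_set_integral => //.
exact/measurable_EFinP/measurable_funTS.
Qed.

End change_of_variables.

(** * The flow as a dominated family of maps *)

Lemma cvg_floor_div {R : realType} (s : R) :
  (Num.floor (n.+1%:R * s))%:~R / n.+1%:R @[n --> \oo] --> s.
Proof.
apply/cvgrPdist_le => e e0; near=> n.
have n0 : 0 < n.+1%:R :> R by rewrite ltr0n.
have /andP[fl fu] := floor_itv (n.+1%:R * s).
have -> : s - (Num.floor (n.+1%:R * s))%:~R / n.+1%:R =
    (n.+1%:R * s - (Num.floor (n.+1%:R * s))%:~R) / n.+1%:R.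
  by rewrite mulrBl mulrAC mulfV ?mul1r// gt_eqF.
rewrite normrM normfV (gtr0_norm n0) ger0_norm ?subr_ge0//.
apply: (@le_trans _ _ n.+1%:R^-1).
  rewrite ler_piMl ?invr_ge0 ?(ltW n0)// lerBlDl (ltW (lt_le_trans fu _))//.
  by rewrite intrD.
rewrite ltW//; near: n; exact: (near_infty_natSinv_lt (PosNum e0)).
Unshelve. all: by end_near.
Qed.

(** The approximations freeze time at the left end of a grid cell of length [1 / (n+1)]. They
    consist of countably many measurable pieces, and they converge by continuity in time. *)
Lemma measurable_caratheodory_fun {R : realType} d (T : measurableType d)
    (g : T -> R -> R) :
  (forall s, measurable_fun setT (g ^~ s)) -> (forall q, continuous (g q)) ->
  measurable_fun setT (fun z : T * measurableTypeR R => g z.1 z.2).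
Proof.
move=> mg cg.
pose gn (n : nat) (z : T * measurableTypeR R) : R :=
  g z.1 ((Num.floor (n.+1%:R * (z.2 : R)))%:~R / n.+1%:R).
apply: (measurable_fun_cvg (h := gn)); last first.
  move=> [q s] _; rewrite /gn/=.
  exact: (cvg_comp _ _ (@cvg_floor_div R s) (cg q s)).
move=> n _ A mA; rewrite setTI.
have -> : gn n @^-1` A = \bigcup_(k : int)
    ([set q | A (g q (k%:~R / n.+1%:R))] `*`
     `[k%:~R / n.+1%:R, (k + 1)%:~R / n.+1%:R[%classic).
  have n0 : 0 < n.+1%:R :> R by rewrite ltr0n.
  have E (k : int) (s : R) : (k%:~R / n.+1%:R <= s < (k + 1)%:~R / n.+1%:R) =
      (Num.floor (n.+1%:R * s) == k).
    rewrite ler_pdivrMr// ltr_pdivlMr// [s * _]mulrC.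
    apply/idP/eqP => [/floor_def//|<-]; exact: floor_itv.
  apply/seteqP; split => -[q s] /=.
    move=> Aqs; exists (Num.floor (n.+1%:R * s)) => //; split => //=.
    by rewrite in_itv/= E.
  by move=> [k _ [/= Aqk]]; rewrite in_itv/= E /gn/= => /eqP ->.
apply: countable_bigcupT_measurable => // k.
apply: measurableX; last exact: measurable_itv.
by rewrite -[X in measurable X]setTI; exact: (mg _ measurableT).
Qed.
Lemma ge0_integral_le0_ae d (T : measurableType d) (R : realType)
    (mu : {measure set T -> \bar R}) (f : T -> \bar R) :
  measurable_fun setT f -> (forall x, 0 <= f x)%E -> (\int[mu]_x f x <= 0)%E ->
  {ae mu, forall x, f x = 0%E}.
Proof.
move=> mf f0 le0.
have : (\int[mu]_x `|f x| = 0)%E.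
  apply/eqP; rewrite eq_le integral_ge0 ?andbT//.
  by under eq_integral do rewrite gee0_abs//.
by move=> /(iffLR (ae_eq_integral_abs mu measurableT mf)); apply: filterS => q /(_ I).
Qed.

Lemma measurable_fun_limn_einf d (T : measurableType d) (R : realType) (D : set T)
    (f : (T -> \bar R)^nat) :
  (forall n, measurable_fun D (f n)) ->
  measurable_fun D (fun x => limn_einf (f ^~ x)).
Proof.
move=> mf; rewrite /limn_einf; apply: (@measurableT_comp _ _ _ _ _ _ oppe) => //.
by apply: measurable_fun_limn_esup => n; exact: measurableT_comp.
Qed.

Section sigma_finite_plane.
Context {R : realType}.

(** [leb2] under a name of its own, for the inference of its sigma-finiteness. *)
Definition sfleb2 : set (plane R) -> \bar R := leb2 R.

HB.instance Definition _ := Measure.on sfleb2.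

Lemma sigma_finite_leb2 : sigma_finite setT sfleb2.
Proof.
apply: completed_measure_extension_sigma_finite; exact: sigma_finite_lebesgue2.
Qed.

HB.instance Definition _ := Measure_isSigmaFinite.Build _ _ _ sfleb2
  sigma_finite_leb2.

End sigma_finite_plane.

Section dominated_family.
Context {R : realType}.
Local Notation mu := (@lebesgue_measure R).
Local Notation B := (measurableTypeR R).
Local Notation mu2 := (@lebesgue2 R).
Local Notation P := (plane R).
Variables (X : R * R -> R -> R * R) (c : {nonneg R}).
Hypothesis mX : forall s, measurable_fun setT (X ^~ s : P -> B * B).
Hypothesis cX : forall q, continuous (X q).
Hypothesis domX : forall s (A : set (R * R)), measurable (A : set (B * B)) ->
  (leb2 R [set q | A (X q s)] <= c%:num%:E * mu2 A)%E.

Lemma measurable_family :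
  measurable_fun setT (fun z : P * B => X z.1 z.2 : B * B).
Proof.
have m1 : measurable_fun setT (fun z : P * B => (X z.1 z.2).1 : B).
  apply: (@measurable_caratheodory_fun _ _ P (fun q s => (X q s).1)).
    by move=> s; exact: (measurableT_comp measurable_fst (mX s)).
  by move=> q s; apply: cvg_comp; [exact: cX|exact: cvg_fst].
have m2 : measurable_fun setT (fun z : P * B => (X z.1 z.2).2 : B).
  apply: (@measurable_caratheodory_fun _ _ P (fun q s => (X q s).2)).
    by move=> s; exact: (measurableT_comp measurable_snd (mX s)).
  by move=> q s; apply: cvg_comp; [exact: cX|exact: cvg_snd].
rewrite (_ : (fun z => _) = fun z : P * B => ((X z.1 z.2).1, (X z.1 z.2).2)).
  exact: measurable_fun_pair.
by apply/funext => z; case: (X _ _).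
Qed.

(** [domX] compares the image measure of [X ^~ s] with a multiple of [mu2] on sets, and integrals
    are monotone in the measure. *)
Lemma ge0_integral_family_le s (h : R * R -> \bar R) :
  measurable_fun setT (h : B * B -> \bar R) -> (forall x, 0 <= h x)%E ->
  (\int[leb2 R]_q h (X q s) <= c%:num%:E * \int[mu2]_x h x)%E.
Proof.
move=> mh h0; rewrite -ge0_integral_mscale//.
rewrite -[leLHS](@ge0_integral_pushforward _ _ _ _ _ (X ^~ s : P -> B * B) (mX s)
  (leb2 R) setT h)//.
by apply: ge0_le_measure_integral => // A mA; exact: domX.
Qed.

Variables a b : R.

Definition time_integral (h : R * R -> \bar R) (q : R * R) : \bar R :=
  (\int[mu]_(s in `[a, b]) h (X q s))%E.

Lemma time_integralE h q : time_integral h q =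
  (\int[mu]_s (h (X q s) * (\1_(`[a, b]%classic : set R) s)%:E))%E.
Proof.
rewrite /time_integral [LHS]integral_mkcond; apply: eq_integral => s _.
by rewrite patchE indicE; case: ifPn => sI; rewrite ?mule1 ?mule0.
Qed.

Lemma measurable_time_integral h :
  measurable_fun setT (h : B * B -> \bar R) -> (forall x, 0 <= h x)%E ->
  measurable_fun setT (time_integral h : P -> \bar R).
Proof.
move=> mh h0; have -> : time_integral h = fubini_F mu (fun z : P * B =>
    (h (X z.1 z.2) * (\1_(`[a, b]%classic : set R) z.2)%:E)%E).
  by apply/funext => q; rewrite time_integralE.
apply: measurable_fun_fubini_tonelli_F.
  apply: emeasurable_funM; first exact: (measurableT_comp mh measurable_family).
  apply/measurable_EFinP; apply: measurableT_comp; last exact: measurable_snd.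
  by apply: measurable_indic; exact: measurable_itv.
by move=> z; rewrite mule_ge0// lee_fin.
Qed.

Lemma integral_time_integral_le h :
  measurable_fun setT (h : B * B -> \bar R) -> (forall x, 0 <= h x)%E ->
  (\int[leb2 R]_q time_integral h q <=
   (Num.max 0 (b - a) * c%:num)%:E * \int[mu2]_x h x)%E.
Proof.
move=> mh h0.
pose H := fun z : P * B =>
  (h (X z.1 z.2) * (\1_(`[a, b]%classic : set R) z.2)%:E)%E.
have mH : measurable_fun setT H.
  apply: emeasurable_funM; first exact: (measurableT_comp mh measurable_family).
  apply/measurable_EFinP; apply: measurableT_comp; last exact: measurable_snd.
  by apply: measurable_indic; exact: measurable_itv.
have H0 z : (0 <= H z)%E by rewrite mule_ge0// lee_fin.
have -> : (\int[leb2 R]_q time_integral h q =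
    \int[sfleb2]_q \int[mu]_s H (q, s))%E.
  by apply: eq_integral => q _; rewrite time_integralE.
rewrite (fubini_tonelli (m1 := sfleb2) (m2 := mu) H mH H0).
have I0 : (0 <= \int[mu2]_x h x)%E by apply: integral_ge0.
apply: (@le_trans _ _ (\int[mu]_(s in `[a, b]) (c%:num%:E * \int[mu2]_x h x))%E).
  rewrite [leRHS]integral_mkcond; apply: ge0_le_integral; first exact: measurableT.
  - by move=> s _; apply: integral_ge0 => q _; exact: H0.
  - exact: (measurable_fun_fubini_tonelli_G (m1 := sfleb2) H mH H0).
  - apply/(iffLR (measurable_restrictT _ _)); first exact: measurable_itv.
    exact: measurable_cst.
  - move=> s _; rewrite patchE /H; case: ifPn => sI /=.
      rewrite [leLHS](_ : _ = (\int[leb2 R]_q h (X q s))%E).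
        exact: ge0_integral_family_le.
      by apply: eq_integral => q _; rewrite indicE sI mule1.
    rewrite [leLHS](_ : _ = 0%E)//; apply: integral0_eq => q _.
    by rewrite indicE (negbTE sI) mule0.
rewrite integral_cst/=; last exact: measurable_itv.
have := @lebesgue_measure_itv R `[a, b]; rewrite /= => ->.
(* The interval is empty when [b < a]; the maximum with [0] covers this case. *)
have -> : ((if a%:E < b%:E then b%:E + (- a)%:E else 0) = (Num.max 0 (b - a))%:E)%E.
  rewrite lte_fin maxEle subr_ge0 -EFinB.
  by case: ltgtP => //= ->; rewrite subrr.
by rewrite EFinM muleC muleA.
Qed.

Lemma ae_time_integral0 (N : set (R * R)) : measurable (N : set (B * B)) ->
  mu2 N = 0%E -> {ae leb2 R, forall q, mu (`[a, b] `&` [set s | N (X q s)]) = 0%E}.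
Proof.
move=> mN N0.
have mh : measurable_fun setT (fun x : B * B => (\1_N x)%:E : \bar R).
  by apply/measurable_EFinP; exact: measurable_indic.
have h0 x : (0 <= (\1_N x)%:E :> \bar R)%E by rewrite lee_fin.
have := integral_time_integral_le mh h0.
have -> : (\int[mu2]_x (\1_N x)%:E = 0)%E.
  by rewrite -[RHS]N0 integral_indic//; congr (mu2 _); rewrite setIT.
rewrite mule0 => le0.
have T0 (q : P) : (0 <= time_integral (fun x => (\1_N x)%:E) q)%E.
  by apply: integral_ge0.
have := ge0_integral_le0_ae (measurable_time_integral mh h0) T0 le0.
apply: filterS => q /= q0; rewrite -[RHS]q0 /time_integral/=.
have -> : (fun s => (\1_N (X q s))%:E) = (fun s => (\1_[set s | N (X q s)] s)%:E : \bar R).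
  by apply/funext => s; rewrite !indicE; congr (_%:R%:E); apply/idP/idP; rewrite !inE.
have mS : measurable ([set s | N (X q s)] : set B).
  have := measurable_fun_pair2 q measurable_family.
  by move=> /(_ measurableT _ mN); rewrite setTI.
by rewrite setIC; apply/esym/integral_indic => //; exact: measurable_itv.
Qed.

Lemma ae_time_integral_lty h :
  measurable_fun setT (h : B * B -> \bar R) -> (forall x, 0 <= h x)%E ->
  (\int[mu2]_x h x < +oo)%E ->
  {ae leb2 R, forall q, (time_integral h q < +oo)%E}.
Proof.
move=> mh h0 hoo.
have T0 (q : P) : (0 <= time_integral h q)%E by apply: integral_ge0.
have : (leb2 R).-integrable setT (time_integral h : P -> \bar R).
  apply/integrableP; split; first exact: measurable_time_integral.
  under eq_integral do rewrite (gee0_abs (T0 _)).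
  apply: le_lt_trans (integral_time_integral_le mh h0) _.
  by rewrite lte_mul_pinfty// lee_fin mulr_ge0// le_max lexx.
move=> /integrable_ae-/(_ measurableT).
by apply: filterS => q /(_ I); rewrite ge0_fin_numE.
Qed.

(** By Fatou's lemma the liminf has integral zero. It is kept as a liminf and no subsequence is
    extracted: the indices at which the error is small may vary with [q]. *)
Lemma ae_time_integral_liminf (D : (R * R -> \bar R)^nat) :
  (forall n, measurable_fun setT (D n : B * B -> \bar R)) ->
  (forall n x, 0 <= D n x)%E -> (\int[mu2]_x D n x)%E @[n --> \oo] --> 0%E ->
  {ae leb2 R, forall q, limn_einf (fun n => time_integral (D n) q) = 0%E}.
Proof.
move=> mD D0 Dcvg.
have T0 n (q : P) : (0 <= time_integral (D n) q)%E by apply: integral_ge0.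
have mT n := measurable_time_integral (mD n) (D0 n).
have := fatou (leb2 R) measurableT mT (fun n q _ => T0 n q).
have L0 (q : P) : (0 <= limn_einf (fun n => time_integral (D n) q))%E.
  rewrite limn_einf_lim; apply: lime_ge; first exact: is_cvg_einfs.
  by apply: nearW => n; apply: le_ereal_inf_tmp => _ [k _ <-].
have cv0 : ((Num.max 0 (b - a) * c%:num)%:E * \int[mu2]_x D n x)%E @[n --> \oo] --> 0%E.
  by rewrite -[X in _ --> X](mule0 (Num.max 0 (b - a) * c%:num)%:E); exact: cvgeZl.
have icv : limn_einf (fun n => \int[leb2 R]_q time_integral (D n) q)%E = 0%E.
  have : (\int[leb2 R]_q time_integral (D n) q)%E @[n --> \oo] --> 0%E.
    apply: squeeze_cvge cv0; last exact: cvg_cst.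
    apply: nearW => n; rewrite integral_ge0//=.
    exact: integral_time_integral_le.
  by move=> /cvg_limn_einf_sup[].
rewrite icv => le0.
have mL : measurable_fun setT (fun q : P => limn_einf (fun n => time_integral (D n) q)).
  exact: measurable_fun_limn_einf.
exact: ge0_integral_le0_ae.
Qed.

End dominated_family.

Section measurable_open_plane.
Context {R : realType}.
Local Notation B := (measurableTypeR R).

(** [B * B] carries the product sigma-algebra, so an open set is reached as a countable union of
    boxes with rational corners. *)
Lemma open_measurable_plane (U : set (R * R)) : open U -> measurable (U : set (B * B)).
Proof.
move=> oU.
pose box (r : (rat * rat) * (rat * rat)) : set (R * R) :=
  `]ratr r.1.1, ratr r.1.2[ `*` `]ratr r.2.1, ratr r.2.2[.
have -> : U = \bigcup_(r in [set r | box r `<=` U]) box r.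
  apply/seteqP; split => [[x y] Uxy|x [r /= rU rx]]; last exact: rU.
  have [e /= e0 eU] := iffLR (nbhs_ballP _ _) (open_nbhs_nbhs (conj oU Uxy)).
  have xe (z : R) : z - e < z by rewrite ltrBlDr ltrDl.
  have ex (z : R) : z < z + e by rewrite ltrDl.
  have [a] := rat_in_itvoo (xe x); rewrite in_itv/= => /andP[a1 a2].
  have [b] := rat_in_itvoo (ex x); rewrite in_itv/= => /andP[b1 b2].
  have [c] := rat_in_itvoo (xe y); rewrite in_itv/= => /andP[c1 c2].
  have [d] := rat_in_itvoo (ex y); rewrite in_itv/= => /andP[d1 d2].
  exists ((a, b), (c, d)); last by split => /=; rewrite in_itv/= ?a2 ?b1 ?c2 ?d1.
  move=> [z t] [/=]; rewrite !in_itv/= => /andP[az zb] /andP[ct td].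
  by apply: eU; split; rewrite /ball/= ltr_distl; lra.
rewrite bigcup_mkcond; apply: countable_bigcupT_measurable => // r.
by case: ifP => // _; apply: measurableX; exact: measurable_itv.
Qed.

Lemma compact_measurable_plane (K : set (R * R)) : compact K ->
  measurable (K : set (B * B)).
Proof.
move=> /(compact_closed (@norm_hausdorff _ _)) cK.
by rewrite -[K]setCK; apply: measurableC; apply: open_measurable_plane; exact: closed_openC.
Qed.

End measurable_open_plane.

Section extended_flow.
Context {R : realType}.
Local Notation mu := (@lebesgue_measure R).
Local Notation B := (measurableTypeR R).
Local Notation mu2 := (@lebesgue2 R).
Local Notation P := (plane R).
Variables (K : set (R * R)) (rho : R) (v : R * R -> R * R) (Phi : R * R -> R -> R * R).
Hypotheses (cK : compact K) (rho0 : 0 < rho).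
Hypothesis flowPhi : regular_lagrangian_flow K rho v Phi.

(** As a change of time it freezes a trajectory beyond both ends, which keeps it continuous on the
    whole line; applied to values it enforces bounds everywhere. *)
Definition clamp (a b s : R) := Num.max a (Num.min b s).

Lemma clamp_continuous a b : continuous (clamp a b).
Proof.
move=> s; apply: continuous_max; first exact: cvg_cst.
by apply: continuous_min; [exact: cvg_cst|exact: cvg_id].
Qed.

Lemma clamp_itv a b s : a <= b -> clamp a b s \in `[a, b].
Proof.
move=> ab; rewrite in_itv/= /clamp le_max lexx/= ge_max ab/= ge_min lexx//.
Qed.

Lemma clamp_id a b s : s \in `[a, b] -> clamp a b s = s.
Proof.
by rewrite in_itv/= => /andP[sa sb]; rewrite /clamp min_r// max_r.
Qed.

(** Setting the flow to be the identity outside [K] makes its domination by the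
    Lebesgue measure global. *)
Definition ext_flow (q : R * R) (s : R) : R * R :=
  if q \in K then Phi q (clamp (- rho) rho s) else q.

Lemma ext_flow_continuous q : continuous (ext_flow q).
Proof.
have [Kq|Kq] := boolP (q \in K); last first.
  by rewrite /ext_flow (negbTE Kq) => s; exact: cvg_cst.
rewrite /ext_flow Kq => s.
have [/(_ q (set_mem Kq)) cPhi _ _ _] := flowPhi.
have rr : - rho <= rho by rewrite (le_trans _ (ltW rho0))// oppr_le0 ltW.
have cI : `[- rho, rho]%classic (clamp (- rho) rho s) by exact: clamp_itv.
have := (iffLR (subspace_continuousP _ _) cPhi) _ cI.
move=> cPs U /cPs; rewrite /= /within/= => nU.
have := @clamp_continuous (- rho) rho s _ nU.
move=> H; have {}H : \forall t \near s, clamp (- rho) rho t \in `[- rho, rho] ->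
    U (Phi q (clamp (- rho) rho t)) by exact: H.
suff : \forall t \near s, U (Phi q (clamp (- rho) rho t)) by [].
by apply: filterS H => t; apply; exact: clamp_itv.
Qed.

(** Evaluation at a given time is continuous for uniform convergence. The measurability of [Phi] as
    a map into curves thus yields that of each [q |-> Phi q s]. *)
Lemma flow_section_open (U : set (R * R)) s : open U -> s \in `[- rho, rho] ->
  open [set g : {uniform` `[- rho, rho] -> R * R} | U (g s)].
Proof.
move=> oU sI; rewrite openE => g /= Ugs; apply/uniform_nbhs.
have := open_nbhs_nbhs (conj oU Ugs).
rewrite -nbhs_entourageE => -[E eE EU]; exists E; split => // h /(_ s sI) Egh.
by apply: EU; apply/xsectionP.
Qed.

Lemma measurable_ext_flow_component (f : R * R -> R) s : continuous f ->
  measurable_fun setT (fun q : P => f (ext_flow q s) : B).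
Proof.
move=> cf mT; apply: (measurability _ (RGenOInfty.measurableE R)) => //.
move=> _ [_ [a ->] <-].
rewrite setTI.
have rr : - rho <= rho by rewrite (le_trans _ (ltW rho0))// oppr_le0 ltW.
have oU : open (f @^-1` `]a, +oo[%classic) by apply: open_comp => // x _; exact: cf.
have -> : (fun q => f (ext_flow q s)) @^-1` `]a, +oo[%classic =
    [set q | K q /\ [set g : {uniform` `[- rho, rho] -> R * R} |
      (f @^-1` `]a, +oo[%classic) (g (clamp (- rho) rho s))] (Phi q)] `|`
    (f @^-1` `]a, +oo[%classic `\` K).
  apply/seteqP; split => q /=; rewrite /ext_flow.
    by case: ifPn => [/set_mem ? ?|/negP]; [left|rewrite inE; right].
  by case=> -[]; [move=> Kq|move=> + Kq]; [rewrite mem_set|rewrite memNset].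
have [_ mPhi _ _] := flowPhi.
apply: measurableU; first by apply: mPhi; apply: flow_section_open => //; exact: clamp_itv.
apply: measurable_plane; apply: measurableD; first exact: open_measurable_plane.
exact: compact_measurable_plane.
Qed.

Lemma measurable_ext_flow s : measurable_fun setT (ext_flow ^~ s : P -> B * B).
Proof.
rewrite (_ : (fun q => _) = fun q : P => ((ext_flow q s).1, (ext_flow q s).2)).
  apply: measurable_fun_pair; apply: measurable_ext_flow_component => x.
    exact: cvg_fst.
  exact: cvg_snd.
by apply/funext => q; case: (ext_flow _ _).
Qed.

(** Let [E] be the set of points of [K] that reach [A] at time [s]. Its image lies in [A], so the
    lower bound on the measure of images bounds [leb2 R E] by [m] times the measure of [A]. Off [K]
    the extended flow is the identity and adds at most the measure of [A], hence the constant
    [m + 1]. *)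
Lemma ext_flow_dom : exists c : {nonneg R}, forall s (A : set (R * R)),
  measurable (A : set (B * B)) ->
  (leb2 R [set q | A (ext_flow q s)] <= c%:num%:E * mu2 A)%E.
Proof.
have [_ _ _ [m m1 mPhi]] := flowPhi.
have m0 : 0 < m by rewrite (lt_le_trans _ m1).
have rr : - rho <= rho by rewrite (le_trans _ (ltW rho0))// oppr_le0 ltW.
have mm0 : 0 <= m + 1 by rewrite addr_ge0// ltW.
exists (NngNum mm0) => s A mA /=.
pose E : set P := [set q | K q /\ A (ext_flow q s)].
have mE : measurable E.
  apply: measurableI; first by apply: measurable_plane; exact: compact_measurable_plane.
  by rewrite -[X in measurable X]setTI; exact: measurable_ext_flow.
have [+ _] := mPhi E _ mE (fun q => @proj1 _ _) (@clamp_itv (- rho) rho s rr).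
(* The image need not be measurable; [leb2] is monotone all the same, being an outer measure. *)
have imA : (leb2 R ((Phi ^~ (clamp (- rho) rho s)) @` E) <= mu2 A)%E.
  rewrite -(leb2_borel mA); apply: le_mu_ext => _ [q [Kq Aq] <-].
  by move: Aq; rewrite /ext_flow mem_set.
move=> /le_trans/(_ imA).
rewrite -(@lee_pmul2l _ m%:E)// muleA -EFinM mulfV ?gt_eqF// mul1e => EA.
apply: (@le_trans _ _ (leb2 R (E `|` A))%E).
  apply: le_mu_ext => q /=; rewrite /E/=; have [Kq|Kq] := pselect (K q); first by left.
  by rewrite /ext_flow memNset//; right.
apply: (le_trans (measureU2 _ _ _)) => //; first exact: measurable_plane.
rewrite EFinD ge0_muleDl ?lee_fin ?(ltW m0)// mul1e.
apply: leeD; first exact: EA.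
by have /eqP := leb2_borel mA; rewrite eq_le => /andP[].
Qed.

End extended_flow.

(** * The chain rule along a Lipschitz curve *)

Section bounded_integrals.
Context d (T : measurableType d) (R : realType) (m : {measure set T -> \bar R}).

Lemma integrable_mul_bounded (F k : T -> R) (C : R) : m.-integrable setT (EFin \o F) ->
  measurable_fun setT k -> (forall x, `|k x| <= C) ->
  m.-integrable setT (fun x => (F x * k x)%:E).
Proof.
move=> iF mk kC; rewrite (_ : (fun x => _) = ((EFin \o F) \* (EFin \o k))%E)//.
apply: integrableMl => //.
by exists C; split; [exact: num_real|move=> M /ltW CM x _; exact: le_trans (kC x) CM].
Qed.

End bounded_integrals.

Section bounded_fubini.
Context d1 d2 (T1 : measurableType d1) (T2 : measurableType d2) (R : realType).
Variables (m1 : {sigma_finite_measure set T1 -> \bar R})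
  (m2 : {sigma_finite_measure set T2 -> \bar R}).

(** The function equal to [|C| |F y|] for [t] in [D] dominates, and it is integrable because [D] has
    finite measure. The integrability of the inner integral is recorded because this integral is
    later subtracted from another one. *)
Lemma Fubini_bounded (D : set T1) (F : T2 -> R) (k : T1 * T2 -> R) (C : R) :
  measurable D -> (m1 D < +oo)%E -> measurable_fun setT k ->
  (forall z, `|k z| <= C * \1_D z.1) -> m2.-integrable setT (EFin \o F) ->
  \int[m2]_y (F y * \int[m1]_t k (t, y)) = \int[m1]_t \int[m2]_y (F y * k (t, y)) /\
  m1.-integrable setT (fun t => (\int[m2]_y (F y * k (t, y)))%:E).
Proof.
move=> mD Doo mk kC iF.
have mF : measurable_fun setT F by apply/measurable_EFinP; exact: measurable_int iF.
have C0 z : `|k z| <= `|C|.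
  rewrite (le_trans (kC z))// indicE; case: (_ \in _); rewrite ?mulr1 ?mulr0//.
  exact: ler_norm.
pose G (z : T1 * T2) : \bar R := (F z.2 * k z)%:E.
have mG : measurable_fun setT G.
  apply/measurable_EFinP; apply: measurable_funM => //.
  exact: (measurableT_comp mF measurable_snd).
have mk1 t : measurable_fun setT (fun y => k (t, y)) by apply: (measurable_fun_pair2 t mk).
have mk2 y : measurable_fun setT (fun t => k (t, y)) by apply: (measurable_fun_pair1 y mk).
have i2 t : m2.-integrable setT (fun y => G (t, y)).
  by apply: integrable_mul_bounded (mk1 t) _ => // y; exact: C0.
have ik y : m1.-integrable setT (fun t => (k (t, y))%:E).
  apply: (@le_integrable _ _ _ _ _ measurableT _ (fun t => (`|C| * \1_D t)%:E)) => //.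
  - by apply/measurable_EFinP; exact: mk2.
  - move=> t _; rewrite lee_fin normrM normr_id (le_trans (kC (t, y)))//=.
    by rewrite (ger0_norm (_ : 0 <= \1_D t))// ler_wpM2r// ler_norm.
  - rewrite (_ : (fun t => _) = (fun t => (`|C|)%:E * (\1_D t)%:E)%E)//.
    apply: integrableZl => //; apply/integrableP; split.
      by apply/measurable_EFinP; exact: measurable_indic.
    under eq_integral do rewrite gee0_abs ?lee_fin//.
    by rewrite integral_indic// setIT.
have iG : (m1 \x m2)%E.-integrable setT G.
  apply/(integrable21ltyP m1 m2 mG).
  apply: (@le_lt_trans _ _ (\int[m2]_y (((`|C|)%:E * m1 D) * `|(F y)%:E|))%E).
    apply: ge0_le_integral => //.
    - by move=> y _; exact: integral_ge0.
    - apply: (measurable_fun_fubini_tonelli_G (m1 := m1) (abse \o G)) => //=.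
      exact: measurableT_comp.
    - apply: emeasurable_funM; first exact: measurable_cst.
      by apply: measurableT_comp => //; exact/measurable_EFinP.
    - move=> y _; rewrite /G/=.
      apply: (@le_trans _ _ (\int[m1]_t ((`|F y| * `|C|)%:E * (\1_D t)%:E))%E).
        apply: ge0_le_integral => //.
        + apply/measurable_EFinP; apply: measurableT_comp => //.
          by apply: measurable_funM; [exact: measurable_cst|exact: mk2].
        + apply: emeasurable_funM; first exact: measurable_cst.
          by apply/measurable_EFinP; exact: measurable_indic.
        + move=> t _; rewrite -EFinM lee_fin normrM -mulrA ler_wpM2l//.
          by rewrite (le_trans (kC (t, y)))//= ler_wpM2r// ler_norm.
      rewrite ge0_integralZl//; last by apply/measurable_EFinP; exact: measurable_indic.
      by rewrite integral_indic// setIT EFinM -muleA muleC.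
  rewrite ge0_integralZl//; last 2 first.
    by apply: measurableT_comp => //; exact/measurable_EFinP.
    by rewrite mule_ge0.
  apply: lte_mul_pinfty; first by rewrite mule_ge0.
    by rewrite ge0_fin_numE ?mule_ge0// lte_mul_pinfty.
  by have /integrableP[] := iF.
have EG t : (\int[m2]_y G (t, y) = (\int[m2]_y (F y * k (t, y)))%:E)%E.
  by rewrite /Rintegral fineK//; exact: (integrable_fin_num measurableT (i2 t)).
split; last first.
  rewrite (_ : (fun t => _) = (fun t => \int[m2]_y G (t, y))%E).
    exact: integrable_fubini_F.
  exact/esym/funext.
rewrite /Rintegral; congr fine.
transitivity (\int[m2]_y \int[m1]_t G (t, y))%E.
  apply: eq_integral => y _; rewrite EFinM fineK; last first.
    exact: (integrable_fin_num measurableT (ik y)).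
  by rewrite -integralZl.
rewrite -Fubini//.
by apply: eq_integral => t _; rewrite EG.
Qed.

End bounded_fubini.

Section mollification.
Context {R : realType}.
Local Notation mu := (@lebesgue_measure R).
Local Notation B := (measurableTypeR R).
Local Notation mu2 := (@lebesgue2 R).

Lemma measurable_mol2r n (x : R * R) : measurable_fun setT (mol2 n x : B * B -> R).
Proof. by apply: (measurable_fun_pair2 (x : B * B) (measurable_mol2 n)). Qed.

Lemma integral_mol2 n (x : R * R) : (\int[mu2]_y (mol2 n x y)%:E = 1)%E.
Proof.
rewrite /lebesgue2 fubini_tonelli1/=; last 2 first.
- by apply/measurable_EFinP; exact: measurable_mol2r.
- by move=> y; rewrite lee_fin mol2_ge0.
rewrite /fubini_F -[RHS](integral_mol n x.1); apply: eq_integral => a _.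
under eq_integral do rewrite /mol2/= EFinM.
rewrite ge0_integralZl//=.
- by rewrite integral_mol mule1.
- apply/measurable_EFinP; apply: measurableT_comp; first exact: measurable_mol.
  exact: measurable_funB.
- by move=> b _; rewrite lee_fin mol_ge0.
- by rewrite lee_fin mol_ge0.
Qed.

Definition mollify n (h : R * R -> R) (x : R * R) : R :=
  \int[mu2]_y (h y * mol2 n x y).

Lemma mol2_le n (x y : R * R) : `|mol2 n x y| <= (n.+1%:R / bump_mass) ^+ 2.
Proof.
by rewrite ger0_norm ?mol2_ge0// /mol2 expr2 ler_pM// ?mol_ge0// mol_le.
Qed.

(** The kernel has mass [1], so the difference is the integral of [(h x - h y) mol2 n x y] over
    [y]. *)
Lemma mollify_err n (h : R * R -> R) x : mu2.-integrable setT (EFin \o h) ->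
  (`|h x - mollify n h x|%:E <= mol_err n h x)%E.
Proof.
move=> ih; have mm := measurable_mol2r n x.
have im : mu2.-integrable setT (EFin \o (mol2 n x : B * B -> R)).
  apply/integrableP; split; first exact/measurable_EFinP.
  under eq_integral do rewrite gee0_abs ?lee_fin ?mol2_ge0//.
  by rewrite integral_mol2 ltry.
have ihm := integrable_mul_bounded ih mm (mol2_le n x).
have ihx : mu2.-integrable setT (fun y => (h x * mol2 n x y)%:E) 
  by apply: (integrableZl measurableT (h x) im).
have m1 : \int[mu2]_y mol2 n x y = 1 by rewrite /Rintegral integral_mol2.
rewrite -[X in X - _]mulr1 -m1 -RintegralZl// -RintegralB//.
have ihh : mu2.-integrable setT (EFin \o (fun y => h x * mol2 n x y - h y * mol2 n x y)).
  by apply: (integrableB measurableT ihx ihm).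
rewrite EFin_normr_Rintegral// (le_trans (le_abse_integral _ _ _))//.
  exact: measurable_int ihh.
rewrite /mol_err le_eqVlt; apply/orP; left; apply/eqP; apply: eq_integral => y _ /=.
by rewrite -mulrBl normrM distrC (ger0_norm (mol2_ge0 _ _ _)).
Qed.

End mollification.

Section curve_chain_rule.
Context {R : realType}.
Local Notation mu := (@lebesgue_measure R).
Local Notation B := (measurableTypeR R).
Local Notation mu2 := (@lebesgue2 R).
Variables (a b : R) (x1 x2 w1 w2 phi phi' : R -> R) (f g1 g2 : R * R -> R).
Hypotheses (ab : a <= b) (p1 : prim a b x1 w1) (p2 : prim a b x2 w2)
  (pphi : prim a b phi phi') (phia : phi a = 0) (phib : phi b = 0).
Hypotheses (intf : mu2.-integrable setT (EFin \o f))
  (intg1 : mu2.-integrable setT (EFin \o g1))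
  (intg2 : mu2.-integrable setT (EFin \o g2)).
Local Notation X t := (x1 t, x2 t).
Let D : set R := `[a, b]%classic.
Let u1 t := w1 t * phi t.
Let u2 t := w2 t * phi t.

Hypothesis weak1 : \forall n \near \oo, forall t, D t ->
  \int[mu2]_y (f y * (dmol n (x1 t - y.1) * mol n (x2 t - y.2))) = mollify n g1 (X t).
Hypothesis weak2 : \forall n \near \oo, forall t, D t ->
  \int[mu2]_y (f y * (mol n (x1 t - y.1) * dmol n (x2 t - y.2))) = mollify n g2 (X t).
Hypotheses (fX : mu.-integrable D (fun t => (f (X t))%:E))
  (g1X : mu.-integrable D (fun t => (g1 (X t))%:E))
  (g2X : mu.-integrable D (fun t => (g2 (X t))%:E)).
Let err n := (\int[mu]_(t in D)
  (mol_err n f (X t) + mol_err n g1 (X t) + mol_err n g2 (X t)))%E.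
Hypothesis err_small : forall (e : R) n, 0 < e ->
  exists2 m, (n <= m)%N & (err m <= e%:E)%E.

(* [k n (., y)] is the density of [t |-> mol2 n (X t) y * phi t], which vanishes at
   both ends; integrating it against [f y] in the other order produces the
   mollified functions. *)
Let k1 n (z : B * (B * B)) : R :=
  dmol n (x1 z.1 - z.2.1) * mol n (x2 z.1 - z.2.2).
Let k2 n (z : B * (B * B)) : R :=
  mol n (x1 z.1 - z.2.1) * dmol n (x2 z.1 - z.2.2).
Let k3 n (z : B * (B * B)) : R := mol2 n (X z.1) z.2.
Let k n (z : B * (B * B)) : R :=
  u1 z.1 * k1 n z + u2 z.1 * k2 n z + phi' z.1 * k3 n z.

Let bounds : exists M, [/\ 0 < M, forall t, `|u1 t| <= M, forall t, `|u2 t| <= M &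
  forall t, `|phi' t| <= M].
Proof.
have [_ [M1 w1M] w10 _] := p1; have [_ [M2 w2M] w20 _] := p2.
have [_ [M3 phiM] _ _] := pphi.
have [M4 M40 lipphi] := prim_lipschitz pphi.
(* [phi] vanishes at [a], so its Lipschitz constant [M4] bounds it by [C] on the interval. *)
pose C := M4 * (b - a).
have C0 : 0 <= C by rewrite mulr_ge0// subr_ge0.
have phiC t : D t -> `|phi t| <= C.
  rewrite /D/= in_itv/= => /andP[at_ tb].
  have := lipphi a t; rewrite phia subr0 => /le_trans; apply.
  by rewrite ler_wpM2l// ger0_norm ?subr_ge0// lerD2r.
have uM (w : R -> R) N : (forall t, `|w t| <= N) -> (forall t, t \notin `[a, b] -> w t = 0) ->
    forall t, `|w t * phi t| <= N * C.
  move=> wN w0 t; have N0 : 0 <= N by rewrite (le_trans _ (wN 0)).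
  have [tD|tD] := boolP (t \in `[a, b]).
    by rewrite normrM ler_pM// phiC.
  by rewrite w0// mul0r normr0 mulr_ge0.
have := (normr_ge0 (M1 * C), normr_ge0 (M2 * C), normr_ge0 M3).
have := (ler_norm (M1 * C), ler_norm (M2 * C), ler_norm M3).
move=> [[n1 n2] n3] [[m1 m2] m3].
exists (1 + `|M1 * C| + `|M2 * C| + `|M3|); split.
- by lra.
- by move=> t; apply: (le_trans (uM _ _ w1M w10 t)); lra.
- by move=> t; apply: (le_trans (uM _ _ w2M w20 t)); lra.
- by move=> t; apply: (le_trans (phiM t)); lra.
Qed.

Let measurable_u : [/\ measurable_fun setT (u1 : B -> R),
  measurable_fun setT (u2 : B -> R) & measurable_fun setT (phi' : B -> R)].
Proof.
have [mw1 _ _ _] := p1; have [mw2 _ _ _] := p2; have [mp _ _ _] := pphi.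
have mphi : measurable_fun setT (phi : B -> R).
  by apply: continuous_measurable_fun; exact: prim_continuous pphi.
by split => //; exact: measurable_funM.
Qed.

Let u_out t : t \notin `[a, b] -> [/\ u1 t = 0, u2 t = 0 & phi' t = 0].
Proof.
move=> tD; have [_ _ w10 _] := p1; have [_ _ w20 _] := p2; have [_ _ p0 _] := pphi.
by rewrite /u1 /u2 w10// w20// p0// !mul0r.
Qed.

Let measurable_dmol n : measurable_fun setT (dmol n : B -> R).
Proof. by apply: continuous_measurable_fun; exact: dmol_continuous. Qed.

Let measurable_shift (x : R -> R) p (proj : B * B -> B) : prim a b x p ->
  measurable_fun setT proj ->
  measurable_fun setT (fun z : B * (B * B) => x z.1 - proj z.2).
Proof.
move=> px mp; apply: measurable_funB; last exact: (measurableT_comp mp measurable_snd).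
apply: (measurableT_comp _ measurable_fst).
by apply: continuous_measurable_fun; exact: prim_continuous px.
Qed.

Let measurable_k1 n : measurable_fun setT (k1 n).
Proof.
apply: measurable_funM.
  exact: (measurableT_comp (measurable_dmol n) (measurable_shift p1 measurable_fst)).
exact: (measurableT_comp (measurable_mol n) (measurable_shift p2 measurable_snd)).
Qed.

Let measurable_k2 n : measurable_fun setT (k2 n).
Proof.
apply: measurable_funM.
  exact: (measurableT_comp (measurable_mol n) (measurable_shift p1 measurable_fst)).
exact: (measurableT_comp (measurable_dmol n) (measurable_shift p2 measurable_snd)).
Qed.

Let measurable_k3 n : measurable_fun setT (k3 n).
Proof.
apply: measurable_funM.
  exact: (measurableT_comp (measurable_mol n) (measurable_shift p1 measurable_fst)).
exact: (measurableT_comp (measurable_mol n) (measurable_shift p2 measurable_snd)).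
Qed.

Let measurable_k n : measurable_fun setT (k n).
Proof.
have [m1 m2 m3] := measurable_u.
by apply: measurable_funD; [apply: measurable_funD|];
  apply: measurable_funM => //; apply: (measurableT_comp _ measurable_fst).
Qed.

Let bounded_k n : exists2 C, 0 <= C & [/\ forall z, `|k1 n z| <= C,
  forall z, `|k2 n z| <= C & forall z, `|k3 n z| <= C].
Proof.
have [E dE] := @dmol_bounded R n.
have E0 : 0 <= E by rewrite (le_trans _ (dE 0)).
set N := n.+1%:R / @bump_mass R.
have mN u : `|mol n u| <= N by rewrite ger0_norm ?mol_ge0// mol_le.
have N0 : 0 <= N by rewrite (le_trans _ (mN 0)).
exists (E * N + N * N); first by rewrite addr_ge0// mulr_ge0.
split => z; rewrite normrM.
- by rewrite (@le_trans _ _ (E * N))// ?ler_pM// lerDl mulr_ge0.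
- by rewrite (@le_trans _ _ (E * N))// ?[E * N]mulrC ?ler_pM// mulrC lerDl mulr_ge0.
- by rewrite (@le_trans _ _ (N * N))// ?ler_pM// lerDr mulr_ge0.
Qed.

Let k_bounded n : exists C, forall z, `|k n z| <= C * \1_D z.1.
Proof.
have [M [M0 u1M u2M u3M]] := bounds; have [C C0 [k1C k2C k3C]] := bounded_k n.
exists (M * C + M * C + M * C) => z.
have [zD|zD] := boolP (z.1 \in `[a, b]); last first.
  rewrite /k; have [-> -> ->] := u_out zD.
  by rewrite !mul0r !addr0 normr0 mulr_ge0// !addr_ge0// mulr_ge0// ltW.
rewrite indicE mem_set// mulr1 /k (le_trans (ler_normD _ _))// lerD//; last first.
  by rewrite normrM ler_pM.
by rewrite (le_trans (ler_normD _ _))// lerD// normrM ler_pM.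
Qed.

Let prim_k n (y : R * R) :
  prim a b (fun t => mol n (x1 t - y.1) * mol n (x2 t - y.2) * phi t)
    (fun t => k n (t, y)).
Proof.
have shift (x w : R -> R) c : prim a b x w -> prim a b (fun t => mol n (x t - c))
    (fun t => dmol n (x t - c) * w t).
  move=> px; have pxc : prim a b (fun t => x t - c) w.
    by case: px => m B0 o I; split => // s t st; rewrite -I//; ring.
  by apply: (prim_chain pxc); [exact: is_derive_mol|exact: dmol_continuous].
apply: (prim_eq (primM (primM (shift _ _ y.1 p1) (shift _ _ y.2 p2)) pphi)) => t.
by rewrite /k /k1 /k2 /k3 /u1 /u2 /mol2/=; ring.
Qed.

Let integral_k n (y : R * R) : \int[mu]_t k n (t, y) = 0.
Proof.
have := prim_Rintegral_eq0 ab (prim_k n y); rewrite phia phib !mulr0 => /(_ erefl) <-.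
rewrite [RHS]Rintegral_mkcond; apply: eq_Rintegral => t _; rewrite patchE.
case: ifPn => // /negP tD; have tD' : t \notin `[a, b] by apply/negP => h; apply: tD; rewrite inE.
by rewrite /k/=; have [-> -> ->] := u_out tD'; rewrite !mul0r !addr0.
Qed.

Let mollified t n :=
  u1 t * mollify n g1 (X t) + u2 t * mollify n g2 (X t) + phi' t * mollify n f (X t).

Let mD : measurable (D : set B). Proof. exact: measurable_itv. Qed.

(** For every [y] the integral of [k n] in time is zero, so the double integral vanishes. In the
    other order, the weak identities turn the two terms with [dmol] into mollified gradients. *)
Let fubini_k n : (forall t, D t ->
    \int[mu2]_y (f y * (dmol n (x1 t - y.1) * mol n (x2 t - y.2))) = mollify n g1 (X t)) ->
  (forall t, D t ->
    \int[mu2]_y (f y * (mol n (x1 t - y.1) * dmol n (x2 t - y.2))) = mollify n g2 (X t)) ->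
  \int[mu]_(t in D) mollified t n = 0 /\
  mu.-integrable D (fun t => (mollified t n)%:E).
Proof.
move=> E1 E2.
have [C kC] := k_bounded n.
have [FE iF] := @Fubini_bounded _ _ B (B * B)%type R mu mu2 D f (k n) C mD
  (lebesgue_measure_cc_lty a b) (measurable_k n) kC intf.
have LE t : \int[mu2]_y (f y * k n (t, y)) = (mollified t n) * \1_D t.
  have [tD|tD] := boolP (t \in `[a, b]); last first.
    have [z1 z2 z3] := u_out tD.
    rewrite /k/= z1 z2 z3 /mollified z1 z2 z3.
    rewrite !mul0r !addr0 mul0r; transitivity (\int[mu2]_(y in setT) (0 : R)).
      by apply: eq_Rintegral => y _; rewrite !mul0r !addr0 mulr0.
    by rewrite Rintegral_cst// mul0r.
  rewrite indicE mem_set// mulr1 /mollified -E1// -E2//.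
  have [N N0 [k1N k2N k3N]] := bounded_k n.
  have mk (h : B * (B * B) -> R) : measurable_fun setT h ->
      measurable_fun setT (fun y => h (t, y)).
    by move=> mh; apply: (measurable_fun_pair2 (t : B) mh).
  have i1 := integrable_mul_bounded intf (mk _ (measurable_k1 n)) (fun y => k1N (t, y)).
  have i2 := integrable_mul_bounded intf (mk _ (measurable_k2 n)) (fun y => k2N (t, y)).
  have i3 := integrable_mul_bounded intf (mk _ (measurable_k3 n)) (fun y => k3N (t, y)).
  have j1 := integrableZl measurableT (u1 t) i1.
  have j2 := integrableZl measurableT (u2 t) i2.
  have j3 := integrableZl measurableT (phi' t) i3.
  transitivity (\int[mu2]_y (u1 t * (f y * k1 n (t, y)) + u2 t * (f y * k2 n (t, y)) +
      phi' t * (f y * k3 n (t, y)))).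
    by apply: eq_Rintegral => y _; rewrite /k/=; ring.
  rewrite RintegralD//; last by apply: (integrableD measurableT j1 j2).
  by rewrite RintegralD// !RintegralZl.
split.
  rewrite Rintegral_mkcond.
  transitivity (\int[mu]_t \int[mu2]_y (f y * k n (t, y))).
    apply: eq_Rintegral => t _; rewrite LE patchE indicE.
    by case: ifPn => _; rewrite ?mulr1 ?mulr0.
  rewrite -FE; transitivity (\int[mu2]_(y in setT) (0 : R)).
    by apply: eq_Rintegral => y _; rewrite integral_k mulr0.
  by rewrite Rintegral_cst// mul0r.
have : mu.-integrable D (fun t => (\int[mu2]_y (f y * k n (t, y)))%:E).
  exact: integrableS iF.
apply: eq_integrable => // t tD; rewrite LE indicE.
by rewrite tD mulr1.
Qed.

(** The mollified integrand has integral zero and differs from the true one by at most [M] times the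
    three errors. This bound holds for all large [n], while [err_small] makes [err] at most [e / M]
    at some arbitrarily large index; the two meet. *)
Theorem curve_chain_rule :
  \int[mu]_(t in D) ((w1 t * g1 (X t) + w2 t * g2 (X t)) * phi t + f (X t) * phi' t) = 0.
Proof.
have [M [M0 u1M u2M u3M]] := bounds; have [mu1 mu2_ mu3] := measurable_u.
pose A t := u1 t * g1 (X t) + u2 t * g2 (X t) + phi' t * f (X t).
transitivity (\int[mu]_(t in D) A t).
  by apply: eq_Rintegral => t _; rewrite /A /u1 /u2; ring.
have iu (u h : R -> R) : measurable_fun setT (u : B -> R) -> (forall t, `|u t| <= M) ->
    mu.-integrable D (fun t => (h t)%:E) -> mu.-integrable D (fun t => (u t * h t)%:E).
  move=> mu' uM ih; rewrite (_ : (fun t => _) = ((EFin \o u) \* (fun t => (h t)%:E))%E)//.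
  apply: integrableMr => //; first exact: measurable_funTS.
  by exists M; split; [exact: num_real|move=> N /ltW MN t _; exact: le_trans (uM t) MN].
have i1 := iu _ _ mu1 u1M g1X; have i2 := iu _ _ mu2_ u2M g2X; have i3 := iu _ _ mu3 u3M fX.
have iA : mu.-integrable D (EFin \o A).
  by apply: (integrableD mD (integrableD mD i1 i2) i3).
have mX : measurable_fun setT (fun t : B => X t : B * B).
  apply: measurable_fun_pair; apply: continuous_measurable_fun.
    exact: prim_continuous p1.
  exact: prim_continuous p2.
have mint (h : R * R -> R) : mu2.-integrable setT (EFin \o h) ->
    measurable_fun setT (h : B * B -> R).
  by move=> ih; apply/measurable_EFinP; exact: measurable_int ih.
have mE n (h : R * R -> R) : mu2.-integrable setT (EFin \o h) ->
    measurable_fun setT (fun t : B => mol_err n h (X t)).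
  by move=> /mint mh; exact: (measurableT_comp (measurable_mol_err n mh) mX).
have Aerr : \forall n \near \oo, (`|\int[mu]_(t in D) A t|%:E <= M%:E * err n)%E.
  near=> n.
  have [L0 iL] : \int[mu]_(t in D) mollified t n = 0 /\
      mu.-integrable D (fun t => (mollified t n)%:E).
    by apply: fubini_k; near: n.
  have -> : \int[mu]_(t in D) A t = \int[mu]_(t in D) (A t - mollified t n).
    by rewrite RintegralB// L0 subr0.
  have iAL : mu.-integrable D (EFin \o (fun t => A t - mollified t n)).
    by apply: (integrableB mD iA iL).
  rewrite EFin_normr_Rintegral// (le_trans (le_abse_integral _ _ _))//.
    exact: measurable_int iAL.
  rewrite /err -ge0_integralZl//; last 3 first.
  - apply: measurable_funTS; apply: emeasurable_funD; last exact: mE.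
    by apply: emeasurable_funD; exact: mE.
  - by move=> t _; apply: adde_ge0; [apply: adde_ge0|]; exact: mol_err_ge0.
  - by rewrite lee_fin ltW.
  apply: ge0_le_integral => //.
  - by apply: measurableT_comp => //; exact: measurable_int iAL.
  - apply: emeasurable_funM; first exact: measurable_cst.
    apply: measurable_funTS; apply: emeasurable_funD; last exact: mE.
    by apply: emeasurable_funD; exact: mE.
  move=> t _ /=.
  have e1 := mollify_err n (X t) intf; have e2 := mollify_err n (X t) intg1.
  have e3 := mollify_err n (X t) intg2.
  apply: (@le_trans _ _ (M%:E * (`|f (X t) - mollify n f (X t)|%:E +
      `|g1 (X t) - mollify n g1 (X t)|%:E + `|g2 (X t) - mollify n g2 (X t)|%:E))%E); last first.
    by rewrite lee_pmul2l// leeD// leeD.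
  rewrite -!EFinD -EFinM lee_fin.
  have -> : A t - mollified t n = u1 t * (g1 (X t) - mollify n g1 (X t)) +
      u2 t * (g2 (X t) - mollify n g2 (X t)) + phi' t * (f (X t) - mollify n f (X t)).
    by rewrite /A /mollified; ring.
  have uM u h : `|u| <= M -> `|u * h| <= M * `|h| by move=> uM; rewrite normrM ler_wpM2r.
  have h1 := uM _ (g1 (X t) - mollify n g1 (X t)) (u1M t).
  have h2 := uM _ (g2 (X t) - mollify n g2 (X t)) (u2M t).
  have h3 := uM _ (f (X t) - mollify n f (X t)) (u3M t).
  have tri (p q r : R) : `|p + q + r| <= `|p| + `|q| + `|r|.
    by rewrite (le_trans (ler_normD _ _))// lerD2r ler_normD.
  apply: (le_trans (tri _ _ _)); apply: (le_trans (lerD (lerD h1 h2) h3)).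
  by rewrite le_eqVlt; apply/orP; left; apply/eqP; ring.
have [N _ NA] := Aerr.
apply/normr0_eq0/eqP; rewrite eq_le normr_ge0 andbT; apply/ler_addgt0Pr => e e0.
have [|m Nm em] := err_small N (_ : 0 < e / M); first by rewrite divr_gt0.
rewrite add0r -lee_fin (le_trans (NA m Nm))//.
by rewrite -lee_pdivlMl// -EFinM mulrC.
Unshelve. all: by end_near.
Qed.

End curve_chain_rule.

(** * Borel representatives *)

Section borel_representatives.
Context {R : realType}.
Local Notation mu := (@lebesgue_measure R).
Local Notation B := (measurableTypeR R).
Local Notation mu2 := (@lebesgue2 R).
Variable Omega : set (R * R).
Hypothesis mO : measurable (Omega : set (B * B)).

(** The value [0] off [Omega] and on the discarded null set turns integrals over [Omega] into
    integrals of a Borel function over the plane. *)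
Lemma borel_representative (f : R * R -> R) :
  measurable_fun (Omega : set (plane R)) (f : plane R -> R) ->
  exists f' N, [/\ measurable_fun setT (f' : B * B -> R),
    measurable (N : set (B * B)), mu2 N = 0%E,
    (forall x, Omega x -> ~ N x -> f' x = f x) &
    forall x, ~ Omega x \/ N x -> f' x = 0].
Proof.
move=> mf.
have [N [mN N0 mfN]] := caratheodory_measurable_fun_ae (@sigma_finite_lebesgue2 R) mO mf.
exists (f \_ (Omega `\` N)), N; split => //.
- exact: (iffLR (measurable_restrictT (f : B * B -> R) (measurableD mO mN)) mfN).
- by move=> x Ox Nx; rewrite patchE mem_set.
- by move=> x H; rewrite patchE memNset// => -[]; case: H.
Qed.

(** Clamping turns bounds valid almost everywhere into bounds valid everywhere; the points of
    [Omega] where they fail join the null set. *)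
Lemma bounded_representative (f : R * R -> R) (a b : R) : a <= b ->
  measurable_fun (Omega : set (plane R)) (f : plane R -> R) ->
  {ae leb2 R, forall x, Omega x -> a <= f x <= b} ->
  exists f' N, [/\ measurable_fun setT (f' : B * B -> R),
    measurable (N : set (B * B)), mu2 N = 0%E,
    (forall x, Omega x -> ~ N x -> f' x = f x) &
    forall x, a <= f' x <= b].
Proof.
move=> ab /borel_representative[f' [N [mf' mN N0 f'f _]]].
move=> /completed_negligible_sub[N' [mN' N'0 sub]].
exists (fun x => clamp a b (f' x)), (N `|` N'); split.
- by apply: measurableT_comp => //; apply: continuous_measurable_fun; exact: clamp_continuous.
- exact: measurableU.
- exact: null_set_setU.
- move=> x Ox NN; rewrite f'f//; last by move=> ?; apply: NN; left.
  apply: clamp_id; rewrite in_itv/=; apply: contrapT => H; apply: NN; right.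
  by apply: sub => /(_ Ox).
- by move=> x; have := clamp_itv (f' x) ab; rewrite in_itv.
Qed.

Lemma Rintegral_representative (f f' k : R * R -> R) (N : set (R * R)) :
  measurable_fun (Omega : set (plane R)) (f : plane R -> R) ->
  measurable_fun setT (f' : B * B -> R) -> measurable_fun setT (k : B * B -> R) ->
  measurable (N : set (B * B)) -> mu2 N = 0%E ->
  (forall x, Omega x -> ~ N x -> f' x = f x) ->
  (forall x, ~ Omega x \/ N x -> f' x = 0) ->
  \int[leb2 R]_(x in Omega) (f x * k x) = \int[mu2]_x (f' x * k x).
Proof.
move=> mf mf' mk mN N0 f'f f'0.
have mfk : measurable_fun setT (fun x : B * B => (f' x * k x)%:E).
  by apply/measurable_EFinP; exact: measurable_funM.
rewrite /Rintegral -integral_leb2//; congr fine.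
transitivity (\int[leb2 R]_(x in Omega) (f' x * k x)%:E)%E; last first.
  rewrite [LHS]integral_mkcond; apply: eq_integral => x _; rewrite patchE.
  by case: ifPn => // /negP Ox; rewrite f'0 ?mul0r//; left => ?; apply: Ox; rewrite inE.
apply: ae_eq_integral; first exact: measurable_plane.
- apply/measurable_EFinP; apply: measurable_funM => //.
  exact: (measurable_fun_plane (measurable_funTS mk)).
- exact: (measurable_fun_plane (measurable_funTS mfk)).
exists N; split; first exact: measurable_plane.
  by rewrite leb2_borel.
move=> x /= H; apply: contrapT => Nx; apply: H => Ox.
by rewrite f'f.
Qed.

Lemma L1_representative (f f' : R * R -> R) (N : set (R * R)) : L1 Omega f ->
  measurable_fun setT (f' : B * B -> R) ->
  measurable (N : set (B * B)) ->
  (forall x, Omega x -> ~ N x -> f' x = f x) ->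
  (forall x, ~ Omega x \/ N x -> f' x = 0) ->
  mu2.-integrable setT (EFin \o f').
Proof.
move=> /integrableP[mf foo] mf' mN f'f f'0; apply/integrableP; split.
  exact/measurable_EFinP.
have mf'' : measurable_fun setT (fun x : B * B => `|f' x|%:E).
  by apply/measurable_EFinP; exact: measurableT_comp.
have := integral_leb2 measurableT mf''; rewrite /= => <-.
apply: le_lt_trans foo; rewrite [leRHS]integral_mkcond.
apply: ge0_le_integral; first exact: measurableT.
- by move=> x _; rewrite lee_fin.
- exact: (measurable_fun_plane mf'' measurableT).
- apply: (iffLR (measurable_restrictT _ (measurable_plane mO))); exact: measurableT_comp.
move=> x _; rewrite patchE; case: ifPn => [/set_mem Ox|/negP Ox].
  have [Nx|Nx] := pselect (N x); last by rewrite f'f.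
  by rewrite (f'0 x (or_intror Nx)) normr0 lee_fin.
have nO : ~ Omega x by move=> ?; apply: Ox; rewrite inE.
by rewrite (f'0 x (or_introl nO)) normr0.
Qed.

End borel_representatives.

Section line_representatives.
Context {R : realType}.
Local Notation mu := (@lebesgue_measure R).
Local Notation B := (measurableTypeR R).
Variables (A N : set R) (f p : R -> R).
Hypotheses (mA : measurable (A : set B)) (mp : measurable_fun setT (p : B -> R))
  (mN : measurable (N : set B)) (N0 : mu N = 0%E)
  (fp : forall t, A t -> ~ N t -> f t = p t).

Let mpl : measurable_fun (A : set (line R)) (fun t : line R => (p t)%:E).
Proof.
apply: measurable_fun_line => //; apply/measurable_EFinP; exact: measurable_funTS.
Qed.

Let ae_fp : ae_eq (leb1 R) (A : set (line R)) (fun t => (p t)%:E) (fun t => (f t)%:E).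
Proof.
exists N; split; [exact: measurable_line|exact: N0|].
by move=> t /= H; apply: contrapT => Nt; apply: H => At; rewrite fp.
Qed.

(** Nothing is known of [f] except that it agrees with a Borel function off a null set; the
    completeness of [leb1] makes it measurable. *)
Let mfl : measurable_fun (A : set (line R)) (fun t : line R => (f t)%:E).
Proof. exact: (ae_measurable_fun (@leb1_complete R) ae_fp mpl). Qed.

Let mpe : measurable_fun (A : set B) (fun t : B => (p t)%:E).
Proof. by apply/measurable_EFinP; exact: measurable_funTS. Qed.

Lemma integral_line_representative :
  (\int[leb1 R]_(t in A) (f t)%:E = \int[mu]_(t in A) (p t)%:E)%E.
Proof.
rewrite -(integral_leb1 mA mpe).
by apply/esym; apply: ae_eq_integral => //; exact: measurable_line.
Qed.

Lemma Rintegral_line_representative :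
  \int[leb1 R]_(t in A) f t = \int[mu]_(t in A) p t.
Proof. by rewrite /Rintegral integral_line_representative. Qed.

Lemma L1_itv_representative : mu.-integrable A (fun t => (p t)%:E) -> L1_itv A f.
Proof.
move=> /integrableP[_ poo]; apply/integrableP; split; first exact: mfl.
have mpa : measurable_fun (A : set B) (fun t : B => `|(p t)%:E|%E).
  exact: measurableT_comp.
rewrite (_ : (\int[_]_(x in _) _ = \int[mu]_(t in A) `|(p t)%:E|)%E)//.
rewrite -(integral_leb1 mA mpa); apply/esym; apply: ae_eq_integral.
- exact: measurable_line.
- by apply: measurableT_comp => //; exact: mpl.
- by apply: measurableT_comp => //; exact: mfl.
by apply: filterS ae_fp => t fpt At; rewrite fpt.
Qed.

End line_representatives.

Lemma int0_representative {R : realType} (A N : set R) (f p P : R -> R) (s : R) :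
  measurable_fun setT (p : measurableTypeR R -> R) ->
  measurable (N : set (measurableTypeR R)) -> lebesgue_measure N = 0%E ->
  (forall t, A t -> ~ N t -> f t = p t) ->
  `[0, s] `<=` A -> `[s, 0] `<=` A ->
  (forall s t, s <= t -> P t - P s = \int[lebesgue_measure]_(x in `[s, t]) p x) ->
  int0 f s = P s - P 0.
Proof.
move=> mp mN N0 fp A1 A2 PI; rewrite /int0; case: ifPn => [s0|].
  rewrite PI//; apply: Rintegral_line_representative mN N0 _ => //.
  by move=> t /A1; exact: fp.
rewrite -ltNge => s0; rewrite -[RHS]opprB PI ?(ltW s0)//; congr (- _).
apply: Rintegral_line_representative mN N0 _ => //.
by move=> t /A2; exact: fp.
Qed.

(** * Reparametrized trajectories *)

Section arclength_parametrization.
Context {R : realType}.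
Local Notation mu := (@lebesgue_measure R).
Local Notation B := (measurableTypeR R).
Variables (a b c1 c2 : R) (l L : R -> R) (N : set R).
Hypotheses (a0 : a <= 0) (b0 : 0 <= b).
Hypotheses (mL : measurable_fun setT (L : B -> R)) (c10 : 0 < c1)
  (Lc : forall s, c1 <= L s <= c2)
  (mN : measurable (N : set B)) (N0 : mu N = 0%E)
  (lL : forall s, s \in `[a, b] -> ~ N s -> l s = L s).

(** [prim_integral] is about densities that vanish outside [[a, b]]. The function [L - c1] is one,
    and the linear term [c1 * s] restores the rest. *)
Lemma arclength_primitive : (forall s, s \notin `[a, b] -> L s = c1) ->
  exists S : R -> R,
  (forall s t, s <= t -> S t - S s = \int[mu]_(x in `[s, t]) L x) /\ S 0 = 0.
Proof.
move=> L1.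
have Lb s : `|L s - c1| <= c2 - c1.
  by have /andP[h1 h2] := Lc s; rewrite ger0_norm ?subr_ge0// lerD2r.
have mLc : measurable_fun setT ((fun s => L s - c1) : B -> R).
  by apply: measurable_funB => //; exact: measurable_cst.
have [|_ _ _ PI] := @prim_integral R a b (fun s => L s - c1) _ mLc Lb.
  by move=> s /L1 ->; rewrite subrr.
pose Q t := \int[mu]_(x in `]-oo, t]) (L x - c1).
exists (fun s => c1 * s + (Q s - Q 0)); split; last by rewrite mulr0 subrr addr0.
move=> s t st.
have -> : c1 * t + (Q t - Q 0) - (c1 * s + (Q s - Q 0)) = Q t - Q s + c1 * (t - s) by ring.
rewrite /Q PI//.
have -> : c1 * (t - s) = \int[mu]_(x in `[s, t]) c1.
  rewrite Rintegral_cst; last exact: measurable_itv.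
  by rewrite lebesgue_measure_cc.
rewrite -RintegralD; last 3 first.
- exact: measurable_itv.
- exact: bounded_itv_integrable Lb.
- by apply: (@bounded_itv_integrable _ _ `|c1|) => //; exact: measurable_cst.
by apply: eq_Rintegral => x _; rewrite subrK.
Qed.

Variables S T : R -> R.
Hypotheses (SL : forall s t, s <= t -> S t - S s = \int[mu]_(x in `[s, t]) L x)
  (S0 : S 0 = 0) (ST : cancel S T) (TS : cancel T S).

Lemma int0_arclength s : s \in `[a, b] -> int0 l s = S s.
Proof.
rewrite in_itv/= => /andP[as_ sb].
rewrite -[RHS]subr0 -S0; apply: (int0_representative (A := `[a, b]%classic) mL mN N0) => //.
  by move=> t /=; rewrite !in_itv/= => /andP[t0 ts]; rewrite (le_trans a0 t0) (le_trans ts sb).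
by move=> t /=; rewrite !in_itv/= => /andP[t0 ts]; rewrite (le_trans as_ t0) (le_trans ts b0).
Qed.

Let Smono := arclength_mono mL c10 Lc SL.

Let Tmono : {mono T : s t / s <= t}.
Proof. by move=> s t; rewrite -(Smono (T s)) !TS. Qed.

Lemma L1_itv_speed : L1_itv `[a, b] l.
Proof.
apply: (@L1_itv_representative _ _ N l L);
  [exact: measurable_itv|exact: mL|exact: mN|exact: N0|exact: lL|].
apply: (@bounded_itv_integrable _ L c2) => // x.
have /andP[h1 h2] := Lc x; rewrite ger0_norm//; exact: le_trans (ltW c10) h1.
Qed.

Local Notation sig := (int0 l).
Local Notation tau := ('pinv_(fun=> 0) `[a, b] sig).

Let aI : a \in `[a, b]. Proof. by rewrite in_itv/= lexx (le_trans a0). Qed.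

Let bI : b \in `[a, b]. Proof. by rewrite in_itv/= lexx (le_trans a0). Qed.

Let siginj : {in `[a, b]%classic &, injective sig}.
Proof.
move=> s t; rewrite !inE => sI tI; rewrite !int0_arclength// => /(congr1 T).
by rewrite !ST.
Qed.

Lemma arclength_inverse_itv t : t \in `[S a, S b] -> T t \in `[a, b].
Proof. by rewrite !in_itv/= -(Smono a) -(Smono _ b) !TS. Qed.

Lemma pinv_arclength t : t \in `[S a, S b] -> tau t = T t.
Proof.
move=> /arclength_inverse_itv TI.
have E : sig (T t) = t by rewrite int0_arclength// TS.
by rewrite -[in LHS]E pinvKV// inE.
Qed.

Lemma arclength_set_bij : set_bij `[a, b] `[sig a, sig b] sig.
Proof.
rewrite !int0_arclength//; split; last 2 first.
- exact: siginj.
- by move=> t /= /arclength_inverse_itv TI; exists (T t) => //; rewrite int0_arclength// TS.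
move=> s /= sI; rewrite int0_arclength//; move: sI; rewrite !in_itv/=.
by rewrite !Smono.
Qed.

Lemma arclength_increasing : strictly_increasing_on `[sig a, sig b] tau.
Proof.
rewrite !int0_arclength// => s t /= sJ tJ st.
rewrite !pinv_arclength// ltNge Tmono -ltNge//.
Qed.

Lemma arclength_bilipschitz : bilipschitz_on `[sig a, sig b] tau.
Proof.
have c20 : 0 < c2 by have /andP[h1 h2] := Lc 0; rewrite (lt_le_trans c10)// (le_trans h1).
have k0 : 0 < c2 + c1^-1 by rewrite addr_gt0// invr_gt0.
(* The slopes of [T] lie between [1 / c2] and [1 / c1]; the chosen constant is at least [c2] and at
   least [1 / c1], so it serves for both inequalities. *)
rewrite !int0_arclength//; exists (c2 + c1^-1); split => // s t /= sJ tJ.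
rewrite !pinv_arclength//.
have main u w : u <= w -> (c2 + c1^-1)^-1 * `|u - w| <= `|T u - T w| <= (c2 + c1^-1) * `|u - w|.
  move=> uw; have Tuw : T u <= T w by rewrite Tmono.
  have := speed_bounds mL c10 Lc SL Tuw; rewrite !TS => /andP[h1 h2].
  rewrite !(distrC u) !(distrC (T u)) !ger0_norm ?subr_ge0//; apply/andP; split.
    rewrite mulrC ler_pdivrMr//; apply: (le_trans h2).
    by rewrite mulrC ler_wpM2l ?subr_ge0// lerDl invr_ge0 ltW.
  rewrite (@le_trans _ _ (c1^-1 * (w - u)))//.
    by rewrite mulrC ler_pdivlMr// mulrC.
  by rewrite ler_wpM2r ?subr_ge0// lerDr ltW.
have [st|/ltW ts] := leP s t; first exact: main.
by rewrite distrC [`|T s - _|]distrC; exact: main.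
Qed.

(** The substitution [t = S s] has Jacobian [L], which is at most [c2]. *)
Lemma ge0_integral_reparam_le (F : R -> \bar R) : measurable_fun setT (F : B -> \bar R) ->
  (forall s, 0 <= F s)%E ->
  (\int[mu]_(t in `[S a, S b]) F (T t) <= c2%:E * \int[mu]_(s in `[a, b]) F s)%E.
Proof.
move=> mF F0.
have c20 : 0 < c2 by have /andP[h1 h2] := Lc 0; rewrite (lt_le_trans c10)// (le_trans h1).
have mT : measurable_fun setT (T : B -> B).
  by apply: continuous_measurable_fun; exact: (arclength_inverse_continuous mL c10 Lc SL TS).
have mFT : measurable_fun setT (fun t : B => F (T t)) by exact: measurableT_comp.
rewrite (integral_arclength mL c10 Lc SL); last 2 first.
- exact: measurable_itv.
- exact: measurable_funTS.
rewrite (arclength_preimage_itv mL c10 Lc SL _ _ ST TS) !ST -ge0_integralZl//; last 2 first.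
- exact: measurable_funTS.
- by rewrite lee_fin ltW.
apply: ge0_le_integral; first exact: measurable_itv.
- by move=> s _; rewrite mule_ge0// lee_fin; have /andP[h _] := Lc s; rewrite (le_trans (ltW c10)).
- apply: measurable_funTS; apply: emeasurable_funM; last exact/measurable_EFinP.
  by rewrite (_ : (fun s => _) = F)//; apply/funext => s; rewrite ST.
- by apply: measurable_funTS; apply: emeasurable_funM => //; exact: measurable_cst.
- by move=> s _; rewrite ST muleC lee_wpmul2r// lee_fin; have /andP[] := Lc s.
Qed.

End arclength_parametrization.

Lemma limn_einf0_small {R : realType} (u : (\bar R)^nat) (e : R) n : limn_einf u = 0%E ->
  0 < e -> exists2 m, (n <= m)%N & (u m <= e%:E)%E.
Proof.
move=> u0 e0; apply: contrapT => H.
have ue m : (n <= m)%N -> (e%:E <= u m)%E.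
  by move=> nm; rewrite leNgt; apply/negP => /ltW um; apply: H; exists m.
have : (e%:E <= limn_einf u)%E.
  rewrite limn_einf_lim; apply: lime_ge; first exact: is_cvg_einfs.
  exists n => // k /= nk; apply: le_ereal_inf_tmp => _ [m /= km <-].
  by apply: ue; exact: leq_trans km.
by rewrite u0 lee_fin leNgt e0.
Qed.

Lemma is_derive_pair {R : realType} (f g : R -> R) (t df dg : R) :
  is_derive t 1 f df -> is_derive t 1 g dg ->
  is_derive t 1 (fun s => (f s, g s) : R * R) (df, dg).
Proof.
move=> [Df Ef] [Dg Eg].
have H : (h^-1 *: (((fun s : R => (f s, g s) : R * R) \o shift t) (h *: (1:R)) - (f t, g t)))
    @[h --> 0^'] --> ((df, dg) : R * R).
  have -> : (fun h : R => h^-1 *: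
      (((fun s : R => (f s, g s) : R * R) \o shift t) (h *: (1:R)) - (f t, g t))) =
    (fun h : R => (h^-1 *: ((f \o shift t) (h *: (1:R)) - f t),
                   h^-1 *: ((g \o shift t) (h *: (1:R)) - g t))).
    by apply/funext.
  have c1 : h^-1 *: ((f \o shift t) (h *: (1:R)) - f t) @[h --> 0^'] --> df.
    by rewrite -Ef; exact: Df.
  have c2 : h^-1 *: ((g \o shift t) (h *: (1:R)) - g t) @[h --> 0^'] --> dg.
    by rewrite -Eg; exact: Dg.
  exact: (cvg_pair c1 c2).
apply: DeriveDef; first by apply/cvg_ex; exists (df, dg).
exact: cvg_lim.
Qed.

(** The support is closed and lies in [I], so the function is zero near every point outside [I], and
    its derivative is zero there as well. *)
Lemma test_function_line {R : realType} (I : set R) (phi : R -> R^o) :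
  test_function (V := R^o) I phi ->
  [/\ forall x : R, is_derive x 1 (phi : R -> R) (phi^`()%classic x),
      continuous (phi^`()%classic : R -> R),
      forall x, ~ I x -> phi x = 0 & forall x, ~ I x -> phi^`()%classic x = 0].
Proof.
move=> [/(_ 1%N)[cphi /(_ 1)[dphi [cdphi _]]] _ sI].
have out x : ~ I x -> \forall y \near x, phi y = 0.
  move=> Ix; have : open (~` supp phi) by apply: closed_openC; exact: closed_closure.
  move=> oS; have := open_nbhs_nbhs (conj oS (fun h : supp phi x => Ix (sI _ h))).
  apply: filterS => y H; apply: contrapT => /eqP y0; apply: H.
  exact: subset_closure.
have dE : phi^`()%classic = (fun x => 'D_1 phi x) by apply/funext => x; rewrite derive1E.
split.
- by move=> x; rewrite dE; apply: DeriveDef; [exact: dphi|].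
- by rewrite dE.
- by move=> x /out/nbhs_singleton.
- move=> x /out H; rewrite dE /=.
  have -> : 'D_1 phi x = 'D_1 (cst 0 : R^o -> R^o) x by exact: near_eq_derive.
  by rewrite derive_cst.
Qed.
Section reparametrized_curve.
Context {R : realType}.
Local Notation mu := (@lebesgue_measure R).
Local Notation B := (measurableTypeR R).
Local Notation mu2 := (@lebesgue2 R).
Variables (a b c1 c2 : R) (L S T : R -> R).
Hypotheses (ab : a <= b) (mL : measurable_fun setT (L : B -> R)) (c10 : 0 < c1)
  (Lc : forall s, c1 <= L s <= c2)
  (SL : forall s t, s <= t -> S t - S s = \int[mu]_(x in `[s, t]) L x)
  (ST : cancel S T) (TS : cancel T S).
Variables (x1 x2 v1 v2 : R -> R) (gam : R -> R * R).
Hypotheses (p1 : prim a b x1 v1) (p2 : prim a b x2 v2)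
  (gamE : forall t, t \in `[S a, S b] -> gam t = (x1 (T t), x2 (T t))).

Let q1 := prim_arclength mL c10 Lc SL ST TS p1.
Let q2 := prim_arclength mL c10 Lc SL ST TS p2.
Let w1 t := v1 (T t) / L (T t).
Let w2 t := v2 (T t) / L (T t).
Let I : set R := `]S a, S b[%classic.
Let J : set R := `[S a, S b]%classic.
Let X s := (x1 s, x2 s).

Let IJ : I `<=` J.
Proof. by move=> t; rewrite /I /J/= !in_itv/= => /andP[/ltW -> /ltW ->]. Qed.

(** A point of the open interval has a neighbourhood on which [gamE] applies, so [gam] inherits the
    derivative of the pair [x1 \o T], [x2 \o T] off the null sets of the two coordinates. *)
Lemma reparametrized_ae_derive : exists N : set R, [/\ measurable (N : set B),
  mu N = 0%E & forall t, I t -> ~ N t -> is_derive t 1 gam (w1 t, w2 t)].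
Proof.
have [N1 [mN1 N10 sub1]] := prim_ae_derive q1.
have [N2 [mN2 N20 sub2]] := prim_ae_derive q2.
exists (N1 `|` N2); split; [exact: measurableU|exact: null_set_setU|].
move=> t It Nt.
have d1 : is_derive t 1 (x1 \o T) (w1 t).
  by apply: contrapT => H; apply: Nt; left; exact: sub1.
have d2 : is_derive t 1 (x2 \o T) (w2 t).
  by apply: contrapT => H; apply: Nt; right; exact: sub2.
have nearE : \forall s \near t, gam s = ((x1 \o T) s, (x2 \o T) s).
  have oI : open I by exact: interval_open.
  by apply: filterS (open_nbhs_nbhs (conj oI It)) => s /IJ; exact: gamE.
have [D E] := is_derive_pair d1 d2.
apply: DeriveDef.
  by apply: near_eq_derivable D; apply: filterS nearE => s ->.
by rewrite -E; apply: near_eq_derive.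
Qed.

Variables (f g1 g2 h k1 k2 : R * R -> R) (N : set R).
Hypotheses (intf : mu2.-integrable setT (EFin \o f))
  (intg1 : mu2.-integrable setT (EFin \o g1))
  (intg2 : mu2.-integrable setT (EFin \o g2))
  (mN : measurable (N : set B)) (N0 : mu N = 0%E)
  (hf : forall s, s \in `[a, b] -> ~ N s ->
    [/\ h (X s) = f (X s), k1 (X s) = g1 (X s) & k2 (X s) = g2 (X s)]).
Hypotheses
  (fX : (\int[mu]_(s in `[a, b]) `|f (X s)|%:E < +oo)%E)
  (g1X : (\int[mu]_(s in `[a, b]) `|g1 (X s)|%:E < +oo)%E)
  (g2X : (\int[mu]_(s in `[a, b]) `|g2 (X s)|%:E < +oo)%E).
Hypothesis weak : \forall n \near \oo, forall s, s \in `[a, b] ->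
  \int[mu2]_y (f y * (dmol n (x1 s - y.1) * mol n (x2 s - y.2))) = mollify n g1 (X s) /\
  \int[mu2]_y (f y * (mol n (x1 s - y.1) * dmol n (x2 s - y.2))) = mollify n g2 (X s).
Hypothesis err_small : forall (e : R) n, 0 < e -> exists2 m, (n <= m)%N &
  (\int[mu]_(s in `[a, b])
    (mol_err m f (X s) + mol_err m g1 (X s) + mol_err m g2 (X s)) <= e%:E)%E.

Let mT : measurable_fun setT (T : B -> B).
Proof.
by apply: continuous_measurable_fun; exact: (arclength_inverse_continuous mL c10 Lc SL TS).
Qed.

Let mX : measurable_fun setT ((fun s => X s) : B -> B * B).
Proof.
apply: measurable_fun_pair; apply: continuous_measurable_fun.
  exact: prim_continuous p1.
exact: prim_continuous p2.
Qed.

Let mint (F : R * R -> R) : mu2.-integrable setT (EFin \o F) ->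
  measurable_fun setT (F : B * B -> R).
Proof. by move=> iF; apply/measurable_EFinP; exact: measurable_int iF. Qed.

Let mFX (F : R * R -> R) : mu2.-integrable setT (EFin \o F) ->
  measurable_fun setT ((fun s => F (X s)) : B -> R).
Proof. by move=> /mint mF; exact: (measurableT_comp mF mX). Qed.

Let mFXT (F : R * R -> R) : mu2.-integrable setT (EFin \o F) ->
  measurable_fun setT ((fun t => F (X (T t))) : B -> R).
Proof. by move=> /mFX mF; exact: (measurableT_comp mF mT). Qed.

Let c20 : 0 < c2.
Proof. by have /andP[h1 h2] := Lc 0; rewrite (lt_le_trans c10)// (le_trans h1). Qed.

Let iFXT (F : R * R -> R) : mu2.-integrable setT (EFin \o F) ->
  (\int[mu]_(s in `[a, b]) `|F (X s)|%:E < +oo)%E ->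
  mu.-integrable J (fun t => (F (X (T t)))%:E).
Proof.
move=> iF Foo; apply/integrableP; split.
  by apply: measurable_funTS; apply/measurable_EFinP; exact: mFXT.
have mF : measurable_fun setT ((fun s => `|F (X s)|%:E) : B -> \bar R).
  by apply/measurable_EFinP; apply: measurableT_comp => //; exact: mFX.
apply: (le_lt_trans (ge0_integral_reparam_le a b mL c10 Lc SL ST TS mF _)).
  by move=> s; rewrite lee_fin.
by rewrite lte_mul_pinfty// lee_fin ltW.
Qed.

Let TI t : J t -> T t \in `[a, b].
Proof. exact: (arclength_inverse_itv mL c10 Lc SL TS). Qed.

Let mI : measurable (I : set B). Proof. exact: measurable_itv. Qed.
Let mJ : measurable (J : set B). Proof. exact: measurable_itv. Qed.

Let G t := w1 t * g1 (X (T t)) + w2 t * g2 (X (T t)).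

Let iG : mu.-integrable J (fun t => (G t)%:E).
Proof.
have aux (w y F : R -> R) : prim (S a) (S b) y w -> mu.-integrable J (fun t => (F t)%:E) ->
    mu.-integrable J (fun t => (w t * F t)%:E).
  move=> [mw [M wM] _ _] iF.
  rewrite (_ : (fun t => _) = ((EFin \o w) \* (fun t => (F t)%:E))%E)//.
  apply: integrableMr => //; first exact: measurable_funTS.
  by exists M; split; [exact: num_real|move=> K /ltW MK t _; exact: le_trans (wM t) MK].
by apply: (integrableD mJ (aux _ _ _ q1 (iFXT intg1 g1X)) (aux _ _ _ q2 (iFXT intg2 g2X))).
Qed.

Let mG : measurable_fun setT (G : B -> R).
Proof.
have [m1 _ _ _] := q1; have [m2 _ _ _] := q2.
by apply: measurable_funD; apply: measurable_funM => //; exact: mFXT.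
Qed.

(** [curve_chain_rule] is applied on [[S a, S b]] to the curve in the new parameter. Off a null set
    [M] of parameters, [h], [k1], [k2] may be replaced by [f], [g1], [g2], and the derivative of
    [gam] by the densities. *)
Lemma reparametrized_W11 : W11_with_derivative I (fun t => h (gam t))
  (fun t => (gam^`()%classic t).1 * k1 (gam t) + (gam^`()%classic t).2 * k2 (gam t)).
Proof.
have [N' [mN' N'0 dgam]] := reparametrized_ae_derive.
have mTN : measurable (T @^-1` N : set B) by rewrite -[X in measurable X]setTI; exact: mT.
have TN0 := arclength_null_preimage mL c10 Lc SL ST TS mN N0.
pose M := T @^-1` N `|` N'.
have mM : measurable (M : set B) by exact: measurableU.
have M0 : mu M = 0%E by exact: null_set_setU.
have E1 t : I t -> ~ M t -> h (gam t) = f (X (T t)).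
  move=> /IJ Jt Mt; rewrite gamE//.
  by have [|-> _ _ //] := hf (TI Jt); move=> NT; apply: Mt; left.
have E2 t : I t -> ~ M t ->
    (gam^`()%classic t).1 * k1 (gam t) + (gam^`()%classic t).2 * k2 (gam t) = G t.
  move=> It Mt; have [|_ eg] := dgam t It; first by move=> ?; apply: Mt; right.
  rewrite derive1E eg/= gamE ?(IJ It)//.
  by have [|_ -> -> //] := hf (TI (IJ It)); move=> NT; apply: Mt; left.
have if_ := iFXT intf fX.
split.
- apply: (L1_itv_representative mI (mFXT intf) mM M0 E1).
  exact: integrableS if_.
- apply: (L1_itv_representative mI mG mM M0 E2).
  exact: integrableS iG.
move=> phi /test_function_line[dphi cdphi phi0 dphi0].
have out t : t \notin `[S a, S b] -> phi^`()%classic t = 0.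
  by move=> tJ; apply: dphi0 => /IJ; apply/negP.
have pphi := prim_C1 dphi cdphi out.
have mphi : measurable_fun setT (phi : B -> R).
  by apply: continuous_measurable_fun; exact: prim_continuous pphi.
have mdphi : measurable_fun setT (phi^`()%classic : B -> R).
  exact: continuous_measurable_fun.
rewrite (Rintegral_line_representative (N := M)
    (p := fun t => f (X (T t)) * phi^`()%classic t)) //; last 2 first.
- by apply: measurable_funM => //; exact: mFXT.
- by move=> t It Mt; rewrite E1.
rewrite [in RHS](Rintegral_line_representative (N := M)
    (p := fun t => G t * phi t)) //; last 2 first.
- exact: measurable_funM.
- by move=> t It Mt; rewrite E2.
(* Both [phi] and its derivative vanish off the open interval, so the end points can be added to
   match [curve_chain_rule]. *)
have toJ (F psi : R -> R) : (forall t, ~ I t -> psi t = 0) ->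
    \int[mu]_(t in I) (F t * psi t) = \int[mu]_(t in J) (F t * psi t).
  move=> psi0; rewrite [LHS]Rintegral_mkcond [RHS]Rintegral_mkcond.
  apply: eq_Rintegral => t _; rewrite !patchE.
  have [It|It] := boolP (t \in I).
    by rewrite mem_set//; apply: IJ; exact: set_mem.
  by case: ifP => // _; rewrite psi0 ?mulr0// => H; move/negP: It; apply; rewrite inE.
rewrite (toJ _ _ dphi0) (toJ _ _ phi0).
have Sab : S a <= S b by rewrite (arclength_mono mL c10 Lc SL).
have := @curve_chain_rule R (S a) (S b) (x1 \o T) (x2 \o T) w1 w2 phi _ f g1 g2
  Sab q1 q2 pphi.
have nIa : ~ I (S a) by rewrite /I/= in_itv/= ltxx.
have nIb : ~ I (S b) by rewrite /I/= in_itv/= ltxx andbF.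
move=> /(_ (phi0 _ nIa) (phi0 _ nIb) intf intg1 intg2).
have weakn1 : \forall n \near \oo, forall t, J t ->
  \int[mu2]_y (f y * (dmol n ((x1 \o T) t - y.1) * mol n ((x2 \o T) t - y.2))) =
    mollify n g1 (X (T t)).
  by apply: filterS weak => n H t /TI/H[].
have weakn2 : \forall n \near \oo, forall t, J t ->
  \int[mu2]_y (f y * (mol n ((x1 \o T) t - y.1) * dmol n ((x2 \o T) t - y.2))) =
    mollify n g2 (X (T t)).
  by apply: filterS weak => n H t /TI/H[].
move=> /(_ weakn1 weakn2 if_ (iFXT intg1 g1X) (iFXT intg2 g2X)).
have errT (e : R) n : 0 < e -> exists2 m, (n <= m)%N &
    (\int[mu]_(t in J) (mol_err m f (X (T t)) + mol_err m g1 (X (T t)) +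
      mol_err m g2 (X (T t))) <= e%:E)%E.
  (* The passage from time to the new parameter costs a factor [c2], hence [e / c2]. *)
  move=> e0; have [|m nm em] := err_small n (_ : 0 < e / c2); first by rewrite divr_gt0.
  exists m => //.
  pose F x := (mol_err m f x + mol_err m g1 x + mol_err m g2 x)%E.
  have mF : measurable_fun setT ((fun s => F (X s)) : B -> \bar R).
    apply: (measurableT_comp _ mX); apply: emeasurable_funD.
      by apply: emeasurable_funD; apply: measurable_mol_err; exact: mint.
    by apply: measurable_mol_err; exact: mint.
  have F0 s : (0 <= F (X s))%E.
    by apply: adde_ge0; [apply: adde_ge0|]; exact: mol_err_ge0.
  apply: (le_trans (ge0_integral_reparam_le a b mL c10 Lc SL ST TS mF F0)).
  apply: (@le_trans _ _ (c2%:E * (e / c2)%:E)%E).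
    by rewrite lee_wpmul2l ?lee_fin ?(ltW c20).
  by rewrite -EFinM mulrCA mulfV ?mulr1// gt_eqF.
move=> /(_ errT).
have mulb (psi F : R -> R) : measurable_fun setT (psi : B -> R) -> continuous psi ->
    mu.-integrable J (fun t => (F t)%:E) -> mu.-integrable J (fun t => (F t * psi t)%:E).
  move=> mpsi cpsi iF.
  rewrite (_ : (fun t => _) = ((fun t => (F t)%:E) \* (EFin \o psi))%E)//.
  apply: integrableMl => //; first exact: measurable_funTS.
  have := continuous_compact (continuous_subspaceT cpsi) (@segment_compact R (S a) (S b)).
  move=> /compact_bounded[K [Kr KM]]; exists K; split => // M' KM' t Jt.
  by apply: KM => //; exists t.
rewrite RintegralD//; last 2 first.
- by apply: mulb iG => //; exact: prim_continuous pphi.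
- exact: mulb if_.
by rewrite addrC => /eqP; rewrite addr_eq0 => /eqP.
Qed.

End reparametrized_curve.

(** * Sobolev functions along almost every trajectory *)

Section borel_sobolev.
Context {R : realType}.
Local Notation mu := (@lebesgue_measure R).
Local Notation B := (measurableTypeR R).
Local Notation mu2 := (@lebesgue2 R).

(** The last clause is the weak gradient tested against [y |-> mol2 n x y], whose support has to fit
    in [Omega]. Differentiating the kernel in [y] brings a minus sign that cancels the one from the
    integration by parts. *)
Definition borel_W11 (Omega N : set (R * R)) (h k1 k2 f g1 g2 : R * R -> R) : Prop :=
  [/\ mu2.-integrable setT (EFin \o f), mu2.-integrable setT (EFin \o g1),
      mu2.-integrable setT (EFin \o g2),
      forall x, Omega x -> ~ N x -> [/\ h x = f x, k1 x = g1 x & k2 x = g2 x] &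
      forall n x, (forall y, `|x - y| <= n.+1%:R^-1 -> Omega y) ->
        \int[mu2]_y (f y * (dmol n (x.1 - y.1) * mol n (x.2 - y.2))) = mollify n g1 x /\
        \int[mu2]_y (f y * (mol n (x.1 - y.1) * dmol n (x.2 - y.2))) = mollify n g2 x].

Lemma measurable_kernel (k l : R -> R) (x : R * R) : continuous k -> continuous l ->
  measurable_fun setT ((fun y => k (x.1 - y.1) * l (x.2 - y.2)) : B * B -> R).
Proof.
move=> ck cl; apply: measurable_funM.
  apply: (measurableT_comp (f := k : B -> R)); first exact: continuous_measurable_fun.
  by apply: measurable_funB => //; exact: measurable_fst.
apply: (measurableT_comp (f := l : B -> R)); first exact: continuous_measurable_fun.
by apply: measurable_funB => //; exact: measurable_snd.
Qed.

Lemma RintegralN_bounded (f k : R * R -> R) (C : R) : mu2.-integrable setT (EFin \o f) ->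
  measurable_fun setT (k : B * B -> R) -> (forall x, `|k x| <= C) ->
  \int[mu2]_y (f y * - k y) = - \int[mu2]_y (f y * k y).
Proof.
move=> intf mk kC; rewrite -mulN1r -RintegralZl//.
  by apply: eq_Rintegral => y _; rewrite mulrN mulN1r.
by apply: (integrable_mul_bounded intf mk kC).
Qed.

Lemma W11_borel (Omega : set (R * R)) (h k1 k2 : R * R -> R) : open Omega ->
  W11_with_gradient Omega h k1 k2 ->
  exists f g1 g2 N, [/\ measurable (N : set (B * B)), mu2 N = 0%E &
    borel_W11 Omega N h k1 k2 f g1 g2].
Proof.
move=> oO [Lh Lk1 Lk2 W1 W2].
have mO := open_measurable_plane oO.
have mL1 (F : R * R -> R) : L1 Omega F -> measurable_fun (Omega : set (plane R)) (F : plane R -> R).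
  by move=> /integrableP[mF _]; apply/measurable_EFinP.
have [f [N [mf mN N0 fh f0]]] := borel_representative mO (mL1 _ Lh).
have [g1 [N1 [mg1 mN1 N10 gk1 g10]]] := borel_representative mO (mL1 _ Lk1).
have [g2 [N2 [mg2 mN2 N20 gk2 g20]]] := borel_representative mO (mL1 _ Lk2).
have intf := L1_representative mO Lh mf mN fh f0.
have intg1 := L1_representative mO Lk1 mg1 mN1 gk1 g10.
have intg2 := L1_representative mO Lk2 mg2 mN2 gk2 g20.
exists f, g1, g2, (N `|` (N1 `|` N2)); split.
- by do 2! apply: measurableU => //.
- by apply: null_set_setU => //; [exact: measurableU|exact: null_set_setU].
split => //.
  move=> x Ox Nx; rewrite fh ?gk1 ?gk2//.
  - by move=> H; apply: Nx; right; right.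
  - by move=> H; apply: Nx; right; left.
  - by move=> H; apply: Nx; left.
move=> n x box; have tphi := mol2_test_function box.
have [E dE] := @dmol_bounded R n.
have mE u : `|mol n u| <= n.+1%:R / @bump_mass R by rewrite ger0_norm ?mol_ge0// mol_le.
have mm := measurable_mol2r n x.
split.
- have mk := measurable_kernel x (@dmol_continuous R n) (@mol_continuous R n).
  have kC (y : R * R) : `|dmol n (x.1 - y.1) * mol n (x.2 - y.2)| <= E * (n.+1%:R / @bump_mass R).
    by rewrite normrM ler_pM.
  apply/eqP; rewrite -eqr_opp -(RintegralN_bounded intf mk kC).
  rewrite -(Rintegral_representative mO (mL1 _ Lh) mf _ mN N0 fh f0); last first.
    exact: measurableT_comp.
  rewrite /mollify -(Rintegral_representative mO (mL1 _ Lk1) mg1 mm mN1 N10 gk1 g10).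
  rewrite -(W1 _ tphi); apply/eqP; apply: eq_Rintegral => y _.
  by rewrite derive_mol2_e1.
- have mk := measurable_kernel x (@mol_continuous R n) (@dmol_continuous R n).
  have kC (y : R * R) : `|mol n (x.1 - y.1) * dmol n (x.2 - y.2)| <= (n.+1%:R / @bump_mass R) * E.
    by rewrite normrM ler_pM.
  apply/eqP; rewrite -eqr_opp -(RintegralN_bounded intf mk kC).
  rewrite -(Rintegral_representative mO (mL1 _ Lh) mf _ mN N0 fh f0); last first.
    exact: measurableT_comp.
  rewrite /mollify -(Rintegral_representative mO (mL1 _ Lk2) mg2 mm mN2 N20 gk2 g20).
  rewrite -(W2 _ tphi); apply/eqP; apply: eq_Rintegral => y _.
  by rewrite derive_mol2_e2.
Qed.

(** Compactness in its near-covering form: at a point with a ball of radius [e] inside [Omega], half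
    of [e] is spent on moving the centre and half on the size of the box. *)
Lemma near_box_sub (Omega C : set (R * R)) : open Omega -> compact C -> C `<=` Omega ->
  \forall n \near \oo, forall x, C x -> forall y, `|x - y| <= n.+1%:R^-1 -> Omega y.
Proof.
move=> oO /compact_near_coveringP cC CO.
apply: (cC nat \oo (fun n x => forall y, `|x - y| <= n.+1%:R^-1 -> Omega y)) => x Cx.
have [e /= e0 eO] := iffLR (nbhs_ballP _ _) (open_nbhs_nbhs (conj oO (CO _ Cx))).
have e20 : 0 < e / 2 by rewrite divr_gt0.
exists (ball x (e / 2), [set n | n.+1%:R^-1 < e / 2]).
  split; first exact: nbhsx_ballx.
  exact: (near_infty_natSinv_lt (PosNum e20)).
move=> [x' n] [/= xx' ne] y x'y; apply: eO.
move: xx'; rewrite -!ball_normE /ball_ /= => xx'.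
rewrite (splitr e) -(subrKA x') (le_lt_trans (ler_normD _ _))// ltrD//.
exact: le_lt_trans x'y ne.
Qed.

(** The integrability and the error bound asked of a trajectory. No test function occurs, so one
    exceptional set serves all of them. *)
Definition tame_along (a b : R) (X : R -> R * R) (f g1 g2 : R * R -> R) : Prop :=
  [/\ (\int[mu]_(s in `[a, b]) `|f (X s)|%:E < +oo)%E,
      (\int[mu]_(s in `[a, b]) `|g1 (X s)|%:E < +oo)%E,
      (\int[mu]_(s in `[a, b]) `|g2 (X s)|%:E < +oo)%E &
      forall (e : R) n, 0 < e -> exists2 m, (n <= m)%N &
        (\int[mu]_(s in `[a, b])
          (mol_err m f (X s) + mol_err m g1 (X s) + mol_err m g2 (X s)) <= e%:E)%E].

(** The three errors are summed before the liminf is taken, so that a single index makes all of them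
    small. *)
Lemma ae_tame (X : R * R -> R -> R * R) (c : {nonneg R}) (a b : R) (f g1 g2 : R * R -> R) :
  (forall s, measurable_fun setT (X ^~ s : plane R -> B * B)) ->
  (forall q, continuous (X q)) ->
  (forall s (A : set (R * R)), measurable (A : set (B * B)) ->
    (leb2 R [set q | A (X q s)] <= c%:num%:E * mu2 A)%E) ->
  mu2.-integrable setT (EFin \o f) -> mu2.-integrable setT (EFin \o g1) ->
  mu2.-integrable setT (EFin \o g2) ->
  {ae leb2 R, forall q, tame_along a b (X q) f g1 g2}.
Proof.
move=> mX cX domX intf intg1 intg2.
have mint (F : R * R -> R) : mu2.-integrable setT (EFin \o F) ->
    measurable_fun setT (F : B * B -> R).
  by move=> iF; apply/measurable_EFinP; exact: measurable_int iF.
have fin (F : R * R -> R) : mu2.-integrable setT (EFin \o F) ->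
    (\int[mu2]_x `|F x|%:E < +oo)%E by move=> /integrableP[].
have lty (F : R * R -> R) : mu2.-integrable setT (EFin \o F) ->
    {ae leb2 R, forall q, (time_integral X a b (fun x => `|F x|%:E) q < +oo)%E}.
  move=> iF; apply: (ae_time_integral_lty mX cX domX).
  - by apply/measurable_EFinP; apply: measurableT_comp => //; exact: mint.
  - by move=> x; rewrite lee_fin.
  - exact: fin.
pose D n x := (mol_err n f x + mol_err n g1 x + mol_err n g2 x)%E.
have mD n : measurable_fun setT (D n : B * B -> \bar R).
  apply: emeasurable_funD; last by apply: measurable_mol_err; exact: mint.
  by apply: emeasurable_funD; apply: measurable_mol_err; exact: mint.
have D0 n x : (0 <= D n x)%E by apply: adde_ge0; [apply: adde_ge0|]; exact: mol_err_ge0.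
have Dcvg : (\int[mu2]_x D n x)%E @[n --> \oo] --> 0%E.
  have -> : (fun n => \int[mu2]_x D n x)%E = (fun n => \int[mu2]_x mol_err n f x +
      \int[mu2]_x mol_err n g1 x + \int[mu2]_x mol_err n g2 x)%E.
    apply/funext => n; rewrite /D ge0_integralD//.
    - rewrite ge0_integralD//.
      + by move=> x _; exact: mol_err_ge0.
      + by apply: measurable_mol_err; exact: mint.
      + by move=> x _; exact: mol_err_ge0.
      + by apply: measurable_mol_err; exact: mint.
    - by move=> x _; apply: adde_ge0; exact: mol_err_ge0.
    - by apply: emeasurable_funD; apply: measurable_mol_err; exact: mint.
    - by move=> x _; exact: mol_err_ge0.
    - by apply: measurable_mol_err; exact: mint.
  rewrite -[X in _ --> X](_ : 0 + 0 + 0 = 0)%E; last by rewrite !adde0.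
  apply: cvgeD; [by rewrite ?adde0| |by apply: integral_mol_err_cvg; [exact: mint|exact: fin]].
  by apply: cvgeD => //; apply: integral_mol_err_cvg;
    [exact: mint|exact: fin|exact: mint|exact: fin].
have aeT := ae_filter_ringOfSetsType (leb2 R).
have lim0 := ae_time_integral_liminf mX cX domX a b mD D0 Dcvg.
have := @filterI _ _ aeT _ _ (@filterI _ _ aeT _ _ (lty f intf) (lty g1 intg1))
  (@filterI _ _ aeT _ _ (lty g2 intg2) lim0).
apply: filterS => q [[qf qg1] [qg2 qD]]; split => //.
by move=> e n e0; exact: limn_einf0_small.
Qed.

End borel_sobolev.

(** * A single trajectory outside the exceptional set *)

Section good_initial_point.
Context {R : realType}.
Local Notation mu := (@lebesgue_measure R).
Local Notation B := (measurableTypeR R).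
Local Notation mu2 := (@lebesgue2 R).
Variables (Omega N : set (R * R)) (rho c1 c2 M : R) (lambda lam v1 v2 : R * R -> R)
  (v : R * R -> R * R) (Phi X : R -> R * R) (q : R * R).
Hypotheses (oO : open Omega) (rho0 : 0 < rho) (c10 : 0 < c1).
Hypotheses (mlam : measurable_fun setT (lam : B * B -> R))
  (lamc : forall x, c1 <= lam x <= c2)
  (mv1 : measurable_fun setT (v1 : B * B -> R))
  (mv2 : measurable_fun setT (v2 : B * B -> R))
  (v1M : forall x, `|v1 x| <= M) (v2M : forall x, `|v2 x| <= M)
  (mN : measurable (N : set (B * B))) (cX : continuous X)
  (XO : forall s, s \in `[- rho, rho] -> Omega (X s))
  (PhiX : forall s, s \in `[- rho, rho] -> Phi s = X s)
  (agree : forall x, Omega x -> ~ N x ->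
    [/\ lambda x = lam x, (v x).1 = v1 x & (v x).2 = v2 x])
  (XN : mu (`[- rho, rho] `&` [set s | N (X s)]) = 0%E)
  (flow : forall s, s \in `[- rho, rho] -> Phi s =
    q + (int0 (fun t => (v (Phi t)).1) s, int0 (fun t => (v (Phi t)).2) s)).

Let I0 : set R := `[- rho, rho]%classic.
Let l s := lambda (Phi s).
Let gam t := Phi ('pinv_(fun=> 0) `[- rho, rho] (int0 l) t).
Let J : set R := `[int0 l (- rho), int0 l rho]%classic.
Let I : set R := `]int0 l (- rho), int0 l rho[%classic.

Let Nl : set R := I0 `&` [set s | N (X s)].

Let mX : measurable_fun setT (X : B -> B * B).
Proof.
rewrite (_ : X = fun s => ((X s).1, (X s).2)); last by apply/funext => s; case: (X s).
apply: measurable_fun_pair; apply: continuous_measurable_fun => s; apply: cvg_comp; try exact: cX.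
- exact: cvg_fst.
- exact: cvg_snd.
Qed.

Let mI0 : measurable (I0 : set B). Proof. exact: measurable_itv. Qed.

Let mNl : measurable (Nl : set B).
Proof. by apply: measurableI => //; rewrite -[X in measurable X]setTI; exact: mX. Qed.

Let r0 : - rho <= 0. Proof. by rewrite oppr_le0 ltW. Qed.
Let rr : - rho <= rho. Proof. exact: (le_trans r0 (ltW rho0)). Qed.

Let good s : s \in `[- rho, rho] -> ~ Nl s ->
  [/\ l s = lam (X s), (v (Phi s)).1 = v1 (X s) & (v (Phi s)).2 = v2 (X s)].
Proof.
move=> sI Ns; rewrite /l PhiX//; apply: agree; first exact: XO.
by move=> NX; apply: Ns; split.
Qed.

(** The flow equation exhibits a coordinate as a primitive of [vi] along [Phi]. Off a null set of
    times this is the Borel function [u] along [X], and cutting it off outside [[-rho, rho]] gives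
    the density. *)
Let component (u : R * R -> R) (vi proj : R * R -> R) :
  measurable_fun setT (u : B * B -> R) -> (forall x, `|u x| <= M) ->
  (forall s, s \in `[- rho, rho] -> ~ Nl s -> vi (Phi s) = u (X s)) ->
  (forall s, s \in `[- rho, rho] -> proj (Phi s) = proj q + int0 (fun t => vi (Phi t)) s) ->
  exists x p, prim (- rho) rho x p /\
    forall s, s \in `[- rho, rho] -> x s = proj (X s).
Proof.
move=> mu' uM vu eqn.
have M0 : 0 <= M by rewrite (le_trans _ (uM 0)).
pose p s : R := if s \in I0 then u (X s) else 0.
have mp : measurable_fun setT (p : B -> R).
  rewrite (_ : p = (u \o X) \_ I0); last by apply/funext => s; rewrite patchE.
  apply: (iffLR (measurable_restrictT _ mI0)); apply: measurable_funTS.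
  exact: (measurableT_comp mu' mX).
have pM s : `|p s| <= M by rewrite /p; case: ifP => // _; rewrite normr0.
have p0 s : s \notin `[- rho, rho] -> p s = 0.
  by move=> sI; rewrite /p memNset//; exact/negP.
have := prim_integral mp pM p0; set P := (fun t => _) => pP.
have [m1 m2 m3 PI] := pP.
exists (fun s => proj q + (P s - P 0)), p; split.
  by split => // s t st; rewrite -PI//; ring.
move=> s sI; rewrite -PhiX// eqn//; congr (_ + _); apply/esym.
have /andP[s1 s2] : (- rho <= s) && (s <= rho) by move: sI; rewrite in_itv.
apply: (int0_representative (A := I0) mp mNl XN) => //.
- by move=> t tI Nt; rewrite vu// /p mem_set.
- move=> t /=; rewrite /I0/= !in_itv/= => /andP[t0 ts].
  by rewrite (le_trans r0 t0) (le_trans ts s2).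
- move=> t /=; rewrite /I0/= !in_itv/= => /andP[t0 ts].
  by rewrite (le_trans s1 t0) (le_trans ts (ltW rho0)).
Qed.

(** The initial point is fixed here, and every exceptional set has become a hypothesis on its
    trajectory. The functions [h], [k1], [k2] and their representatives are quantified inside the
    conclusion because it serves for each component of [w]. *)
Lemma good_initial_point :
  [/\ L1_itv `[- rho, rho] l, set_bij `[- rho, rho] J (int0 l),
      strictly_increasing_on J ('pinv_(fun=> 0) `[- rho, rho] (int0 l)) &
      bilipschitz_on J ('pinv_(fun=> 0) `[- rho, rho] (int0 l))] /\
  {ae leb1 R, forall t, I t -> derivable gam t 1} /\
  forall f g1 g2 h k1 k2 : R * R -> R, borel_W11 Omega N h k1 k2 f g1 g2 ->
    tame_along (- rho) rho X f g1 g2 ->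
    W11_with_derivative I (fun t => h (gam t))
      (fun t => (gam^`()%classic t).1 * k1 (gam t) + (gam^`()%classic t).2 * k2 (gam t)).
Proof.
(* Setting the speed to [c1] outside the time interval keeps its bounds on the whole line, where [S]
   is then invertible. *)
pose L s := if s \in I0 then lam (X s) else c1.
have c12 : c1 <= c2 by have /andP[h1 h2] := lamc 0; exact: le_trans h2.
have mL : measurable_fun setT (L : B -> R).
  rewrite (_ : L = fun s => ((fun s => lam (X s) - c1) \_ I0) s + c1); last first.
    by apply/funext => s; rewrite /L patchE; case: ifP; rewrite ?subrK ?add0r.
  apply: measurable_funD; last exact: measurable_cst.
  apply: (iffLR (measurable_restrictT _ mI0)); apply: measurable_funTS.
  by apply: measurable_funB; [exact: (measurableT_comp mlam mX)|exact: measurable_cst].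
have Lc s : c1 <= L s <= c2 by rewrite /L; case: ifP => // _; rewrite lexx.
have L1 s : s \notin `[- rho, rho] -> L s = c1.
  by move=> sI; rewrite /L memNset//; exact/negP.
have lL s : s \in `[- rho, rho] -> ~ Nl s -> l s = L s.
  by move=> sI Ns; have [-> _ _] := good sI Ns; rewrite /L mem_set.
have [S [SL S0]] := arclength_primitive mL Lc L1.
have [T [ST TS _]] := arclength_inverse mL c10 Lc SL.
have rI : - rho \in `[- rho, rho] by rewrite in_itv/= lexx.
have rI' : rho \in `[- rho, rho] by rewrite in_itv/= lexx andbT.
have SE := int0_arclength r0 (ltW rho0) mL mNl XN lL SL S0.
split.
  split.
  - exact: (L1_itv_speed mL c10 Lc mNl XN lL).
  - exact: (arclength_set_bij r0 (ltW rho0) mL c10 Lc mNl XN lL SL S0 ST TS).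
  - exact: (arclength_increasing r0 (ltW rho0) mL c10 Lc mNl XN lL SL S0 ST TS).
  - exact: (arclength_bilipschitz r0 (ltW rho0) mL c10 Lc mNl XN lL SL S0 ST TS).
have [x1 [u1 [p1 x1X]]] : exists x p, prim (- rho) rho x p /\
    forall s, s \in `[- rho, rho] -> x s = (X s).1.
  apply: (component (vi := fun x => (v x).1) mv1 v1M).
    by move=> s sI Ns; have [] := good sI Ns.
  by move=> s sI; rewrite flow.
have [x2 [u2 [p2 x2X]]] : exists x p, prim (- rho) rho x p /\
    forall s, s \in `[- rho, rho] -> x s = (X s).2.
  apply: (component (vi := fun x => (v x).2) mv2 v2M).
    by move=> s sI Ns; have [] := good sI Ns.
  by move=> s sI; rewrite flow.
have xX s : s \in `[- rho, rho] -> (x1 s, x2 s) = X s.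
  by move=> sI; rewrite x1X// x2X//; case: (X s).
have gamE t : t \in `[S (- rho), S rho] -> gam t = (x1 (T t), x2 (T t)).
  move=> tJ; rewrite /gam.
  rewrite (pinv_arclength r0 (ltW rho0) mL c10 Lc mNl XN lL SL S0 ST TS tJ).
  have TI := arclength_inverse_itv mL c10 Lc SL TS tJ.
  by rewrite PhiX// xX.
have IE : I = `]S (- rho), S rho[%classic by rewrite /I !SE.
rewrite IE; split.
  have [N' [mN' N'0 dgam]] := reparametrized_ae_derive mL c10 Lc SL ST TS p1 p2 gamE.
  exists N'; split; [exact: measurable_line|exact: N'0|].
  move=> t /= H; apply: contrapT => Nt; apply: H => It.
  by have [] := dgam t It Nt.
move=> f g1 g2 h k1 k2 [intf intg1 intg2 hfg weak] [fX g1X g2X small].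
have toX (F : R * R -> \bar R) : (\int[mu]_(s in I0) F (x1 s, x2 s) =
    \int[mu]_(s in I0) F (X s))%E.
  by apply: eq_integral => s; rewrite inE => sI; rewrite xX.
apply: (reparametrized_W11 rr mL c10 Lc SL ST TS p1 p2 gamE intf intg1 intg2 mNl XN).
- move=> s sI Ns; rewrite xX//; apply: hfg; first exact: XO.
  by move=> NX; apply: Ns; split.
- by rewrite (toX (fun x => `|f x|%:E)).
- by rewrite (toX (fun x => `|g1 x|%:E)).
- by rewrite (toX (fun x => `|g2 x|%:E)).
(* The trajectory is a compact subset of [Omega], so for large [n] every box centred on it fits in
   [Omega], uniformly in time. *)
- have cC : compact (X @` I0).
    by apply: continuous_compact; [exact: continuous_subspaceT|exact: segment_compact].
  have CO : X @` I0 `<=` Omega by move=> _ [s sI <-]; exact: XO.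
  apply: filterS (near_box_sub oO cC CO) => n box s sI.
  have := weak n (X s) (box (X s) _); rewrite -xX//=; apply.
  by rewrite xX//; exists s.
- move=> e n e0; have [m nm em] := small e n e0; exists m; first exact: nm.
  have := toX (fun x => mol_err m f x + mol_err m g1 x + mol_err m g2 x)%E.
  by move=> ->; exact: em.
Qed.

End good_initial_point.

Lemma borel_W11_sub {R : realType} (Omega N N' : set (R * R))
    (h k1 k2 f g1 g2 : R * R -> R) : N `<=` N' ->
  borel_W11 Omega N h k1 k2 f g1 g2 -> borel_W11 Omega N' h k1 k2 f g1 g2.
Proof.
by move=> NN' [intf intg1 intg2 hf weak]; split => // x Ox N'x; apply: hf => // /NN'.
Qed.

Lemma Linfty_representative {R : realType} (Omega : set (R * R)) (f : R * R -> R) :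
  measurable (Omega : set (measurableTypeR R * measurableTypeR R)%type) ->
  Linfty Omega f ->
  exists f' N M, [/\ measurable_fun setT
      (f' : measurableTypeR R * measurableTypeR R -> R),
    measurable (N : set (measurableTypeR R * measurableTypeR R)%type),
    lebesgue2 N = 0%E, (forall x, Omega x -> ~ N x -> f' x = f x) &
    forall x, `|f' x| <= M].
Proof.
move=> mO [mf [M fM]].
(* The bound [M] may be negative when [Omega] is a null set, hence the absolute value. *)
have MM : - `|M| <= `|M| by rewrite (@le_trans _ _ 0)// oppr_le0.
have fM' : {ae leb2 R, forall x, Omega x -> - `|M| <= f x <= `|M|}.
  apply: (@filterS _ _ (ae_filter_ringOfSetsType (leb2 R)) _ _ _ fM) => x fx Ox; rewrite -ler_norml.
  exact: le_trans (fx Ox) (ler_norm M).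
have [f' [N [mf' mN N0 f'f f'M]]] := bounded_representative mO MM mf fM'.
by exists f', N, `|M|; split => // x; rewrite ler_norml.
Qed.

Theorem theorem9p1 (R : realType) (Omega : set (R * R)) (v : R * R -> R * R)
    (K : set (R * R)) :
  open Omega ->
  BV_vec Omega v -> Linfty_vec Omega v -> bounded_divergence Omega v ->
  compact K -> K `<=` Omega ->
  \forall rho \near 0^'+,
  forall (lambda : R * R -> R) (c1 c2 : R)
    (w : R * R -> R * R) (Dw : R * R -> (R * R) * (R * R))
    (Phi : R * R -> R -> R * R),
  measurable_fun (Omega : set (plane R)) (lambda : plane R -> R) ->
  0 < c1 -> {ae leb2 R, forall x, Omega x -> c1 <= lambda x <= c2} ->
  W11_vec_with_gradient Omega w Dw ->
  regular_lagrangian_flow K rho v Phi ->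
  (forall q s, K q -> s \in `[- rho, rho] -> Omega (Phi q s)) ->
  {ae leb2 R, forall q, K q ->
    let sigma_q := sigma Phi lambda q in
    let tau_q := tau rho Phi lambda q in
    let gamma_q := gamma rho Phi lambda q in
    let J := `[sigma_q (- rho), sigma_q rho]%classic in
    let I := `]sigma_q (- rho), sigma_q rho[%classic in
    [/\ L1_itv `[- rho, rho] (fun s => lambda (Phi q s)),
        set_bij `[- rho, rho] J sigma_q,
        strictly_increasing_on J tau_q &
        bilipschitz_on J tau_q] /\
    {ae leb1 R, forall t, I t -> derivable gamma_q t 1} /\
    W11_curve_with_derivative I (w \o gamma_q)
      (fun t => apply_jacobian (Dw (gamma_q t)) (gamma_q^`()%classic t))}.
Proof.
move=> oO _ [Lv1 Lv2] _ cK KO; near=> rho.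
have rho0 : 0 < rho by near: rho; exact: nbhs_right_gt.
move=> lambda c1 c2 w Dw Phi mlambda c10 lambdac [Ww1 Ww2] flowPhi PhiO.
have mO := open_measurable_plane oO.
(* When [Omega] is a null set [c2] may be smaller than [c1]; the maximum keeps the interval of
   values nonempty. *)
have c12 : c1 <= Num.max c1 c2 by rewrite le_max lexx.
have lambdac' : {ae leb2 R, forall x, Omega x -> c1 <= lambda x <= Num.max c1 c2}.
  apply: (@filterS _ _ (ae_filter_ringOfSetsType (leb2 R)) _ _ _ lambdac) => x cx Ox.
  have /andP[h1 h2] := cx Ox.
  by rewrite h1 le_max h2 orbT.
have [lam [N0 [mlam mN0 N00 lamE lamc]]] := bounded_representative mO c12 mlambda lambdac'.
have [v1 [N1 [M1 [mv1 mN1 N10 v1E v1M]]]] := Linfty_representative mO Lv1.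
have [v2 [N2 [M2 [mv2 mN2 N20 v2E v2M]]]] := Linfty_representative mO Lv2.
have [f1 [g11 [g12 [N3 [mN3 N30 bW1]]]]] := W11_borel oO Ww1.
have [f2 [g21 [g22 [N4 [mN4 N40 bW2]]]]] := W11_borel oO Ww2.
(* One null set for [lambda], [v] and both components of [w]: a trajectory that meets it only at a
   null set of times is good for all the representatives. *)
pose N := N0 `|` (N1 `|` (N2 `|` (N3 `|` N4))).
have mN34 := measurableU _ _ mN3 mN4.
have mN24 := measurableU _ _ mN2 mN34.
have mN14 := measurableU _ _ mN1 mN24.
have mN : measurable (N : set (measurableTypeR R * measurableTypeR R)%type).
  exact: measurableU.
have NN : lebesgue2 N = 0%E.
  apply: null_set_setU mN0 mN14 N00 _; apply: null_set_setU mN1 mN24 N10 _.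
  apply: null_set_setU mN2 mN34 N20 _; exact: null_set_setU mN3 mN4 N30 N40.
have {}bW1 : borel_W11 Omega N (fun x => (w x).1) (fun x => (Dw x).1.1)
    (fun x => (Dw x).2.1) f1 g11 g12.
  by apply: borel_W11_sub bW1 => x N3x; do 3 right; left.
have {}bW2 : borel_W11 Omega N (fun x => (w x).2) (fun x => (Dw x).1.2)
    (fun x => (Dw x).2.2) f2 g21 g22.
  by apply: borel_W11_sub bW2 => x N4x; do 4 right.
have agree x : Omega x -> ~ N x ->
    [/\ lambda x = lam x, (v x).1 = v1 x & (v x).2 = v2 x].
  move=> Ox Nx; rewrite lamE ?v1E ?v2E//.
  - by move=> N2x; apply: Nx; right; right; left.
  - by move=> N1x; apply: Nx; right; left.
  - by move=> N0x; apply: Nx; left.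
pose X := ext_flow K rho Phi.
have mX := measurable_ext_flow cK rho0 flowPhi.
have cX := ext_flow_continuous rho0 flowPhi.
have [c domX] := ext_flow_dom cK rho0 flowPhi.
have aeN := ae_time_integral0 mX cX domX (- rho) rho mN NN.
have [if1 ig11 ig12 _ _] := bW1; have [if2 ig21 ig22 _ _] := bW2.
have tame1 := ae_tame (- rho) rho mX cX domX if1 ig11 ig12.
have tame2 := ae_tame (- rho) rho mX cX domX if2 ig21 ig22.
have [_ _ aeflow _] := flowPhi.
have aeF := ae_filter_ringOfSetsType (leb2 R).
have := @filterI _ _ aeF _ _ (@filterI _ _ aeF _ _ aeflow aeN)
  (@filterI _ _ aeF _ _ tame1 tame2).
apply: (@filterS _ _ aeF) => q [[flowq Nq] [t1 t2]] Kq.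
have XPhi s : s \in `[- rho, rho] -> Phi q s = X q s.
  by move=> sI; rewrite /X /ext_flow mem_set// clamp_id.
have XO s : s \in `[- rho, rho] -> Omega (X q s).
  by move=> sI; rewrite -XPhi//; exact: PhiO.
have [_ _ flowq'] := flowq Kq.
have v1M' x : `|v1 x| <= Num.max M1 M2 by rewrite le_max v1M.
have v2M' x : `|v2 x| <= Num.max M1 M2 by rewrite le_max v2M orbT.
have [param [deriv W11]] := good_initial_point oO rho0 c10 mlam lamc mv1 mv2 v1M' v2M'
  mN (cX q) XO XPhi agree Nq flowq'.
split; first exact: param.
split; first exact: deriv.
by split; [exact: W11 bW1 t1|exact: W11 bW2 t2].
Unshelve. all: by end_near.
Qed.
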